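(* If $(T_n)_{n\in\mathbb{N}}$ is a sequence of estimators in the semi-parametric sequence of experiments $(\mathcal{E}_n)_{n\in\mathbb{N}}$ (i.e. $T_n$ is a real-valued function of $(X_0,\ldots,X_n)$ not depending on $(h,G)$) such that, for all $(h,G)\in[0,\infty)\times\mathcal{G}$, the law of $T_n$ under $\mathbb{P}_{1-h/n^2,G}$ converges weakly to a probability distribution $Z_{h,G}$ on $\mathbb{R}$ with $\int z\,\mathrm{d}Z_{h,G}(z)=h$, then $$\int(z-h)^2\,\mathrm{d}Z_{h,G}(z)\ge\frac{2h}{g(0)\mu_G}\qquad\text{for all }(h,G)\in[0,\infty)\times\mathcal{G}.$$ The estimator $$\tilde h_n=\frac{2\sum_{t=1}^n\mathbf{1}\{\Delta X_t<0\}}{\hat g_n(0)\,\hat\mu_{G,n}},\qquad \hat g_n(0)=\frac1n\sum_{t=1}^n\mathbf{1}\{X_t=X_{t-1}\},\qquad \hat\mu_{G,n}=\frac{X_n}{n},$$ satisfies these conditions and achieves the variance bound (with equality for all $(h,G)\in[0,\infty)\times\mathcal{G}$).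
   Context: Notation: $\mathbb{N}=\{1,2,\ldots\}$, $\mathbb{Z}_+=\mathbb{N}\cup\{0\}$. For a probability distribution $G$ on $\mathbb{Z}_+$, $g$ is its probability mass function, $\mu_G$ its mean and $\sigma_G^2$ its variance. For $\theta\in[0,1]$, under $\mathbb{P}_{\theta,G}$ the INAR(1) process $(X_t)_{t\ge0}$ is defined by $X_0=0$ and $X_t=\vartheta\circ X_{t-1}+\varepsilon_t$ for $t\in\mathbb{N}$, where $\vartheta\circ X_{t-1}=\sum_{j=1}^{X_{t-1}}Z^{(t)}_j$ (an empty sum is $0$), $(Z^{(t)}_j)_{j,t\in\mathbb{N}}$ are i.i.d. Bernoulli variables with success probability $\theta$, and, independently of these, $(\varepsilon_t)_{t\in\mathbb{N}}$ are i.i.d. with distribution $G$. $\Delta X_t=X_t-X_{t-1}$. $\mathbb{P}^{(n)}_{\theta,G}$ is the law of $(X_0,\ldots,X_n)$ under $\mathbb{P}_{\theta,G}$. $\mathcal{G}$ is the set of all probability distributions $G$ on $\mathbb{Z}_+$ such that one of the following holds: (1) the support of $G$ is $\{0,\ldots,M\}$ for some $M\in\mathbb{N}$; (2) the support of $G$ is $\mathbb{Z}_+$, $\sigma_G^2<\infty$, and there is $M\in\mathbb{N}$ with $g(k+1)\le g(k)$ for all $k\ge M$. $\mathcal{E}_n=\bigl(\mathbb{Z}_+^{n+1},2^{\mathbb{Z}_+^{n+1}},(\mathbb{P}^{(n)}_{1-h/n^2,G}\mid(h,G)\in[0,\infty)\times\mathcal{G})\bigr)$, where for fixed $h$ one considers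 $n$ large enough that $1-h/n^2\in[0,1]$. The value assigned to $\tilde h_n$ when its denominator is zero is immaterial (e.g. $0$). *)

(* Defs.v *)
From HB Require Import structures.
From mathcomp Require Import all_boot all_order all_algebra.
From mathcomp Require Import all_classical all_reals all_analysis.

Set Implicit Arguments.
Unset Strict Implicit.
Unset Printing Implicit Defensive.

Import Order.TTheory GRing.Theory Num.Theory.
Import numFieldNormedType.Exports.

Local Open Scope classical_set_scope.
Local Open Scope ring_scope.

(* Distributions on Z_+ are probability measures on [nat], whose sigma-algebra
   is the power set. *)
Section distributions_on_nat.
Context {R : realType}.
Implicit Type G : probability nat R.

Definition pmf_nat G (k : nat) : R := fine (G [set k]).

Definition mean_nat G : R := fine ('E_G[fun k => k%:R])%E.

Definition support_nat G : set nat := [set k | 0 < pmf_nat G k].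

Definition admissible G : Prop :=
  (exists M : nat, (0 < M)%N /\ support_nat G = [set k | (k <= M)%N]) \/
  [/\ support_nat G = setT,
      ('V_G[fun k => k%:R] < +oo)%E &
      exists M : nat, (0 < M)%N /\
        forall k, (M <= k)%N -> pmf_nat G k.+1 <= pmf_nat G k].

End distributions_on_nat.

Definition mutually_independent d (Omega : measurableType d) (R : realType)
    (P : probability Omega R) d' (T : measurableType d') (I : eqType)
    (X : I -> Omega -> T) : Prop :=
  forall (s : seq I) (A : I -> set T), uniq s -> (forall i, measurable (A i)) ->
    P (\bigcap_(i in [set` s]) (X i @^-1` A i)) =
    (\prod_(i <- s) P (X i @^-1` A i))%E.

(* Time and summation indices are shifted to start at 0: [Z t j] is the
   Bernoulli variable Z^{(t+1)}_{j+1} and [eps t] is epsilon_{t+1}.  The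
   clauses "the Z's are i.i.d., the eps's are i.i.d., and the two families are
   independent" amount to mutual independence of the joint family together with
   the marginal laws. *)
Section inar.
Context {d : measure_display} {Omega : measurableType d} {R : realType}.
Variables (Z : nat -> nat -> {mfun Omega >-> bool})
          (eps : nat -> {mfun Omega >-> nat}).

Definition noise (i : nat * nat + nat) : Omega -> nat :=
  match i with
  | inl tj => fun w => nat_of_bool (Z tj.1 tj.2 w)
  | inr t => eps t
  end.

Definition inar_noise (P : probability Omega R) (theta : R)
    (G : probability nat R) : Prop :=
  [/\ forall t j, distribution P (Z t j) = bernoulli_prob theta :> (set bool -> \bar R),
      forall t, distribution P (eps t) = G :> (set nat -> \bar R) &
      mutually_independent P noise].

Fixpoint inar (t : nat) (w : Omega) : nat :=
  if t is s.+1 then (\sum_(j < inar s w) Z s j w + eps s w)%N else 0%N.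

Lemma measurable_inar t : measurable_fun setT (inar t).
Proof.
elim: t => [|t IH]; first exact: measurable_cst.
pose S k w := (\sum_(j < k) Z t j w + eps t w)%N.
have mS k : measurable_fun setT (S k).
  rewrite /S; elim: k => [|k IHk].
    under eq_fun do rewrite big_ord0 add0n.
    exact: measurable_funPT.
  have -> : (fun w => (\sum_(j < k.+1) Z t j w + eps t w)%N) =
      (fun w => if Z t k w then (S k w).+1 else S k w).
    apply/funext => w; rewrite /S big_ord_recr /=; case: (Z t k w) => /=.
      by rewrite addn1 addSn.
    by rewrite addn0.
  apply: measurable_fun_ifT => //.
  exact: (measurableT_comp (f := succn)).
move=> _ A mA; rewrite setTI.
have -> : inar t.+1 @^-1` A =
    \bigcup_k ((inar t @^-1` [set k]) `&` (S k @^-1` A)).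
  apply/seteqP; split=> [w /= Aw|w [k _ [/= <- //]]].
  by exists (inar t w).
apply: bigcup_measurable => k _; apply: measurableI.
  by rewrite -[X in measurable X]setTI; exact: IH.
by rewrite -[X in measurable X]setTI; exact: mS.
Qed.

Definition trajectory (n : nat) (w : Omega) : n.+1.-tuple nat :=
  [tuple inar i w | i < n.+1].

Lemma measurable_trajectory n : measurable_fun setT (trajectory n).
Proof.
apply/measurable_fun_tnthP => i.
rewrite [X in measurable_fun _ X](_ : _ = inar i); first exact: measurable_inar.
by apply/funext => w /=; rewrite tnth_mktuple.
Qed.

HB.instance Definition _ n := isMeasurableFun.Build _ _ _ _
  (trajectory n) (@measurable_trajectory n).

(* The law of (X_0, ..., X_n) on Z_+^{n+1}. *)
Definition inar_law (P : probability Omega R) (n : nat) :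
  probability (n.+1.-tuple nat) R := distribution P (trajectory n).

End inar.

(* The library equips tuples with the product sigma-algebra, which over [nat]
   is the power set: any function on Z_+^n is a statistic. *)
Lemma measurable_tuple_nat n (A : set (n.-tuple nat)) : measurable A.
Proof.
apply: countable_measurable => [x|]; last exact: countableP.
have -> : [set x] =
    \bigcap_(i in [set: 'I_n]) ((@tnth n nat ^~ i) @^-1` [set tnth x i]).
  apply/seteqP; split=> [y /= -> //|y /= xy].
  by apply: eq_from_tnth => i; exact: xy.
apply: fin_bigcap_measurable => // i _.
by rewrite -[X in measurable X]setTI; exact: measurable_tnth.
Qed.

Section estimators.
Context {R : realType}.

Definition statistic n (T : n.-tuple nat -> R) : n.-tuple nat -> R := T.

Lemma measurable_statistic n (T : n.-tuple nat -> R) :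
  measurable_fun setT (statistic T).
Proof. by move=> _ A _; exact: measurable_tuple_nat. Qed.

HB.instance Definition _ n (T : n.-tuple nat -> R) :=
  isMeasurableFun.Build _ _ _ _ (statistic T) (@measurable_statistic n T).

Definition weak_cvg (mu : nat -> probability R R) (nu : probability R R) :=
  forall f : R -> R, continuous f -> bounded_fun f ->
    (\int[mu n]_x (f x)%:E)%E @[n --> \oo] --> (\int[nu]_x (f x)%:E)%E.

(* [h / n ^ 2] leaves [0, 1] only for finitely many [n]; the laws at those
   indices are irrelevant to the limit. *)
Definition asymptotically_unbiased d (Omega : measurableType d)
    (Z : nat -> nat -> {mfun Omega >-> bool})
    (eps : nat -> {mfun Omega >-> nat})
    (P : R -> probability nat R -> probability Omega R)
    (T : forall n, n.+1.-tuple nat -> R)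
    (L : R -> probability nat R -> probability R R) : Prop :=
  forall (h : R) (G : probability nat R), 0 <= h -> admissible G ->
    weak_cvg (fun n => distribution
      (inar_law Z eps (P (1 - h / n%:R ^+ 2) G) n) (statistic (@T n))) (L h G)
    /\ ('E_(L h G)[id] = h%:E)%E.

Definition increment n (x : n.-tuple nat) (t : nat) : int :=
  (nth 0%N x t)%:Z - (nth 0%N x t.-1)%:Z.

Definition g0_hat n (x : n.+1.-tuple nat) : R :=
  n%:R^-1 * \sum_(1 <= t < n.+1) (nth 0%N x t == nth 0%N x t.-1)%:R.

Definition mu_hat n (x : n.+1.-tuple nat) : R := (nth 0%N x n)%:R / n%:R.

(* Division by zero is zero. *)
Definition h_tilde n (x : n.+1.-tuple nat) : R :=
  2 * (\sum_(1 <= t < n.+1) (increment x t < 0)%R%:R) / (g0_hat x * mu_hat x).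

Definition variance_bound (h : R) (G : probability nat R) : R :=
  2 * h / (pmf_nat G 0 * mean_nat G).

End estimators.

(* Main.v *)
Require Import Defs.
From HB Require Import structures.
From mathcomp Require Import all_boot all_order all_algebra.
From mathcomp Require Import all_classical all_reals all_analysis.
From mathcomp Require Import measurable_realfun.
From mathcomp Require Import ring lra zify.

(** When the thinning parameter is [1 - h / n ^ 2], deaths are rare.  Up to time
    [n] the population stays close to the line [t * mu], so that about
    [mu * h / 2] deaths occur in total; hardly any two of them occur at the same
    time, and most are hidden by a simultaneous arrival.  A death is visible, as
    a decrease of the process, when no individual arrives at that time, which
    has probability [g 0].  Hence the data are asymptotically worth one
    observation of a Poisson variable of mean [lam * h], with
    [lam = g 0 * mu / 2].  In that experiment the best unbiased estimator of [h]
    is the observation divided by [lam], of variance [h / lam], and this is the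
    bound of the theorem.

    The lower bound does not need the convergence of the experiments.  It
    follows from the inequality of Hammersley, Chapman and Robbins between two
    rates [h < h'] at the same law [G], which asks only for an upper bound on
    the second moment of the likelihood ratio.  Since a lower bound on
    expectations may be restricted to a set of paths, only paths that stay in a
    corridor and lose at most one individual at each step are kept
    ([truncated_hcr]); their probabilities are products of explicit kernels
    ([Pr_path_event]).  The one-step estimate [thin_kernel_chi2] carries the
    proof: by [admissible_ratio] the probabilities [g k] increase at most by a
    constant factor, so a death hidden by an arrival changes the likelihood
    only to second order, and the visible deaths contribute
    [g 0 * x * (a' - a) ^ 2 / a] from the state [x].  Summed along
    [x = t * mu] this yields [lam * (h' - h) ^ 2 / h] ([path_chi2_near]), as for
    two Poisson laws.  Weak convergence transfers the inequality to the limit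
    laws for bounded continuous functions ([hcr_limit]); clamped versions of the
    identity and the choice of [h'] close to [h] give [variance_lower_bound].

    For the estimator, the decreases of the process are compared with proxies,
    in which the population has the deterministic size [truncn (t * mu)].  The
    proxies are independent, so their number is asymptotically Poisson
    ([proxy_count_poisson]).  With probability close to one the number of
    decreases equals the number of proxies while the two estimators in the
    denominator are close to [g 0] and [mu] ([good_event_near]).  Therefore the
    limit law is that of a Poisson variable of mean [lam * h] divided by [lam]
    ([h_tilde_weak_cvg]), whose mean is [h] and whose variance is [h / lam]. *)

Set Implicit Arguments.
Unset Strict Implicit.
Unset Printing Implicit Defensive.
Import Order.TTheory GRing.Theory Num.Theory.
Import numFieldNormedType.Exports.
Local Open Scope classical_set_scope.
Local Open Scope ring_scope.

(** * Real-valued probabilities and expectations *)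

Section real_probability.
Context {d : measure_display} {T : measurableType d} {R : realType}.
Variable P : probability T R.
Implicit Types A B : set T.

(** Real-valued, so that bounds on probabilities are inequalities in [R]. *)
Definition Pr A : R := fine (P A).

Lemma PrE A : measurable A -> P A = (Pr A)%:E.
Proof. by move=> mA; rewrite /Pr fineK// fin_num_measure. Qed.

Lemma Pr_ge0 A : 0 <= Pr A.
Proof. by rewrite fine_ge0. Qed.

Lemma Pr_setT : Pr setT = 1.
Proof. by rewrite /Pr probability_setT. Qed.

Lemma Pr_set0 : Pr set0 = 0.
Proof. by rewrite /Pr measure0. Qed.

Lemma le_Pr A B : measurable A -> measurable B -> A `<=` B -> Pr A <= Pr B.
Proof.
move=> mA mB AB; rewrite -lee_fin -!PrE//.
by apply: le_measure => //; rewrite inE.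
Qed.

Lemma Pr_le1 A : measurable A -> Pr A <= 1.
Proof. by move=> mA; rewrite -Pr_setT; exact: le_Pr. Qed.

Lemma PrU_le A B : measurable A -> measurable B ->
  Pr (A `|` B) <= Pr A + Pr B.
Proof.
move=> mA mB; rewrite -lee_fin EFinD -!PrE//; last exact: measurableU.
exact: measureU2.
Qed.

Lemma PrU_disj A B : measurable A -> measurable B -> A `&` B = set0 ->
  Pr (A `|` B) = Pr A + Pr B.
Proof.
move=> mA mB AB; apply: EFin_inj; rewrite EFinD -!PrE//; last exact: measurableU.
exact: measureU.
Qed.

Lemma PrC A : measurable A -> Pr (~` A) = 1 - Pr A.
Proof.
move=> mA; apply/eqP; rewrite eq_sym subr_eq -PrU_disj//.
- by rewrite setvU Pr_setT.
- exact: measurableC.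
- by rewrite setICl.
Qed.

Lemma measurable_exists_in (I : eqType) (s : seq I) (A : I -> set T) :
  (forall i, i \in s -> measurable (A i)) ->
  measurable [set w | exists2 i, i \in s & A i w].
Proof.
move=> mA.
rewrite (_ : [set w | _] = \bigcup_(i in [set` s]) A i).
  by apply: fin_bigcup_measurable => //; exact: finite_seq.
by apply/seteqP; split => [w [i]|w [i]] /= ? ?; exists i.
Qed.

Lemma Pr_exists_in_le (I : eqType) (s : seq I) (A : I -> set T) :
  (forall i, i \in s -> measurable (A i)) ->
  Pr [set w | exists2 i, i \in s & A i w] <= \sum_(i <- s) Pr (A i).
Proof.
elim: s => [|i s IH] mA.
  rewrite big_nil (_ : [set w | _] = set0) ?Pr_set0//.
  by apply/seteqP; split => // w [].
have mAs j : j \in s -> measurable (A j).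
  by move=> js; apply: mA; rewrite inE js orbT.
have mAi : measurable (A i) by apply: mA; rewrite mem_head.
have mE := measurable_exists_in mAs.
rewrite big_cons; apply: (le_trans _ (lerD (lexx _) (IH mAs))).
apply: (le_trans _ (PrU_le mAi mE)); apply: le_Pr.
- exact: measurable_exists_in.
- exact: measurableU.
- move=> w [j]; rewrite inE => /predU1P[-> ?|js Aj]; first by left.
  by right; exists j.
Qed.

Lemma Pr_bigU_disj (I : eqType) (s : seq I) (A : I -> set T) : uniq s ->
  (forall i, i \in s -> measurable (A i)) ->
  (forall i j w, i \in s -> j \in s -> A i w -> A j w -> i = j) ->
  Pr [set w | exists2 i, i \in s & A i w] = \sum_(i <- s) Pr (A i).
Proof.
elim: s => [|i s IH] /=.
  move=> *; rewrite big_nil (_ : [set w | _] = set0) ?Pr_set0//.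
  by apply/seteqP; split => // w [].
move=> /andP[iNs us] mA dA.
have mAs j : j \in s -> measurable (A j).
  by move=> js; apply: mA; rewrite inE js orbT.
have mAi : measurable (A i) by apply: mA; rewrite mem_head.
have mE := measurable_exists_in mAs.
rewrite big_cons -IH//; last first.
  by move=> j k w js ks; apply: dA; rewrite inE ?js ?ks orbT.
rewrite -PrU_disj//; last first.
  apply/seteqP; split => // w [Ai [j js Aj]].
  have ij : i = j by apply: (dA i j w) => //; rewrite inE ?eqxx ?js ?orbT.
  by rewrite ij js in iNs.
congr Pr; apply/seteqP; split => [w [j]|w [Ai|[j js Aj]]].
- rewrite inE => /predU1P[-> ?|js Aj]; first by left.
  by right; exists j.
- by exists i => //; rewrite mem_head.
- by exists j => //; rewrite inE js orbT.
Qed.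

Definition Ex (f : T -> R) : R := \int[P]_w f w.

(** Bounded measurable functions are integrable under every probability, so the
    linear rules for [Ex] hold for them without further conditions. *)
Definition bmeas (f : T -> R) :=
  measurable_fun setT f /\ exists M, forall w, `|f w| <= M.

Lemma bmeas_integrable f : bmeas f -> P.-integrable setT (EFin \o f).
Proof.
move=> [mf [M fM]]; apply: measurable_bounded_integrable => //.
  by rewrite (le_lt_trans (probability_le1 P measurableT))// ltry.
by exists M; split; rewrite ?num_real// => x Mx w _; exact/ltW/(le_lt_trans (fM w)).
Qed.

Lemma ExE f : bmeas f -> (\int[P]_w (f w)%:E)%E = (Ex f)%:E.
Proof.
by move=> bf; rewrite /Ex /Rintegral fineK//; apply/integrable_fin_num/bmeas_integrable.
Qed.

Lemma bmeas_cst c : bmeas (cst c).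
Proof. by split => //; exists `|c|. Qed.

Lemma bmeasD f g : bmeas f -> bmeas g -> bmeas (fun w => f w + g w).
Proof.
move=> [mf [M fM]] [mg [N gN]]; split; first exact: measurable_funD.
by exists (M + N) => w; rewrite (le_trans (ler_normD _ _))// lerD.
Qed.

Lemma bmeasM f g : bmeas f -> bmeas g -> bmeas (fun w => f w * g w).
Proof.
move=> [mf [M fM]] [mg [N gN]]; split; first exact: measurable_funM.
by exists (M * N) => w; rewrite normrM ler_pM.
Qed.

Lemma bmeasZ c f : bmeas f -> bmeas (fun w => c * f w).
Proof. by move=> bf; apply: bmeasM => //; exact: bmeas_cst. Qed.

Lemma bmeasN f : bmeas f -> bmeas (fun w => - f w).
Proof.
move=> bf; rewrite (_ : (fun w => _) = (fun w => -1 * f w)); first exact: bmeasZ.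
by apply/funext => w; rewrite mulN1r.
Qed.

Lemma bmeas_indic A : measurable A -> bmeas \1_A.
Proof.
move=> mA; split; first exact: measurable_indic.
by exists 1 => w; rewrite indicE; case: (_ \in _); rewrite ?normr1 ?normr0.
Qed.

Lemma bmeas_sum (I : Type) (s : seq I) (F : I -> T -> R) :
  (forall i, bmeas (F i)) -> bmeas (fun w => \sum_(i <- s) F i w).
Proof.
move=> bF; elim: s => [|i s IH].
  by under eq_fun do rewrite big_nil; exact: bmeas_cst.
by under eq_fun do rewrite big_cons; exact: bmeasD.
Qed.

Lemma ExD f g : bmeas f -> bmeas g -> Ex (fun w => f w + g w) = Ex f + Ex g.
Proof. by move=> bf bg; rewrite /Ex RintegralD//; exact: bmeas_integrable. Qed.

Lemma ExZ c f : bmeas f -> Ex (fun w => c * f w) = c * Ex f.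
Proof. by move=> bf; rewrite /Ex RintegralZl//; exact: bmeas_integrable. Qed.

Lemma ExN f : bmeas f -> Ex (fun w => - f w) = - Ex f.
Proof.
move=> bf; rewrite (_ : (fun w => _) = (fun w => -1 * f w)) ?ExZ ?mulN1r//.
by apply/funext => w; rewrite mulN1r.
Qed.

Lemma Ex_cst c : Ex (cst c) = c.
Proof.
by rewrite /Ex Rintegral_cst// -[fine _]/(Pr setT) Pr_setT mulr1.
Qed.

Lemma le_Ex f g : bmeas f -> bmeas g -> (forall w, f w <= g w) -> Ex f <= Ex g.
Proof.
by move=> bf bg fg; apply: le_Rintegral => //; exact: bmeas_integrable.
Qed.

Lemma Ex_indic A : measurable A -> Ex \1_A = Pr A.
Proof.
by move=> mA; rewrite /Ex /Rintegral integral_indic// setIT.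
Qed.

Lemma Ex_sum (I : Type) (s : seq I) (F : I -> T -> R) :
  (forall i, bmeas (F i)) ->
  Ex (fun w => \sum_(i <- s) F i w) = \sum_(i <- s) Ex (F i).
Proof.
move=> bF; elim: s => [|i s IH].
  by under eq_fun do rewrite big_nil; rewrite Ex_cst big_nil.
under eq_fun do rewrite big_cons.
by rewrite ExD ?IH ?big_cons//; exact: bmeas_sum.
Qed.

Lemma Ex_abs_le f g : bmeas f -> bmeas g -> (forall w, `|f w| <= g w) ->
  `|Ex f| <= Ex g.
Proof.
move=> bf bg fg; rewrite ler_norml; apply/andP; split.
  rewrite -ExN//; apply: le_Ex => //; first exact: bmeasN.
  by move=> w; have := fg w; rewrite ler_norml => /andP[].
by apply: le_Ex => // w; have := fg w; rewrite ler_norml => /andP[].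
Qed.

(** Markov's inequality: the expected number of the events that occur is the sum
    of their probabilities. *)
Lemma markov_count (I : Type) (s : seq I) (A : I -> set T) (c : R) : 0 < c ->
  (forall i, measurable (A i)) ->
  Pr [set w | c <= \sum_(i <- s) \1_(A i) w] <= (\sum_(i <- s) Pr (A i)) / c.
Proof.
move=> c0 mA.
have bA i := bmeas_indic (mA i).
have mE : measurable [set w | c <= \sum_(i <- s) \1_(A i) w :> R].
  rewrite -[X in measurable X]setTI; apply: measurable_fun_le => //.
  by have [] := bmeas_sum s bA.
rewrite ler_pdivlMr// -Ex_indic// mulrC -ExZ; last exact: bmeas_indic.
under eq_bigr do rewrite -Ex_indic//.
rewrite -Ex_sum//; apply: le_Ex.
- exact/bmeasZ/bmeas_indic.
- exact: bmeas_sum.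
- move=> w; rewrite [\1__ w in leLHS]indicE.
  have [wE|wE] := boolP (w \in _); first by rewrite mulr1; move/set_mem: wE.
  by rewrite mulr0 sumr_ge0// => i _; rewrite indicE.
Qed.

(** The indicators of the [A i], weighted by the [v i], add up to at most [psi].
    In this way an expectation over all trajectories is bounded below by a sum
    over explicit paths. *)
Lemma Ex_ge_disj_sum (I : eqType) (s : seq I) (A : I -> set T) (psi : T -> R)
    (v : I -> R) : uniq s -> bmeas psi -> (forall w, 0 <= psi w) ->
  (forall i, i \in s -> measurable (A i)) ->
  (forall i j w, i \in s -> j \in s -> A i w -> A j w -> i = j) ->
  (forall i w, i \in s -> A i w -> psi w = v i) ->
  \sum_(i <- s) Pr (A i) * v i <= Ex psi.
Proof.
move=> us bpsi psi0 mA dA Av.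
pose A' i := if i \in s then A i else set0.
have mA' i : measurable (A' i) by rewrite /A'; case: ifPn => // /mA.
have -> : \sum_(i <- s) Pr (A i) * v i = Ex (fun w => \sum_(i <- s) v i * \1_(A' i) w).
  rewrite Ex_sum; last by move=> i; exact/bmeasZ/bmeas_indic.
  apply: eq_big_seq => i si; rewrite ExZ; last exact: bmeas_indic.
  by rewrite Ex_indic// /A' si mulrC.
apply: le_Ex => //.
  by apply: bmeas_sum => i; exact/bmeasZ/bmeas_indic.
move=> w; have [[i si Aiw]|nA] := pselect (exists2 i, i \in s & A i w).
  rewrite (bigD1_seq i)//= big_seq_cond big1 ?addr0.
    by rewrite /A' si indicE mem_set// mulr1 (Av i w).
  move=> j /andP[js ji]; rewrite /A' js indicE memNset ?mulr0// => Aj.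
  by move/eqP: ji; apply; exact: (dA j i w).
rewrite big_seq big1// => i si; rewrite /A' si indicE memNset ?mulr0// => Ai.
by apply: nA; exists i.
Qed.

End real_probability.

(** * Events determined by finitely many coordinates *)

Section independence.
Context {d : measure_display} {Omega : measurableType d} {R : realType}.
Variables (I : eqType) (X : I -> Omega -> nat).
Hypothesis mX : forall i, measurable_fun setT (X i).

(** An event determined by the coordinates in [s].  Transfer of membership
    between points that agree on [s] expresses this without exhibiting [E] as a
    preimage. *)
Definition dep (s : seq I) (E : set Omega) :=
  forall w w', (forall i, i \in s -> X i w = X i w') -> E w -> E w'.

Definition cylinder (s : seq I) (v : seq nat) : set Omega :=
  [set w | [seq X i w | i <- s] = v].

Lemma measurable_coord i (A : set nat) : measurable (X i @^-1` A).
Proof. by rewrite -[X in measurable X]setTI; exact: mX. Qed.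

Lemma measurable_cylinder s v : measurable (cylinder s v).
Proof.
elim: s v => [|i s IH] [|k v].
- by rewrite (_ : cylinder _ _ = setT)//; apply/seteqP; split.
- by rewrite (_ : cylinder _ _ = set0)//; apply/seteqP; split.
- by rewrite (_ : cylinder _ _ = set0)//; apply/seteqP; split.
- rewrite (_ : cylinder _ _ = X i @^-1` [set k] `&` cylinder s v).
    by apply: measurableI => //; exact: measurable_coord.
  apply/seteqP; split => w; rewrite /cylinder/=; first by case.
  by move=> [-> ->].
Qed.

(* Indexing the cylinders over [s] by their codes makes them a sequence. *)
Let slice s (E : set Omega) (k : nat) : set Omega :=
  [set w | choice.pickle [seq X i w | i <- s] = k] `&` E.

Let slice_bigcup s E : E = \bigcup_k slice s E k.
Proof.
apply/seteqP; split => [w Ew|w [k _ []]//].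
by exists (choice.pickle [seq X i w | i <- s]).
Qed.

Let sliceE s E k : dep s E ->
  slice s E k = set0 \/ exists v, slice s E k = cylinder s v.
Proof.
move=> dE; have [[w [wk Ew]]|nE] := pselect (exists w, slice s E k w); last first.
  by left; apply/seteqP; split => // w Ew; apply: nE; exists w.
right; exists [seq X i w | i <- s]; apply/seteqP; split => [w' [w'k Ew']|w' w'w].
  by apply: (pcan_inj choice.pickleK); rewrite w'k wk.
split; first by rewrite /= w'w.
apply: (dE w) => // i si.
have /(congr1 (fun l => nth 0%N l (index i s))) := w'w.
by rewrite !(nth_map i) ?index_mem// !nth_index// => ->.
Qed.

Lemma dep_measurable s E : dep s E -> measurable E.
Proof.
move=> dE; rewrite (slice_bigcup s E); apply: bigcup_measurable => k _.
by have [->|[v ->]] := sliceE k dE => //; exact: measurable_cylinder.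
Qed.

Variable P : probability Omega R.

Let slice_trivI s E : trivIset setT (slice s E).
Proof.
apply/trivIsetP => i j _ _ /eqP ij; apply/seteqP; split => // w [[wi _] [wj _]].
by apply: ij; rewrite -wi -wj.
Qed.

Let indep_of_cylinders s E F : dep s E -> measurable F ->
  (forall v, P (cylinder s v `&` F) = P (cylinder s v) * P F)%E ->
  (P (E `&` F) = P E * P F)%E.
Proof.
move=> dE mF h.
have mS k : measurable (slice s E k).
  by have [->|[v ->]] := sliceE k dE => //; exact: measurable_cylinder.
have hE : E `&` F = \bigcup_k (slice s E k `&` F).
  by rewrite -setI_bigcupl -slice_bigcup.
rewrite hE measure_bigcup//; last 2 first.
- by move=> k _; exact: measurableI.
- apply/trivIsetP => i j _ _ ij.
  have /trivIsetP/(_ i j Logic.I Logic.I ij) sij := @slice_trivI s E.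
  by rewrite setIACA sij set0I.
have hk k : (P (slice s E k `&` F) = (Pr P F)%:E * P (slice s E k))%E.
  have [->|[v ->]] := sliceE k dE; first by rewrite set0I !measure0 mule0.
  by rewrite h muleC -PrE.
transitivity (\sum_(0 <= k <oo | k \in [set: nat]) ((Pr P F)%:E * P (slice s E k)))%E.
  by apply: eq_eseriesr => k _; exact: hk.
rewrite nneseriesZl// muleC -PrE//; congr (_ * _)%E.
rewrite [in RHS](slice_bigcup s E) measure_bigcup//.
Qed.

Hypothesis hX : mutually_independent P X.

Let prob_cylinder s v : uniq s -> size v = size s ->
  (P (cylinder s v) = \prod_(i <- s) P (X i @^-1` [set nth 0%N v (index i s)]))%E.
Proof.
move=> us sv.
rewrite -(hX us (A := fun i => [set nth 0%N v (index i s)]))//.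
congr (P _); apply/seteqP; split => [w <- i /= si|w h].
  by rewrite (nth_map i) ?index_mem// nth_index.
apply: (@eq_from_nth _ 0%N); rewrite size_map ?sv// => k ks.
have [i0 _] : exists i0, i0 \in s by case: (s) ks => // i0 ? _; exists i0; rewrite mem_head.
rewrite (nth_map i0)//.
by have /= := h (nth i0 s k) (mem_nth _ ks); rewrite index_uniq.
Qed.

Let indep_cylinder s s' v v' : uniq (s ++ s') ->
  (P (cylinder s v `&` cylinder s' v') = P (cylinder s v) * P (cylinder s' v'))%E.
Proof.
move=> uss'; move: (uss'); rewrite cat_uniq => /and3P[us /hasPn dss' us'].
have cyl0 t u : size u != size t -> cylinder t u = set0.
  by move=> /eqP tu; apply/seteqP; split => // w wv; apply: tu; rewrite -wv size_map.
have [sv|/cyl0->] := eqVneq (size v) (size s); last by rewrite set0I !measure0 mul0e.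
have [sv'|/cyl0->] := eqVneq (size v') (size s'); last by rewrite setI0 !measure0 mule0.
have -> : cylinder s v `&` cylinder s' v' = cylinder (s ++ s') (v ++ v').
  apply/seteqP; split => [w [<- <-]|w]; first by rewrite /cylinder/= map_cat.
  rewrite /cylinder/= map_cat => /eqP; rewrite eqseq_cat ?size_map ?sv//.
  by move=> /andP[/eqP ? /eqP].
rewrite !prob_cylinder// ?size_cat ?sv ?sv'// big_cat/=; congr (_ * _)%E.
  by apply: eq_big_seq => i si; rewrite nth_cat index_cat si sv index_mem si.
apply: eq_big_seq => i si; have iNs := dss' _ si.
by rewrite nth_cat index_cat (negbTE iNs) sv ltnNge leq_addr/= addKn.
Qed.

(** Both events split into countably many cylinders, for which the product rule
    is an instance of mutual independence. *)
Lemma dep_indep s s' E F : uniq (s ++ s') -> dep s E -> dep s' F ->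
  (P (E `&` F) = P E * P F)%E.
Proof.
move=> uss' dE dF; apply: (indep_of_cylinders dE); first exact: dep_measurable dF.
move=> v; rewrite setIC muleC; apply: (indep_of_cylinders dF).
  exact: measurable_cylinder.
by move=> v'; rewrite setIC muleC; exact: indep_cylinder.
Qed.

Lemma Pr_indep s s' E F : uniq (s ++ s') -> dep s E -> dep s' F ->
  Pr P (E `&` F) = Pr P E * Pr P F.
Proof.
move=> uss' dE dF; rewrite /Pr (dep_indep uss' dE dF) fineM// fin_num_measure//.
  exact: dep_measurable dE.
exact: dep_measurable dF.
Qed.

End independence.

(** * Second moments *)

Section second_moments.
Context {d : measure_display} {T : measurableType d} {R : realType}.
Variable P : probability T R.

(** Converts a finite second moment into membership in the space of square
    integrable functions, which is defined by real powers of the absolute value. *)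
Lemma Lfun2_sqr (f : T -> R) : measurable_fun setT f ->
  (\int[P]_w (f w ^+ 2)%:E < +oo)%E -> f \in Lfun P 2%:E.
Proof.
move=> mf f2; rewrite inE; apply/andP; split; rewrite inE//=.
rewrite /finite_norm unlock/=; apply: poweR_lty.
rewrite (le_lt_trans _ f2)//; apply: ge0_le_integral => //.
- apply/measurable_EFinP; apply: (@measurableT_comp _ _ _ _ _ _ (fun x : R => x `^ 2)%R) => //.
  exact: measurableT_comp.
- by apply/measurable_EFinP; exact: measurable_funX.
- by move=> w _; rewrite lee_fin powR_mulrn// real_normK// num_real.
Qed.

Lemma Lfun2_Lfun1 (f : T -> R) : f \in Lfun P 2%:E -> f \in Lfun P 1.
Proof. by move=> f2; apply: (Lfun_subset12 (fin_num_measure P _ measurableT)). Qed.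

(** Independence makes the joint law a product measure, so that the expectation
    of a product factors by Fubini--Tonelli. *)
Lemma indep_expectationM (X Y : {mfun T >-> R}) :
  (forall w, 0 <= X w) -> (forall w, 0 <= Y w) ->
  (forall A B, measurable A -> measurable B ->
    P (X @^-1` A `&` Y @^-1` B) = P (X @^-1` A) * P (Y @^-1` B))%E ->
  ('E_P[X * Y] = 'E_P[X] * 'E_P[Y])%E.
Proof.
move=> X0 Y0 XY.
pose h w := (X w, Y w).
have mh : measurable_fun setT h by exact: measurable_fun_pair.
pose hM := isMeasurableFun.Build _ _ _ _ h mh.
pose H : {mfun T >-> (R * R)%type} := HB.pack h hM.
pose f (z : R * R) : \bar R := (`|z.1 * z.2|)%:E.
have mf : measurable_fun setT f.
  apply/measurable_EFinP; apply: measurableT_comp => //.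
  by apply: measurable_funM; [exact: measurable_fst|exact: measurable_snd].
have f0 z : (0 <= f z)%E by rewrite lee_fin.
have -> : ('E_P[X * Y] = \int[distribution P H]_z f z)%E.
  rewrite ge0_integral_distribution// unlock; apply: eq_integral => w _.
  by rewrite /f /= ger0_norm// mulr_ge0.
have -> : (\int[distribution P H]_z f z =
           \int[(distribution P X \x distribution P Y)%E]_z f z)%E.
  apply: eq_measure_integral => A mA _; apply/esym.
  by apply: product_measure_unique => // B C mB mC; exact: XY.
rewrite fubini_tonelli1//.
have mabs : measurable_fun setT (fun x : R => `|x|%:E).
  by apply/measurable_EFinP; exact: normr_measurable.
transitivity (\int[distribution P X]_x (`|x|%:E * 'E_P[Y]))%E.
  apply: eq_integral => x _; rewrite /fubini_F.
  under eq_integral do rewrite /f/= normrM EFinM.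
  rewrite ge0_integralZl_EFin//.
  congr (_ * _)%E; rewrite ge0_integral_distribution//.
  by rewrite unlock; apply: eq_integral => w _ /=; rewrite ger0_norm.
rewrite ge0_integralZr//; last exact: expectation_ge0.
congr (_ * _)%E; rewrite ge0_integral_distribution//.
by rewrite unlock; apply: eq_integral => w _ /=; rewrite ger0_norm.
Qed.

Lemma indep_covariance0 (X Y : {mfun T >-> R}) :
  (forall w, 0 <= X w) -> (forall w, 0 <= Y w) ->
  (X : T -> R) \in Lfun P 2%:E -> (Y : T -> R) \in Lfun P 2%:E ->
  (forall A B, measurable A -> measurable B ->
    P (X @^-1` A `&` Y @^-1` B) = P (X @^-1` A) * P (Y @^-1` B))%E ->
  covariance P X Y = 0%E.
Proof.
move=> X0 Y0 X2 Y2 XY.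
have X1 := Lfun2_Lfun1 X2; have Y1 := Lfun2_Lfun1 Y2.
rewrite covarianceE//; last exact: Lfun2_mul_Lfun1.
by rewrite indep_expectationM// subee// fin_numM// expectation_fin_num.
Qed.

(** The variances of uncorrelated variables add up. *)
Lemma chebyshev_sum (Y : nat -> {mfun T >-> R}) (m v : R) :
  (forall t, (Y t : T -> R) \in Lfun P 2%:E) ->
  (forall t, 'E_P[Y t] = m%:E)%E -> (forall t, 'V_P[Y t] = v%:E)%E ->
  (forall s t, (s < t)%N -> covariance P (Y s) (Y t) = 0%E) ->
  forall (n : nat) (delta : R), 0 < delta ->
  Pr P [set w | delta <= `|\sum_(s < n) Y s w - n%:R * m|] <= n%:R * v / delta ^+ 2.
Proof.
move=> Y2 Em Vv cov0 n delta d0.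
pose S n w := \sum_(s < n) Y s w.
have S0 : S 0%N = cst 0 by apply/funext => w; rewrite /S big_ord0.
have SS k : S k.+1 = (S k \+ Y k)%R by apply/funext => w; rewrite /S big_ord_recr.
have S2 k : S k \in Lfun P 2%:E.
  elim: k => [|k IH]; first by rewrite S0 Lfun_cst.
  by rewrite SS rpredD// lee1n.
have covS k t : (k <= t)%N -> covariance P (S k) (Y t) = 0%E.
  elim: k => [|k IH] kt; first by rewrite S0 covariance_cst_l.
  by rewrite SS covarianceDl ?IH ?cov0 ?adde0// ltnW.
have ES k : ('E_P[S k] = (k%:R * m)%:E)%E.
  elim: k => [|k IH]; first by rewrite S0 expectation_cst mul0r.
  rewrite SS expectationD ?Lfun2_Lfun1// IH Em -EFinD; congr (_%:E).
  by rewrite -[in RHS]natr1 mulrDl mul1r.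
have VS k : ('V_P[S k] = (k%:R * v)%:E)%E.
  elim: k => [|k IH]; first by rewrite S0 variance_cst mul0r.
  rewrite SS varianceD// covS// mule0 adde0 IH Vv -EFinD; congr (_%:E).
  by rewrite -[in RHS]natr1 mulrDl mul1r.
have mS : measurable_fun setT (S n) by move: (S2 n); rewrite inE => /andP[]; rewrite inE.
pose SM := isMeasurableFun.Build _ _ _ _ (S n) mS.
pose S' : {mfun T >-> R} := HB.pack (S n) SM.
have := @chebyshev _ _ _ P S' delta d0.
rewrite ES/= VS -EFinM PrE ?lee_fin; first by rewrite [in X in _ <= X -> _]mulrC.
rewrite -[X in measurable X]setTI; apply: measurable_fun_le => //.
apply: measurableT_comp => //; apply: measurable_funB => //.
Qed.

End second_moments.

(** * Laws on the natural numbers *)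

Section laws_on_nat.
Context {R : realType}.
Implicit Type G : probability nat R.

Lemma ge0_integral_nat G (f : nat -> \bar R) : (forall k, 0 <= f k)%E ->
  (\int[G]_k f k = \sum_(0 <= k <oo) f k * G [set k])%E.
Proof.
move=> f0.
have -> : [set: nat] = \bigcup_k [set k] by apply/seteqP; split => // k _; exists k.
rewrite ge0_integral_bigcup//; last by apply/trivIsetP => i j _ _ /eqP ij; apply/seteqP; split => // k [-> /ij].
apply: eq_eseriesr => k _.
by rewrite (eq_integral (cst (f k))) ?integral_cst// => x /set_mem ->.
Qed.

Lemma pmf_natE G k : G [set k] = (pmf_nat G k)%:E.
Proof. by rewrite /pmf_nat fineK// fin_num_measure. Qed.

Lemma pmf_nat_ge0 G k : 0 <= pmf_nat G k.
Proof. by rewrite /pmf_nat fine_ge0. Qed.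

Lemma pmf_nat_sum1 G : (\sum_(0 <= k <oo) (pmf_nat G k)%:E = 1)%E.
Proof.
rewrite -(probability_setT G) -[RHS]mul1e -(integral_cst G measurableT 1%E).
rewrite ge0_integral_nat//; apply: eq_eseriesr => k _.
by rewrite /cst mul1e pmf_natE.
Qed.

Lemma pmf_nat_partial_sum_le1 G n : \sum_(k < n) pmf_nat G k <= 1.
Proof.
rewrite -lee_fin -(pmf_nat_sum1 G) -sumEFin -(big_mkord xpredT (fun k => (pmf_nat G k)%:E)).
by apply: nneseries_lim_ge => k _; rewrite lee_fin pmf_nat_ge0.
Qed.

Lemma pmf_nat_tail G (tau : R) : 0 < tau ->
  exists K, forall n, (K <= n)%N -> 1 - tau <= \sum_(k < n) pmf_nat G k.
Proof.
move=> tau0.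
have cv : (\sum_(0 <= k < n) (pmf_nat G k)%:E)%E @[n --> \oo] --> 1%E.
  rewrite -(pmf_nat_sum1 G); apply: is_cvg_nneseries => k _ _.
  by rewrite lee_fin pmf_nat_ge0.
have cv' : (\sum_(0 <= k < n) pmf_nat G k) @[n --> \oo] --> (1 : R).
  move: cv; under eq_fun do rewrite sumEFin.
  by move/fine_cvg.
have /cvgrPdist_le/(_ _ tau0)[K _ hK] := cv'.
exists K => n /hK; rewrite big_mkord ler_distlC => /andP[].
by rewrite lerBlDr -lerBlDr.
Qed.

(** A finite support bounds the second moment.  Otherwise the variance is finite;
    it is the second moment of the centred variable, and adding the constant
    back stays in the vector space of square integrable functions. *)
Lemma admissible_Lfun2 G : admissible G -> (fun k => k%:R) \in Lfun G 2%:E.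
Proof.
have mid (f : nat -> R) : measurable_fun setT f by [].
case=> [[M [M0 supp]]|[_ V _]].
  apply: Lfun2_sqr => //; rewrite ge0_integral_nat; last by move=> k; rewrite lee_fin sqr_ge0.
  apply: (@le_lt_trans _ _ (\sum_(0 <= k <oo) (M%:R ^+ 2)%:E * (pmf_nat G k)%:E)%E).
    apply: lee_nneseries => [k _ _|k _]; rewrite pmf_natE -EFinM lee_fin.
      by rewrite mulr_ge0 ?sqr_ge0 ?pmf_nat_ge0.
    have [kM|Mk] := leqP k M; first by rewrite ler_wpM2r ?pmf_nat_ge0// lerXn2r ?nnegrE// ler_nat.
    have : ~ support_nat G k by rewrite supp/= leqNgt Mk.
    rewrite /support_nat/= => /negP; rewrite -leNgt => gk.
    have -> : pmf_nat G k = 0 by apply/eqP; rewrite eq_le gk pmf_nat_ge0.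
    by rewrite !mulr0.
  rewrite nneseriesZl// ?pmf_nat_sum1 ?mule1 ?ltry//.
  by move=> k _; rewrite lee_fin pmf_nat_ge0.
set X := fun k : nat => k%:R : R.
set c := fine ('E_G[X])%E.
have -> : X = (X \- cst c) + cst c by apply/funext => k /=; rewrite !fctE subrK.
rewrite rpredD ?lee1n//=; last by move=> _; exact: Lfun_cst.
move=> _; apply: Lfun2_sqr => //; apply: le_lt_trans V.
rewrite /variance covariance.unlock -/X -/c unlock.
by under eq_integral do rewrite expr2.
Qed.

End laws_on_nat.

(** * The noise and the arrivals *)

Section noise_laws.
Context {d : measure_display} {Omega : measurableType d} {R : realType}.
Variables (Z : nat -> nat -> {mfun Omega >-> bool})
          (eps : nat -> {mfun Omega >-> nat}).

Lemma measurable_noise i : measurable_fun setT (noise Z eps i).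
Proof.
case: i => [[t j]|t] /=; last exact: measurable_funPT.
by apply: (measurableT_comp (f := nat_of_bool)).
Qed.

Let depn := dep (noise Z eps).

Lemma dep_sub s s' E : {subset s <= s'} -> depn s E -> depn s' E.
Proof. by move=> ss' dE w w' ww'; apply: dE => i /ss'; exact: ww'. Qed.

Lemma dep_noise_measurable s E : depn s E -> measurable E.
Proof. exact: (dep_measurable measurable_noise). Qed.

Variables (P : probability Omega R) (theta : R) (G : probability nat R).
Hypotheses (theta01 : 0 <= theta <= 1) (hP : inar_noise Z eps P theta G).

Lemma indep_noise s s' E F : uniq (s ++ s') -> depn s E -> depn s' F ->
  (P (E `&` F) = P E * P F)%E.
Proof. by case: hP => _ _ hX; exact: (dep_indep measurable_noise hX). Qed.

Lemma Pr_indep_noise s s' E F : uniq (s ++ s') -> depn s E -> depn s' F ->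
  Pr P (E `&` F) = Pr P E * Pr P F.
Proof. by case: hP => _ _ hX; exact: (Pr_indep measurable_noise hX). Qed.

Lemma Pr_Z t j b : Pr P [set w | Z t j w = b] = if b then theta else 1 - theta.
Proof.
have [hZ _ _] := hP.
rewrite /Pr -[P _]/(distribution P (Z t j) [set b]) hZ /bernoulli_prob theta01.
by rewrite fsbig_set1.
Qed.

Lemma prob_eps t (A : set nat) : P (eps t @^-1` A) = G A.
Proof. by have [_ he _] := hP; rewrite -(he t). Qed.

Lemma Pr_eps t k : Pr P [set w | eps t w = k] = pmf_nat G k.
Proof. by rewrite /Pr -[P _]/(P (eps t @^-1` [set k])) prob_eps. Qed.

Lemma ge0_integral_eps t (f : nat -> \bar R) : (forall k, 0 <= f k)%E ->
  (\int[P]_w f (eps t w) = \int[G]_k f k)%E.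
Proof.
move=> f0; rewrite -(ge0_integral_distribution (eps t) (f := f))//.
by apply: eq_measure_integral => A mA _; exact: prob_eps.
Qed.

(** The law of the arrivals does not depend on the thinning parameter, so the
    bound is the same for all [theta]. *)
Lemma eps_chebyshev (f : nat -> R) (m v : R) :
  (forall k, 0 <= f k) -> f \in Lfun G 2%:E ->
  ('E_G[f] = m%:E)%E -> ('V_G[f] = v%:E)%E ->
  forall (n : nat) (delta : R), 0 < delta ->
  Pr P [set w | delta <= `|\sum_(s < n) f (eps s w) - n%:R * m|]
    <= n%:R * v / delta ^+ 2.
Proof.
move=> f0 f2 Em Vv n delta d0.
pose y t w := f (eps t w).
have my t : measurable_fun setT (y t) by apply: (measurableT_comp (f := f)).
pose yM t := isMeasurableFun.Build _ _ _ _ (y t) (my t).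
pose Y t : {mfun Omega >-> R} := HB.pack (y t) (yM t).
have EY t : ('E_P[Y t] = m%:E)%E.
  by rewrite -Em unlock -(ge0_integral_eps t).
have Y2 t : (Y t : Omega -> R) \in Lfun P 2%:E.
  apply: Lfun2_sqr => //.
  rewrite (ge0_integral_eps t (f := fun k => (f k ^+ 2)%:E)); last first.
    by move=> k; rewrite lee_fin sqr_ge0.
  have /integrableP[_] := Lfun2_integrable_sqr f2.
  apply: le_lt_trans; apply: ge0_le_integral => //=.
    by move=> k _; rewrite lee_fin sqr_ge0.
  by move=> k _; rewrite lee_fin ler_norm.
apply: (@chebyshev_sum _ _ _ P Y m v) => //.
- move=> t; rewrite -Vv /variance covariance.unlock Em EY/= !expectation.unlock.
  rewrite -(ge0_integral_eps t)// => k.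
  by rewrite lee_fin/= -expr2 sqr_ge0.
- move=> s t st; apply: indep_covariance0 => //.
  + by move=> w; exact: f0.
  + by move=> w; exact: f0.
  + move=> A B mA mB; apply: (indep_noise (s := [:: inr s]) (s' := [:: inr t])).
    * by rewrite /= inE andbT -[_ == _]/(s == t) ltn_eqF.
    * move=> w w' ww' /=; rewrite /y.
      by rewrite -[eps s w]/(noise Z eps (inr s) w) ww' ?mem_head.
    * move=> w w' ww' /=; rewrite /y.
      by rewrite -[eps t w]/(noise Z eps (inr t) w) ww' ?mem_head.
Qed.

End noise_laws.

Section uniform_law_of_large_numbers.
Context {d : measure_display} {Omega : measurableType d} {R : realType}.
Variables (Z : nat -> nat -> {mfun Omega >-> bool})
          (eps : nat -> {mfun Omega >-> nat}).

Definition arrivals (t : nat) (w : Omega) : nat := (\sum_(s < t) eps s w)%N.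

Lemma arrivals_le s t w : (s <= t)%N -> (arrivals s w <= arrivals t w)%N.
Proof.
move=> /subnKC <-; elim: (t - s)%N => [|k IH]; first by rewrite addn0.
by rewrite addnS (leq_trans IH)// /arrivals big_ord_recr leq_addr.
Qed.

(** The bound [c * n] refers to the horizon [n] and is the same at all times
    before it. *)
Definition off_course (G : probability nat R) (c : R) (n : nat) : set Omega :=
  [set w | exists2 t, (t <= n)%N & c * n%:R < `|(arrivals t w)%:R - t%:R * mean_nat G|].

Lemma dep_arrivals t (A : set nat) :
  dep (noise Z eps) [seq inr s | s <- iota 0 t] [set w | A (arrivals t w)].
Proof.
move=> w w' ww' /=; rewrite /arrivals.
suff -> : (\sum_(s < t) eps s w = \sum_(s < t) eps s w')%N by [].
apply: eq_bigr => s _; apply: (ww' (inr (val s))).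
by apply: map_f; rewrite mem_iota/=.
Qed.

Lemma measurable_off_course G c n : measurable (off_course G c n).
Proof.
rewrite (_ : off_course _ _ _ = [set w | exists2 t, t \in iota 0 n.+1 &
    c * n%:R < `|(arrivals t w)%:R - t%:R * mean_nat G|]).
  apply: measurable_exists_in => t _.
  by apply: (@dep_noise_measurable _ _ Z eps); exact: (@dep_arrivals t
    [set k | c * n%:R < `|k%:R - t%:R * mean_nat G|]).
apply/seteqP; split => w [t tn h]; exists t => //; first by rewrite mem_iota.
by move: tn; rewrite mem_iota.
Qed.

(** Chebyshev's inequality controls the arrivals on a grid of boundedly many
    times, and monotonicity fills in the gaps.  The bound is uniform in the law
    [P]: the thinning parameter may depend on [n]. *)
Lemma uniform_lln (G : probability nat R) : admissible G ->
  forall c e : R, 0 < c -> 0 < e -> \forall n \near \oo,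
    forall (P : probability Omega R) (theta : R), 0 <= theta <= 1 ->
      inar_noise Z eps P theta G -> Pr P (off_course G c n) <= e.
Proof.
move=> Gadm c e c0 e0.
have id2 := admissible_Lfun2 Gadm.
set mu := mean_nat G.
have Em : ('E_G[fun k => k%:R] = mu%:E)%E.
  by rewrite /mu /mean_nat fineK// expectation_fin_num// Lfun2_Lfun1.
pose v := fine ('V_G[fun k => k%:R])%E.
have Vv : ('V_G[fun k => k%:R] = v%:E)%E by rewrite /v fineK// variance_fin_num.
have v0 : 0 <= v by rewrite fine_ge0// variance_ge0.
have mu0 : 0 <= mu by rewrite /mu fine_ge0// expectation_ge0.
(* A grid of [M + 2] multiples of [q], about [n / M], covers the times up to
   [n]; between two of them the mean grows by at most [c * n / 2]. *)
pose M := (Num.truncn (4 * mu / c)).+1.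
have M0 : 0 < M%:R :> R by rewrite ltr0n.
have muM : mu / M%:R <= c / 4.
  rewrite ler_pdivrMr//.
  have : 4 * mu / c < M%:R by rewrite truncnS_gt.
  rewrite ltr_pdivrMr// => h; lra.
near=> n.
move=> P theta theta01 hP.
have n1 : 1 <= n%:R :> R by near: n; exact: nbhs_infty_ger.
have nmu : 4 * mu / c <= n%:R by near: n; exact: nbhs_infty_ger.
have nbig : 8 * M.+2%:R ^+ 2 * v / (c ^+ 2 * e) <= n%:R by near: n; exact: nbhs_infty_ger.
pose q := (n %/ M).+1.
have nMq : (n < M * q)%N by rewrite mulnC /q ltn_ceil.
have qM : (q%:R - 1) * M%:R <= n%:R :> R.
  by rewrite /q -natr1 addrK -natrM ler_nat leq_divM.
have q1 : 1 <= q%:R :> R by rewrite ler1n.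
have muq : mu * q%:R <= c * n%:R / 2.
  have h1 : (q%:R - 1) <= n%:R / M%:R :> R by rewrite ler_pdivlMr.
  have h2 : mu * (q%:R - 1) <= n%:R * (c / 4).
    apply: (le_trans (ler_wpM2l mu0 h1)).
    by rewrite mulrCA ler_wpM2l// ltW// (lt_le_trans ltr01).
  have h3 : mu <= c * n%:R / 4.
    by move: nmu; rewrite ler_pdivrMr// => h; lra.
  lra.
pose A j : set Omega := [set w | c * n%:R / 2 <=
  `|\sum_(s < (j * q)%N) (eps s w)%:R - (j * q)%:R * mu|].
have cn2 : 0 < c * n%:R / 2.
  by rewrite divr_gt0// mulr_gt0// (lt_le_trans ltr01).
have sumS t w : \sum_(s < t) (eps s w)%:R = (arrivals t w)%:R :> R.
  by rewrite /arrivals natr_sum.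
have mA j : measurable (A j).
  rewrite /A; under eq_set do rewrite sumS.
  apply: (@dep_noise_measurable _ _ Z eps).
  exact: (@dep_arrivals _ [set k | c * n%:R / 2 <= `|k%:R - (j * q)%:R * mu|]).
have sub : off_course G c n `<=` [set w | exists2 j, j \in iota 0 M.+2 & A j w].
  move=> w [t tn ht]; apply: contrapT => nA.
  have hA j : (j < M.+2)%N ->
      `|(arrivals (j * q) w)%:R - (j * q)%:R * mu| < c * n%:R / 2.
    move=> jM; rewrite ltNge; apply/negP => h; apply: nA; exists j.
      by rewrite mem_iota.
    by rewrite /A/= sumS.
  pose j := (t %/ q)%N.
  have jM : (j < M)%N by rewrite /j ltn_divLR// (leq_ltn_trans tn).
  have jt : (j * q <= t)%N by rewrite leq_divM.
  have tj : (t <= j.+1 * q)%N by rewrite ltnW// /j ltn_ceil.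
  have S1 : (arrivals (j * q) w)%:R <= (arrivals t w)%:R :> R.
    by rewrite ler_nat arrivals_le.
  have S2 : (arrivals t w)%:R <= (arrivals (j.+1 * q) w)%:R :> R.
    by rewrite ler_nat arrivals_le.
  have /hA : (j < M.+2)%N by rewrite ltnS ltnW// ltnW.
  have /hA : (j.+1 < M.+2)%N by rewrite ltnS ltnW.
  rewrite !ltr_norml => /andP[a1 a2] /andP[b1 b2].
  have t1 : (j * q)%:R * mu <= t%:R * mu by rewrite ler_wpM2r// ler_nat.
  have t2 : t%:R * mu <= (j.+1 * q)%:R * mu by rewrite ler_wpM2r// ler_nat.
  have t3 : (j.+1 * q)%:R * mu = (j * q)%:R * mu + mu * q%:R.
    by rewrite mulSn natrD; ring.
  move: ht; apply/negP; rewrite -leNgt ler_norml -/mu; lra.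
apply: (le_trans (le_Pr _ (measurable_off_course _ _ _) _ sub)).
  exact: measurable_exists_in.
apply: (le_trans (Pr_exists_in_le _ _)) => //.
have bnd j : (j < M.+2)%N -> Pr P (A j) <= M.+2%:R * (2 * n%:R) * v / (c * n%:R / 2) ^+ 2.
  move=> jM; have h0 (k : nat) : 0 <= k%:R :> R by [].
  apply: (le_trans (eps_chebyshev hP h0 id2 Em Vv (j * q)%N cn2)).
  rewrite ler_pM2r ?invr_gt0 ?exprn_gt0//; apply: ler_wpM2r => //.
  rewrite natrM; apply: ler_pM => //; first by rewrite ler_nat ltnW.
  have : (q%:R - 1) <= n%:R :> R.
    apply: le_trans qM; rewrite ler_peMr ?subr_ge0// ler1n//.
  by lra.
apply: (@le_trans _ _ (\sum_(j <- iota 0 M.+2) (M.+2%:R * (2 * n%:R) * v / (c * n%:R / 2) ^+ 2))).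
  rewrite !big_seq; apply: ler_sum => j; rewrite mem_iota => /andP[_ jM].
  exact: bnd.
rewrite big_const_seq count_predT size_iota iter_addr_0 -(mulr_natr (_ / _)).
move: nbig; rewrite ler_pdivrMr; last by rewrite mulr_gt0// exprn_gt0.
move=> nbig; rewrite mulrAC ler_pdivrMr; last by rewrite exprn_gt0.
have : n%:R * (8 * M.+2%:R ^+ 2 * v) <= n%:R * (n%:R * (c ^+ 2 * e)).
  by rewrite ler_wpM2l// (le_trans ler01).
have -> : M.+2%:R * (2 * n%:R) * v * M.+2%:R = n%:R * (8 * M.+2%:R ^+ 2 * v) / 4 by field.
have -> : e * (c * n%:R / 2) ^+ 2 = n%:R * (n%:R * (c ^+ 2 * e)) / 4 by field.
by move=> h; rewrite ler_wpM2r.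
Unshelve. all: by end_near. Qed.

End uniform_law_of_large_numbers.

(** * Transitions with at most one death *)

Section thinning_kernel.
Context {R : realType}.
Variable g : nat -> R.
Implicit Types (a : R) (x y L : nat).

(** Binomial probabilities of no death and of one death among [x] individuals, each
    of which dies with probability [a]. *)
Definition no_death a x : R := (1 - a) ^+ x.

Definition one_death a x : R := x%:R * a * (1 - a) ^+ x.-1.

(** Probability of the arrivals that lead from [x] to [y]; it vanishes below [x],
    where the truncated subtraction would give [g 0]. *)
Definition jump x y : R := if (x <= y)%N then g (y - x)%N else 0.

(** Probability of a transition from [x] to [y] in which at most one individual
    dies, each of them with probability [a]. *)
Definition thin_kernel a x y : R :=
  no_death a x * jump x y + one_death a x * jump x y.+1.

Lemma no_death_le1 a x : 0 <= a <= 1 -> no_death a x <= 1.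
Proof. by move=> /andP[a0 a1]; rewrite /no_death exprn_ile1 ?subr_ge0// gerBl. Qed.

Lemma no_death_ge0 a x : 0 <= a <= 1 -> 0 <= no_death a x.
Proof. by move=> /andP[a0 a1]; rewrite /no_death exprn_ge0// subr_ge0. Qed.

Lemma no_death_ge a x : 0 <= a <= 1 -> 1 - x%:R * a <= no_death a x.
Proof.
move=> a01; elim: x => [|x IH]; first by rewrite mul0r subr0 /no_death expr0.
move: (no_death_le1 x a01); rewrite /no_death exprS -/(no_death a x) -natr1 => n1.
by move: IH; nra.
Qed.

Lemma no_death_le a x : 0 <= a <= 1 ->
  no_death a x <= 1 - x%:R * a + (x%:R * a) ^+ 2.
Proof.
move=> a01; elim: x => [|x IH]; first by rewrite mul0r subr0 expr0n addr0 /no_death expr0.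
rewrite /no_death exprS -/(no_death a x) -natr1.
have x0 : 0 <= x%:R :> R by [].
have /andP[a0 a1] := a01.
have : (1 - a) * no_death a x <= (1 - a) * (1 - x%:R * a + (x%:R * a) ^+ 2).
  by rewrite ler_wpM2l// subr_ge0.
move=> /le_trans; apply; rewrite -subr_ge0.
have -> : 1 - (x%:R + 1) * a + ((x%:R + 1) * a) ^+ 2 -
  (1 - a) * (1 - x%:R * a + (x%:R * a) ^+ 2) =
  a ^+ 2 * (x%:R + 1 + x%:R ^+ 2 * a) by ring.
by rewrite mulr_ge0 ?sqr_ge0// !addr_ge0// mulr_ge0// sqr_ge0.
Qed.

Lemma one_death_ge0 a x : 0 <= a <= 1 -> 0 <= one_death a x.
Proof. by move=> /andP[a0 a1]; rewrite /one_death !mulr_ge0// exprn_ge0// subr_ge0. Qed.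

Lemma one_death_le a x : 0 <= a <= 1 -> one_death a x <= x%:R * a.
Proof.
move=> a01; have /andP[a0 a1] := a01.
by rewrite /one_death ler_piMr ?mulr_ge0//; exact: no_death_le1.
Qed.

Lemma one_death_ge a x : 0 <= a <= 1 -> x%:R * a * (1 - x%:R * a) <= one_death a x.
Proof.
move=> a01; have /andP[a0 a1] := a01.
rewrite /one_death ler_wpM2l ?mulr_ge0//.
case: x => [|x]; first by rewrite mul0r subr0 expr0.
apply: le_trans (no_death_ge x a01).
by rewrite lerD2l lerN2 ler_wpM2r// ler_nat.
Qed.

Lemma no_one_death_le1 a x : 0 <= a <= 1 -> no_death a x + one_death a x <= 1.
Proof.
move=> a01; have /andP[a0 a1] := a01.
elim: x => [|x IH]; first by rewrite /no_death /one_death expr0 !mul0r addr0.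
have -> : no_death a x.+1 + one_death a x.+1 =
    (1 - a) * (no_death a x + one_death a x) + a * no_death a x.
  rewrite /no_death /one_death/=; case: x {IH} => [|x]; rewrite /= ?expr0 ?expr1 ?exprS.
    by ring.
  by rewrite -!natr1; ring.
by have := no_death_le1 x a01; nra.
Qed.

Hypotheses (g_ge0 : forall k, 0 <= g k) (g_sum : forall n, \sum_(k < n) g k <= 1).

Lemma jump_ge0 x y : 0 <= jump x y.
Proof. by rewrite /jump; case: ifP. Qed.

Lemma sum_jump x L : \sum_(y < L) jump x y = \sum_(k < L - x) g k.
Proof.
elim: L => [|L IH]; first by rewrite sub0n !big_ord0.
rewrite big_ord_recr/= IH /jump; case: leqP => xL; first by rewrite subSn// big_ord_recr.
by have /eqP-> : (L.+1 - x == 0)%N; [rewrite subn_eq0|have /eqP-> : (L - x == 0)%N by [rewrite subn_eq0 ltnW]; rewrite big_ord0 addr0].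
Qed.

Lemma sum_jumpS x L : \sum_(y < L) jump x.+1 y.+1 = \sum_(k < L - x) g k.
Proof. by rewrite -sum_jump; apply: eq_bigr => y _; rewrite /jump ltnS subSS. Qed.

Lemma thin_kernel_ge0 a x y : 0 <= a <= 1 -> 0 <= thin_kernel a x y.
Proof.
move=> a01; rewrite /thin_kernel addr_ge0// mulr_ge0 ?jump_ge0//.
  exact: no_death_ge0.
exact: one_death_ge0.
Qed.

Lemma sum_thin_kernel a x L : \sum_(y < L) thin_kernel a x.+1 y =
  no_death a x.+1 * (\sum_(k < L - x.+1) g k) + one_death a x.+1 * (\sum_(k < L - x) g k).
Proof. by rewrite /thin_kernel big_split/= -!mulr_sumr sum_jump sum_jumpS. Qed.

Lemma thin_kernel0 a y : thin_kernel a 0 y = g y.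
Proof. by rewrite /thin_kernel /no_death /one_death /jump/= expr0 mul1r !mul0r subn0 addr0. Qed.

Lemma sum_thin_kernel_le1 a x L : 0 <= a <= 1 ->
  \sum_(y < L) thin_kernel a x y <= 1.
Proof.
move=> a01; case: x => [|x]; first by under eq_bigr do rewrite thin_kernel0.
rewrite sum_thin_kernel; apply: le_trans (no_one_death_le1 x.+1 a01).
by rewrite lerD// ler_piMr ?no_death_ge0 ?one_death_ge0.
Qed.

(* Expanding a quotient k'^2/k around k isolates the quadratic term. *)
Let sqr_div_expand (k k' r : R) : 0 < k -> (k' - k) ^+ 2 <= r * k ->
  k' ^+ 2 / k <= k + 2 * (k' - k) + r.
Proof.
move=> k0 h; rewrite ler_pdivrMr//.
have -> : (k + 2 * (k' - k) + r) * k = k' ^+ 2 - (k' - k) ^+ 2 + r * k by ring.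
by rewrite -addrA lerDl addrC subr_ge0.
Qed.

Variables (C tau a a' : R) (x L : nat).
Hypotheses (g_ratio : forall k, g k.+1 <= C * g k) (C0 : 0 <= C)
  (a0 : 0 < a) (aa' : a <= a') (a'1 : a' <= 1) (xa' : x%:R * a' <= 2^-1)
  (g_tail : 1 - tau <= \sum_(k < L - x) g k).

Let a01 : 0 <= a <= 1. Proof. by rewrite ltW//= (le_trans aa'). Qed.
Let a'01 : 0 <= a' <= 1. Proof. by rewrite (le_trans (ltW a0) aa')/=. Qed.

(** One-step contribution to the chi-square divergence between two thinning
    rates.  Because [g] does not increase by more than a factor [C], an arrival
    hides a simultaneous death: only a net decrease by one, whose probability is
    about [g 0 * x * a], reveals a death, and it alone contributes at first
    order. *)
Lemma thin_kernel_chi2 :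
  \sum_(y < L) thin_kernel a' x y ^+ 2 / thin_kernel a x y <=
  1 + g 0%N * (x%:R * (a' - a) ^+ 2 / a) +
  (2 * (x%:R * a') * tau +
   (6 + 2 * (1 + C) ^+ 2 + 6 * (a' / a)) * (x%:R * a') ^+ 2).
Proof.
have g01 : g 0%N <= 1 by have := g_sum 1; rewrite big_ord1.
move: (x) xa' g_tail => [_ _|x1 xa'1 tail1].
  rewrite !mul0r expr0n !mulr0 !mul0r !addr0.
  apply: le_trans (sum_thin_kernel_le1 0 L a01); apply: ler_sum => y _.
  rewrite !thin_kernel0; have [->|gy] := eqVneq (g y) 0; first by rewrite expr0n mul0r.
  by rewrite expr2 mulfK.
set b0 := no_death a x1.+1; set b1 := one_death a x1.+1.
set b0' := no_death a' x1.+1; set b1' := one_death a' x1.+1.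
set r := x1.+1%:R * a; set s := x1.+1%:R * a'; set D := x1.+1%:R * (a' - a).
have a'0 : 0 < a' by exact: lt_le_trans aa'.
have r0 : 0 < r by rewrite mulr_gt0.
have sh : s <= 2^-1 := xa'1.
have sC : 0 <= 2 * s ^+ 2 * (1 + C) ^+ 2.
  by apply: mulr_ge0; [apply: mulr_ge0 => //; exact: sqr_ge0|exact: sqr_ge0].
have rs : r <= s by rewrite ler_wpM2l.
have DE : D = s - r by rewrite /D mulrBr.
have r2s2 : r ^+ 2 <= s ^+ 2 by rewrite lerXn2r// nnegrE ltW// (lt_le_trans r0).
have b0_ge : 1 - r <= b0 := no_death_ge _ a01.
have b0'_ge : 1 - s <= b0' := no_death_ge _ a'01.
have b0'_le : b0' <= 1 - s + s ^+ 2 := no_death_le _ a'01.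
have b0_le1 : b0 <= 1 := no_death_le1 _ a01.
have b0'b0 : b0' <= b0.
  by rewrite /b0' /b0 /no_death lerXn2r ?nnegrE ?subr_ge0 ?lerD2l ?lerN2//; case/andP: a01.
have b1_le : b1 <= r := one_death_le _ a01.
have b1'_le : b1' <= s := one_death_le _ a'01.
have b1_ge : r * (1 - r) <= b1 := one_death_ge _ a01.
have b1'_ge : s * (1 - s) <= b1' := one_death_ge _ a'01.
have b1_0 : 0 < b1 by apply: lt_le_trans b1_ge; rewrite mulr_gt0// subr_gt0; lra.
have b1'0 : 0 <= b1' := one_death_ge0 _ a'01.
have b1b1'D : `|b1' - b1| <= D + s ^+ 2 by rewrite ler_norml DE; apply/andP; split; nra.
have b1b1' : `|b1' - b1| <= s by rewrite ler_norml; apply/andP; split; lra.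
(* The state [x - 1] is reached only by a death without arrivals; its
   probability is proportional to [b1], and the change of rate costs [q].  In
   all states above, the change of the kernel is of order [s] relatively to a
   kernel bounded below by [jump / 2], which costs [s ^ 2]. *)
pose q := (b1' - b1) ^+ 2 / b1.
pose r' (y : nat) : R := 2 * s ^+ 2 * (1 + C) ^+ 2 * jump x1.+1 y + q * g 0%N * (y == x1)%:R.
have q0 : 0 <= q by rewrite divr_ge0// ?sqr_ge0// ltW.
have pointwise (y : 'I_L) : thin_kernel a' x1.+1 y ^+ 2 / thin_kernel a x1.+1 y <=
    thin_kernel a x1.+1 y + 2 * (thin_kernel a' x1.+1 y - thin_kernel a x1.+1 y) + r' y.
  rewrite /thin_kernel -/b0 -/b1 -/b0' -/b1' /r'.
  have [yx|xy|yx] := ltngtP (nat_of_ord y) x1.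
  - have -> : jump x1.+1 y = 0 by rewrite /jump ltnNge (ltnW yx).
    have -> : jump x1.+1 y.+1 = 0 by rewrite /jump ltnS leqNgt yx.
    rewrite !mulr0 !addr0.
    by rewrite expr0n mul0r subrr mulr0 addr0.
  - have -> : jump x1.+1 y = g (y - x1.+1)%N by rewrite /jump xy.
    have -> : jump x1.+1 y.+1 = g (y - x1.+1).+1 by rewrite /jump ltnS (ltnW xy) subSn.
    rewrite mulr0 addr0.
    set u := g (y - x1.+1)%N; set v := g (y - x1.+1).+1.
    have u0 : 0 <= u by exact: g_ge0.
    have v0 : 0 <= v by exact: g_ge0.
    have vu : v <= C * u by exact: g_ratio.
    have [u00|u1] := eqVneq u 0.
      have -> : v = 0 by apply/eqP; rewrite eq_le v0 andbT; move: vu; rewrite u00 mulr0.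
      by rewrite u00 !mulr0 !addr0 expr0n mul0r subrr mulr0 addr0.
    have {u0 u1} u0 : 0 < u by rewrite lt_def u1.
    have ku : u / 2 <= b0 * u + b1 * v.
      have : u * 2^-1 <= u * b0 by rewrite ler_wpM2l ?(ltW u0)//; lra.
      have : 0 <= b1 * v by rewrite mulr_ge0// ltW.
      lra.
    apply: sqr_div_expand; first by apply: lt_le_trans ku; rewrite divr_gt0.
    have dk : `|b0' * u + b1' * v - (b0 * u + b1 * v)| <= s * (1 + C) * u.
      have -> : b0' * u + b1' * v - (b0 * u + b1 * v) = (b0' - b0) * u + (b1' - b1) * v.
        by ring.
      apply: (le_trans (ler_normD _ _)); rewrite !normrM (gtr0_norm u0) (ger0_norm v0).
      have h1 : `|b0' - b0| * u <= s * u.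
        by rewrite ler_wpM2r ?(ltW u0)// ler_norml; apply/andP; split; lra.
      have h2 : `|b1' - b1| * v <= s * (C * u) by apply: ler_pM.
      by apply: (le_trans (lerD h1 h2)); rewrite le_eqVlt; apply/orP; left; apply/eqP; ring.
    rewrite -real_normK ?num_real//.
    apply: (@le_trans _ _ ((s * (1 + C) * u) ^+ 2)).
      rewrite lerXn2r ?nnegrE//.
      by rewrite !mulr_ge0 ?addr_ge0// ltW// (lt_le_trans r0).
    have -> : (s * (1 + C) * u) ^+ 2 = 2 * s ^+ 2 * (1 + C) ^+ 2 * u * (u / 2) by field.
    apply: ler_wpM2l => //; apply: mulr_ge0; last exact: ltW.
    exact: sC.
  - have -> : jump x1.+1 y = 0 by rewrite /jump yx ltnn.
    have -> : jump x1.+1 y.+1 = g 0%N by rewrite /jump yx leqnn subnn.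
    rewrite !mulr0 !add0r mulr1.
    have [->|g00] := eqVneq (g 0%N) 0; first by rewrite !mulr0 expr0n mul0r subrr mulr0 !addr0.
    have {}g00 : 0 < g 0%N by rewrite lt_def g00 g_ge0.
    apply: sqr_div_expand; first by rewrite mulr_gt0.
    have -> : q * g 0%N * (b1 * g 0%N) = (b1' * g 0%N - b1 * g 0%N) ^+ 2.
      by rewrite /q; field; rewrite gt_eqF.
    by [].
apply: (@le_trans _ _ (\sum_(y < L) (thin_kernel a x1.+1 y +
    2 * (thin_kernel a' x1.+1 y - thin_kernel a x1.+1 y) + r' y))).
  by apply: ler_sum => y _; exact: pointwise.
have -> : \sum_(y < L) (thin_kernel a x1.+1 y +
    2 * (thin_kernel a' x1.+1 y - thin_kernel a x1.+1 y) + r' y) =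
  \sum_(y < L) thin_kernel a x1.+1 y +
  2 * (\sum_(y < L) thin_kernel a' x1.+1 y - \sum_(y < L) thin_kernel a x1.+1 y) +
  (2 * s ^+ 2 * (1 + C) ^+ 2 * (\sum_(y < L) jump x1.+1 y) +
   q * g 0%N * (\sum_(y < L) (nat_of_ord y == x1)%:R)).
  by rewrite -sumrB !mulr_sumr -!big_split.
rewrite !sum_thin_kernel sum_jump -/b0 -/b1 -/b0' -/b1'.
set G0 := \sum_(k < L - x1.+1) g k; set G1 := \sum_(k < L - x1) g k.
have G00 : 0 <= G0 by exact: sumr_ge0.
have G01 : G0 <= 1 by exact: g_sum.
have G10 : 0 <= G1 by exact: sumr_ge0.
have G11 : G1 <= 1 by exact: g_sum.
have hit : \sum_(y < L) (nat_of_ord y == x1)%:R <= 1 :> R.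
  have [x1L|Lx1] := ltnP x1 L.
    rewrite (bigD1 (Ordinal x1L))//= eqxx big1 ?addr0// => y /negPf yx.
    by rewrite -[X in X%:R]/(nat_of_bool (y == Ordinal x1L)) yx.
  rewrite big1// => y _; rewrite ltn_eqF//; exact: leq_trans (ltn_ord y) Lx1.
(* Up to terms of higher order, [b1' - b1] is [D] and [b1] is [r], and
   [D ^ 2 / r] is the leading term.  The constants absorb the remainders by
   means of [r <= s <= 1 / 2]. *)
have hq : q <= x1.+1%:R * (a' - a) ^+ 2 / a + (2 + 6 * (a' / a)) * s ^+ 2.
  rewrite /q ler_pdivrMr//.
  have -> : x1.+1%:R * (a' - a) ^+ 2 / a = D ^+ 2 / r by rewrite /D /r; field; rewrite gt_eqF//= pnatr_eq0.
  have -> : a' / a = s / r by rewrite /s /r; field; rewrite gt_eqF//= pnatr_eq0.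
  have -> : D ^+ 2 / r + (2 + 6 * (s / r)) * s ^+ 2 = (D ^+ 2 + 2 * r * s ^+ 2 + 6 * s ^+ 3) / r.
    by field; rewrite gt_eqF.
  have s0 : 0 < s by exact: lt_le_trans rs.
  have D0 : 0 <= D by rewrite DE subr_ge0.
  apply: (@le_trans _ _ ((D + s ^+ 2) ^+ 2)).
    by rewrite -real_normK ?num_real// lerXn2r// nnegrE addr_ge0// sqr_ge0.
  apply: (@le_trans _ _ ((D ^+ 2 + 2 * r * s ^+ 2 + 6 * s ^+ 3) / r * (r * (1 - r)))); last first.
    rewrite ler_wpM2l// divr_ge0 ?(ltW r0)// !addr_ge0 ?sqr_ge0//.
      by rewrite !mulr_ge0 ?sqr_ge0// ltW.
    by rewrite mulr_ge0// exprn_ge0// ltW// (lt_le_trans r0).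
  have -> : (D ^+ 2 + 2 * r * s ^+ 2 + 6 * s ^+ 3) / r * (r * (1 - r)) =
    (D ^+ 2 + 2 * r * s ^+ 2 + 6 * s ^+ 3) * (1 - r) by field; rewrite gt_eqF.
  have s3 : 0 <= s ^+ 3 by rewrite exprn_ge0// ltW.
  have h1 : (D + s ^+ 2) ^+ 2 <= D ^+ 2 + 3 * s ^+ 3.
    have -> : (D + s ^+ 2) ^+ 2 = D ^+ 2 + 2 * D * s ^+ 2 + s * s ^+ 3 by ring.
    have : D * s ^+ 2 <= s * s ^+ 2 by rewrite ler_wpM2r ?sqr_ge0//; lra.
    have : s * s ^+ 3 <= 1 * s ^+ 3 by rewrite ler_wpM2r//; lra.
    by rewrite mul1r -[s * s ^+ 2]exprS => h h'; lra.
  apply: (le_trans h1).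
  have h2 : D ^+ 2 <= (D ^+ 2 + 2 * r * s ^+ 2) * (1 - r).
    have Ds2 : D ^+ 2 <= s ^+ 2 by rewrite lerXn2r ?nnegrE//; lra.
    have : r * D ^+ 2 <= r * s ^+ 2 by rewrite ler_wpM2l// ltW.
    move=> h; apply: (@le_trans _ _ ((D ^+ 2 + 2 * (r * D ^+ 2)) * (1 - r))).
      have -> : (D ^+ 2 + 2 * (r * D ^+ 2)) * (1 - r) =
        D ^+ 2 + D ^+ 2 * (r * (1 - 2 * r)) by ring.
      rewrite lerDl; apply: mulr_ge0; first exact: sqr_ge0.
      by apply: mulr_ge0; [exact: ltW|lra].
    by rewrite ler_wpM2r; lra.
  have h3 : s ^+ 3 * 2^-1 <= s ^+ 3 * (1 - r) by rewrite ler_wpM2l//; lra.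
  lra.
have G0q : q * g 0%N * (\sum_(y < L) (nat_of_ord y == x1)%:R) <=
    g 0%N * (x1.+1%:R * (a' - a) ^+ 2 / a) + (2 + 6 * (a' / a)) * s ^+ 2.
  have c0 : 0 <= (2 + 6 * (a' / a)) * s ^+ 2.
    by rewrite mulr_ge0 ?sqr_ge0// addr_ge0// mulr_ge0// divr_ge0// ltW.
  apply: (@le_trans _ _ (q * g 0%N)); first by rewrite ler_piMr// mulr_ge0.
  rewrite mulrC; apply: (le_trans (ler_wpM2l (g_ge0 0) hq)).
  by rewrite mulrDr lerD2l ler_piMl.
have D0 : 0 <= D by rewrite DE subr_ge0.
have s2 : 0 <= s ^+ 2 by exact: sqr_ge0.
have h1 : b0 * G0 + b1 * G1 <= 1.
  apply: le_trans (no_one_death_le1 x1.+1 a01).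
  by rewrite lerD// ler_piMr// ?(ltW b1_0)//; exact: no_death_ge0.
have h2 : (b0' - b0) * G0 <= - (D - s ^+ 2) * G0 by rewrite ler_wpM2r// DE; lra.
have h3 : (b1' - b1) * G1 <= D + s ^+ 2.
  apply: (le_trans (ler_norm _)); rewrite normrM (ger0_norm G10).
  by apply: le_trans b1b1'D; rewrite ler_piMr.
have h4 : D * (1 - G0) <= s * tau.
  have t1 : 1 - G0 <= tau by rewrite lerBlDr -lerBlDl; exact: tail1.
  by apply: ler_pM => //; rewrite ?subr_ge0// DE lerBlDr lerDl ltW.
have h5 : s ^+ 2 * G0 <= s ^+ 2 by rewrite ler_piMr.
have h6 : 2 * s ^+ 2 * (1 + C) ^+ 2 * G0 <= 2 * s ^+ 2 * (1 + C) ^+ 2.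
  by rewrite ler_piMr.
lra.
Qed.

End thinning_kernel.

(** * Paths and their probabilities *)

Section path_events.
Context {d : measure_display} {Omega : measurableType d} {R : realType}.
Variables (Z : nat -> nat -> {mfun Omega >-> bool})
          (eps : nat -> {mfun Omega >-> nat}).

Definition deaths (t x : nat) (w : Omega) : nat := (\sum_(j < x) ~~ Z t j w)%N.

Lemma survivors_deaths t x w : (\sum_(j < x) Z t j w + deaths t x w = x)%N.
Proof.
rewrite /deaths -big_split/= (eq_bigr (fun=> 1%N)); last by move=> j _; case: (Z t j w).
by rewrite sum1_card card_ord.
Qed.

Lemma inarS t w : (inar Z eps t.+1 w + deaths t (inar Z eps t w) w =
  inar Z eps t w + eps t w)%N.
Proof. by rewrite /= addnAC survivors_deaths. Qed.

Lemma inar_le_arrivals t w : (inar Z eps t w <= arrivals eps t w)%N.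
Proof.
elim: t => [|t IH]; first by rewrite /=.
rewrite /arrivals big_ord_recr/=; apply: leq_add => //.
apply: leq_trans IH; rewrite -[leqRHS](survivors_deaths t _ w); exact: leq_addr.
Qed.

(** Only the deaths separate the population from the arrivals. *)
Lemma inar_ge_arrivals t w : (arrivals eps t w <=
  inar Z eps t w + \sum_(s < t) deaths s (inar Z eps s w) w)%N.
Proof.
elim: t => [|t IH]; first by rewrite /arrivals big_ord0.
have -> : arrivals eps t.+1 w = (arrivals eps t w + eps t w)%N.
  by rewrite /arrivals big_ord_recr.
rewrite big_ord_recr [X in (_ <= _ + X)%N]/=.
move: IH (inarS t w); move: (inar Z eps t.+1 w) (deaths t _ w) => x' D.
by move: (arrivals _ _ _) (bigop _ _ _) => A S; lia.
Qed.

Definition step (t x y : nat) : set Omega :=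
  [set w | (deaths t x w <= 1)%N /\ (\sum_(j < x) Z t j w + eps t w)%N = y].

(** Paths are lists with the most recent state in front.  [path_event l] says
    that the process follows [l], losing at most one individual at each step; the
    empty list is no path. *)
Fixpoint path_event (l : seq nat) : set Omega :=
  match l with
  | [::] => set0
  | y :: l' => match l' with
               | [::] => [set _ | y = 0%N]
               | x :: l'' => path_event l' `&` step (size l'') x y
               end
  end.

Fixpoint path_weight (g : nat -> R) (a : R) (l : seq nat) : R :=
  match l with
  | [::] => 0
  | y :: l' => match l' with
               | [::] => (y == 0%N)%:R
               | x :: l'' => path_weight g a l' * thin_kernel g a x y
               end
  end.

Fixpoint history (n : nat) (w : Omega) : seq nat :=
  if n is m.+1 then inar Z eps n w :: history m w else [:: 0%N].

Lemma size_history n w : size (history n w) = n.+1.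
Proof. by elim: n => //= n ->. Qed.

Lemma nth_history n w i : (i <= n)%N -> nth 0%N (history n w) (n - i) = inar Z eps i w.
Proof.
elim: n => [|n IH]; first by rewrite leqn0 => /eqP->.
rewrite leq_eqVlt => /predU1P[->|]; first by rewrite subnn.
by rewrite ltnS => ni; rewrite subSn//= IH.
Qed.

Lemma path_event_history l w : path_event l w -> l = history (size l).-1 w.
Proof.
elim: l => //= y [_ -> //|x l''] IH [hl [_ <-]] /=.
have hx := IH hl.
have hx0 : x = inar Z eps (size l'') w.
  by move: hx => /=; case: (size l'') => [|k] /= [].
by rewrite /= -hx0 -hx.
Qed.

Lemma history_path_event n w :
  (forall t, (t < n)%N -> (deaths t (inar Z eps t w) w <= 1)%N) ->
  path_event (history n w) w.
Proof.
elim: n => [//|n IH] hd.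
have {IH} : path_event (history n w) w by apply: IH => t tn; apply: hd; exact: ltnW.
have := hd n (ltnSn n).
case: n {hd} => [|n] /= h1 h2; first by split.
by split => //; rewrite size_history; split.
Qed.

Lemma path_event_inj l l' w : size l = size l' ->
  path_event l w -> path_event l' w -> l = l'.
Proof. by move=> ll' /path_event_history-> /path_event_history->; rewrite ll'. Qed.

Definition path_tuple n (l : seq nat) : n.+1.-tuple nat :=
  [tuple nth 0%N l (n - i)%N | i < n.+1].

Lemma path_event_trajectory n l w : size l = n.+1 -> path_event l w ->
  trajectory Z eps n w = path_tuple n l.
Proof.
move=> sl /path_event_history; rewrite sl/= => ->.
apply: eq_from_tnth => i; rewrite !tnth_mktuple nth_history//.
by rewrite -ltnS.
Qed.

Let I := (nat * nat + nat)%type.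

(** The part of the noise that drives the step at time [t], respectively all
    steps before [t], as long as the population does not exceed [N].  These two
    blocks are disjoint, which makes the steps of a path independent. *)
Definition present (t N : nat) : seq I :=
  [seq inl (t, j) | j <- iota 0 N] ++ [:: inr t].

Definition past (t N : nat) : seq I := flatten [seq present s N | s <- iota 0 t].

Definition time (i : I) : nat := match i with inl tj => tj.1 | inr t => t end.

Lemma present_time t N i : i \in present t N -> time i = t.
Proof. by rewrite mem_cat => /orP[/mapP[j _ ->]|]//; rewrite inE => /eqP->. Qed.

Lemma past_time t N i : i \in past t N -> (time i < t)%N.
Proof.
move=> /flattenP[s /mapP[k]]; rewrite mem_iota => /= kt ->.
by move=> /present_time->.
Qed.

Lemma present_uniq t N : uniq (present t N).
Proof.
rewrite cat_uniq/= orbF andbT map_inj_uniq ?iota_uniq//=; last by move=> i j [].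
by apply/negP => /mapP[j].
Qed.

Lemma pastS t N : past t.+1 N = past t N ++ present t N.
Proof. by rewrite /past -addn1 iotaD map_cat flatten_cat/= cats0. Qed.

Lemma past_present_uniq t N : uniq (past t N ++ present t N).
Proof.
elim: t => [|t IH]; first exact: present_uniq.
rewrite pastS cat_uniq IH present_uniq andbT/=; apply/hasPn => i /present_time it.
apply/negP; rewrite mem_cat => /orP[/past_time|/present_time]; rewrite it.
  by rewrite ltnNge leqW.
by move=> /eqP; rewrite gtn_eqF.
Qed.

Lemma mem_present_Z t N j : (j < N)%N -> inl (t, j) \in present t N.
Proof. by move=> jN; rewrite mem_cat map_f// mem_iota. Qed.

Lemma mem_present_eps t N : inr t \in present t N.
Proof. by rewrite mem_cat mem_head orbT. Qed.

Let depn := dep (noise Z eps).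

Lemma noise_inj_Z t j w w' :
  noise Z eps (inl (t, j)) w = noise Z eps (inl (t, j)) w' -> Z t j w = Z t j w'.
Proof. by rewrite /=; case: (Z t j w); case: (Z t j w'). Qed.

Lemma dep_step t x y N : (x <= N)%N -> depn (present t N) (step t x y).
Proof.
move=> xN w w' ww' [].
have zz (j : 'I_x) : Z t j w = Z t j w'.
  by apply/noise_inj_Z/ww'/mem_present_Z; exact: leq_trans (ltn_ord j) xN.
rewrite /deaths/step/deaths/=; under eq_bigr do rewrite zz.
under [in X in _ -> X -> _]eq_bigr do rewrite zz.
by rewrite -[eps t w]/(noise Z eps (inr t) w) ww' ?mem_present_eps.
Qed.

Lemma depI s E F : depn s E -> depn s F -> depn s (E `&` F).
Proof. by move=> dE dF w w' ww' [Ew Fw]; split; [exact: (dE w)|exact: (dF w)]. Qed.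

Lemma dep_path_event l N : all (leq^~ N) l ->
  depn (past (size l).-1 N) (path_event l).
Proof.
elim: l => [_ w w' _ []|y [_ _ w w' _ //|x l''] IH /= /andP[yN /andP[xN lN]]].
rewrite pastS; apply: depI.
  apply: (dep_sub (s := past (size l'') N)).
    by move=> i il; rewrite mem_cat il.
  by apply: IH; rewrite /= xN.
apply: (dep_sub (s := present (size l'') N)); last exact: dep_step.
by move=> i il; rewrite mem_cat il orbT.
Qed.

Lemma measurable_Z t j b : measurable [set w | Z t j w = b].
Proof.
apply: (@dep_noise_measurable _ _ Z eps [:: inl (t, j)]) => w w' ww' /= <-.
by apply/esym/noise_inj_Z/ww'; rewrite mem_head.
Qed.

Lemma measurable_path_event l : measurable (path_event l).
Proof.
have lN : all (leq^~ (foldr maxn 0%N l)) l.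
  elim: l => //= y l IH; rewrite leq_maxl/=.
  by apply: sub_all IH => i /= /leq_trans; apply; exact: leq_maxr.
exact: (@dep_noise_measurable _ _ Z eps _ _ (dep_path_event lN)).
Qed.

Section probabilities.
Variables (P : probability Omega R) (theta : R) (G : probability nat R).
Hypotheses (theta01 : 0 <= theta <= 1) (hP : inar_noise Z eps P theta G).

Let g := pmf_nat G.

(* All [Z t j] with [j < x] equal 1, except for [j = i]; the choice [i = x]
   stands for no exception. *)
Let pattern t x i k : set Omega :=
  [set w | (forall j, (j < x)%N -> Z t j w = (j != i)) /\ eps t w = k].

Let dep_pattern t x i k : depn (present t x) (pattern t x i k).
Proof.
move=> w w' ww' [hZ he]; split.
  by move=> j jx; rewrite -(hZ j jx); apply/esym/noise_inj_Z/ww'/mem_present_Z.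
by rewrite -he -[eps t w]/(noise Z eps (inr t) w) ww' ?mem_present_eps.
Qed.

Let Pr_pattern t x i k : (i <= x)%N ->
  Pr P (pattern t x i k) = (if i == x then theta ^+ x else (1 - theta) * theta ^+ x.-1) * g k.
Proof.
move=> ix; have [_ _ hX] := hP.
pose A (u : I) : set nat := match u with
  | inl tj => [set nat_of_bool (tj.2 != i)] | inr _ => [set k] end.
have -> : pattern t x i k = \bigcap_(u in [set` present t x]) (noise Z eps u @^-1` A u).
  apply/seteqP; split => [w [hZ he] u /=|w h].
    rewrite mem_cat => /orP[/mapP[j]|]; last by rewrite inE => /eqP->.
    by rewrite mem_iota/= => jx -> /=; rewrite hZ.
  split; last exact: (h _ (mem_present_eps t x)).
  by move=> j jx; have /= := h _ (mem_present_Z t jx); case: (Z t j w); case: (j != i).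
rewrite /Pr hX ?present_uniq// /present big_cat big_map big_seq1/=.
rewrite -[P _ in X in (_ * X)%E]/(P (eps t @^-1` [set k])) (prob_eps hP) -/g pmf_natE.
have -> : (\prod_(j <- iota 0 x) P (noise Z eps (inl (t, j)) @^-1` A (inl (t, j))) =
  (\prod_(j < x) if (val j) != i then theta else 1 - theta)%:E)%E.
  have -> : iota 0 x = index_iota 0 x by rewrite /index_iota subn0.
  rewrite big_mkord -prodEFin; apply: eq_bigr => j _.
  rewrite -(Pr_Z theta01 hP t j) -PrE; last exact: measurable_Z.
  by congr (P _); apply/seteqP; split => w /=; case: (Z t j w); case: (val j != i).
rewrite -EFinM/=; congr (_ * _).
have [->|ix'] := eqVneq i x.
  rewrite (eq_bigr (fun=> theta)) ?prodr_const ?card_ord// => j _.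
  by rewrite ltn_eqF.
have ltix : (i < x)%N by rewrite ltn_neqAle ix'.
rewrite (bigD1 (Ordinal ltix))//= eqxx; congr (_ * _).
rewrite (eq_bigr (fun=> theta)) => [|j /negPf ji]; last first.
  by rewrite -[X in ~~ X]/(j == Ordinal ltix) ji.
rewrite prodr_const (_ : #|_| = x.-1)//.
by rewrite -[in RHS](card_ord x) -(cardC1 (Ordinal ltix)); apply: eq_card.
Qed.

Let stepE t x y : step t x y = [set w | exists2 i, i \in iota 0 x.+1 &
  (if i == x then (x <= y)%N /\ pattern t x i (y - x)%N w
   else (x <= y.+1)%N /\ pattern t x i (y.+1 - x)%N w)].
Proof.
have patD i k w : (i <= x)%N -> pattern t x i k w -> deaths t x w = (i != x).
  move=> ix [hZ _]; rewrite /deaths.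
  rewrite (eq_bigr (fun j : 'I_x => (val j == i)%N : nat)); last first.
    by move=> j _; rewrite hZ// negbK.
  have [->|ix'] := eqVneq i x; first by apply: big1 => j _; rewrite (ltn_eqF (ltn_ord j)).
  have ltix : (i < x)%N by rewrite ltn_neqAle ix'.
  rewrite (bigD1 (Ordinal ltix))//= eqxx big1 ?addn0// => j /negPf ji.
  by rewrite -[X in nat_of_bool X]/(j == Ordinal ltix) ji.
apply/seteqP; split => [w [d1 yE]|w [i]].
  have sd := survivors_deaths t x w.
  have [d0|d0] := posnP (deaths t x w).
    exists x; first by rewrite mem_iota/=.
    rewrite eqxx; split; first by lia.
    split; last by lia.
    move=> j jx; rewrite ltn_eqF//=.
    move/eqP: d0; rewrite /deaths sum_nat_eq0 => /forallP/(_ (Ordinal jx))/=.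
    by case: (Z t j w).
  have {d1 d0} d1 : deaths t x w = 1%N by lia.
  have [i hi] : exists i : 'I_x, ~~ Z t i w.
    apply: contrapT => h; move: d1; rewrite /deaths big1// => i _.
    by apply/eqP; rewrite eqb0; apply/negP => Zi; apply: h; exists i.
  exists (nat_of_ord i); first by rewrite mem_iota/= ltnW// ltnS.
  rewrite (ltn_eqF (ltn_ord i)); split; first by lia.
  split; last by lia.
  move=> j jx; have [->|ji] := eqVneq j i; first by apply/negbTE.
  apply: contrapT => /negP Zj; move: d1; rewrite /deaths (bigD1 i)//= hi.
  rewrite (bigD1 (Ordinal jx))/=; last by rewrite -val_eqE.
  by rewrite Zj.
rewrite mem_iota/= add0n ltnS => ix.
have sd := survivors_deaths t x w.
have [ix'|ix'] := eqVneq i x => -[xy] pat; have := patD _ _ _ ix pat;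
  rewrite ?ix' ?eqxx/= => dE; case: pat => _ eE; split; lia.
Qed.

Let set_and (b : bool) (A : set Omega) : (fun w => b /\ A w) = if b then A else set0.
Proof. by case: b; apply/seteqP; split => // w []. Qed.

(** The step splits according to the individual that dies, if any does. *)
Lemma Pr_step t x y : Pr P (step t x y) = thin_kernel g (1 - theta) x y.
Proof.
rewrite stepE Pr_bigU_disj ?iota_uniq//; first last.
- move=> i j w; rewrite !mem_iota/= !add0n !ltnS => ix jx hi hj.
  have {}hi : exists k, pattern t x i k w by move: hi; case: ifP => _ [_ ?]; eexists; eassumption.
  have {}hj : exists k, pattern t x j k w by move: hj; case: ifP => _ [_ ?]; eexists; eassumption.
  move: hi hj => [k [hi _]] [k' [hj _]].
  have [ij|ji|//] := ltngtP i j.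
    have := hi i (leq_trans ij jx).
    by rewrite hj ?(leq_trans ij)// eqxx ltn_eqF.
  have := hj j (leq_trans ji ix).
  by rewrite hi ?(leq_trans ji)// eqxx ltn_eqF.
- move=> i _; have mp j k : measurable (pattern t x j k).
    apply: (@dep_noise_measurable _ _ Z eps (present t x)); exact: dep_pattern.
  by case: (i == x); rewrite set_and; case: ifP.
have th : theta = 1 - (1 - theta) by rewrite opprB addrC subrK.
rewrite -addn1 iotaD big_cat/= big_seq1 add0n eqxx addrC; congr (_ + _).
  rewrite set_and /jump; case: ifPn => xy; last by rewrite Pr_set0 mulr0.
  by rewrite Pr_pattern// eqxx /no_death -th.
have -> : one_death (1 - theta) x * jump g x y.+1 =
    \sum_(i <- iota 0 x) ((1 - theta) * theta ^+ x.-1 * jump g x y.+1).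
  rewrite big_const_seq count_predT size_iota iter_addr_0 -mulr_natl !mulrA.
  by rewrite /one_death -th.
apply: eq_big_seq => i; rewrite mem_iota/= add0n => ix; rewrite ltn_eqF//.
rewrite set_and /jump; case: ifPn => xy; last by rewrite Pr_set0 mulr0.
by rewrite Pr_pattern ?(ltnW ix)// ltn_eqF.
Qed.

(** The steps of a path read off disjoint blocks of the noise. *)
Lemma Pr_path_event l : Pr P (path_event l) = path_weight g (1 - theta) l.
Proof.
elim: l => [|y l IH]; first exact: Pr_set0.
case: l IH => [|x l''] IH.
  rewrite /=; have [->|y0] := eqVneq y 0%N.
    by rewrite (_ : [set _ | _] = setT) ?Pr_setT//; apply/seteqP; split.
  by rewrite (_ : [set _ | _] = set0) ?Pr_set0//; apply/seteqP; split => // w /eqP; rewrite (negbTE y0).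
pose N := foldr maxn 0%N (x :: l'').
have lN : all (leq^~ N) (x :: l'').
  rewrite /N; elim: (x :: l'') => //= z l IHl; rewrite leq_maxl/=.
  by apply: sub_all IHl => i /= /leq_trans; apply; exact: leq_maxr.
rewrite [path_event _]/(path_event (x :: l'') `&` step (size l'') x y).
rewrite (Pr_indep_noise hP (past_present_uniq (size l'') N)).
- by rewrite IH Pr_step.
- exact: (dep_path_event lN).
- by apply: dep_step; case/andP: lN.
Qed.

End probabilities.
End path_events.

Section path_lists.
Context {R : realType}.
Variables (b : nat -> nat) (N : nat).

(** The paths of length [n] whose states do not exceed [N], nor [b t] at each time
    [t] before the last: a finite set, over which likelihoods are summed. *)
Fixpoint paths (n : nat) : seq (seq nat) :=
  if n is m.+1 then
    [seq y :: l | l <- [seq l <- paths m | (head 0%N l <= b m)%N], y <- iota 0 N.+1]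
  else [:: [:: 0%N]].

Lemma pathsS n : paths n.+1 =
  [seq y :: l | l <- [seq l <- paths n | (head 0%N l <= b n)%N], y <- iota 0 N.+1].
Proof. by []. Qed.

Lemma size_path n l : l \in paths n -> size l = n.+1.
Proof.
elim: n l => [|n IH] l; first by rewrite inE => /eqP->.
rewrite pathsS => /allpairsP[[l' y] /= [+ _ ->]]; rewrite mem_filter => /andP[_ /IH] /= ->.
by [].
Qed.

Lemma uniq_paths n : uniq (paths n).
Proof.
elim: n => // n IH; rewrite pathsS; apply: allpairs_uniq; rewrite ?filter_uniq ?iota_uniq//.
by move=> [l y] [l' y'] _ _ [-> ->].
Qed.

Lemma sum_paths n (F : seq nat -> R) : \sum_(l <- paths n.+1) F l =
  \sum_(l <- paths n | (head 0%N l <= b n)%N) \sum_(y < N.+1) F (nat_of_ord y :: l).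
Proof.
rewrite pathsS big_allpairs_dep big_filter; apply: eq_bigr => l _.
have -> : iota 0 N.+1 = index_iota 0 N.+1 by rewrite /index_iota subn0.
by rewrite big_mkord.
Qed.

Variables (g : nat -> R) (a a' : R).
Hypotheses (g_ge0 : forall k, 0 <= g k) (a01 : 0 <= a <= 1) (a'01 : 0 <= a' <= 1).

Lemma path_weight_ge0 c l : 0 <= c <= 1 -> 0 <= path_weight g c l.
Proof.
move=> c01; elim: l => [//|y l IH]; case: l IH => [|x l] IH; first by rewrite /=.
rewrite [path_weight _ _ _]/(path_weight g c (x :: l) * thin_kernel g c x y).
by rewrite mulr_ge0// thin_kernel_ge0.
Qed.

Lemma path_weight_cons c y l : (0 < size l)%N ->
  path_weight g c (y :: l) = path_weight g c l * thin_kernel g c (head 0%N l) y.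
Proof. by case: l. Qed.

(** Summation over the last step costs a factor of at most
    [1 + B n <= expR (B n)], uniformly in the past, because a path that is
    continued satisfies [x <= b n]. *)
Lemma sum_paths_chi2 (B : nat -> R) n :
  (forall t x, (t < n)%N -> (x <= b t)%N ->
    \sum_(y < N.+1) thin_kernel g a' x y ^+ 2 / thin_kernel g a x y <= 1 + B t) ->
  \sum_(l <- paths n) path_weight g a' l ^+ 2 / path_weight g a l <=
  expR (\sum_(t < n) B t).
Proof.
elim: n => [_|n IH hB].
  by rewrite big_seq1 /= big_ord0 expR0 expr1n divr1.
have pos l : 0 <= path_weight g a' l ^+ 2 / path_weight g a l.
  by rewrite divr_ge0 ?sqr_ge0// path_weight_ge0.
rewrite big_ord_recr/= expRD sum_paths.
apply: (@le_trans _ _ (\sum_(l <- paths n)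
    path_weight g a' l ^+ 2 / path_weight g a l * expR (B n))); last first.
  rewrite -mulr_suml ler_wpM2r ?expR_ge0// IH// => t x tn.
  by apply: hB; exact: ltnW.
rewrite big_mkcond !big_seq; apply: ler_sum => l lp.
case: ifPn => [hl|_]; last by rewrite mulr_ge0// expR_ge0.
have sl : (0 < size l)%N by rewrite (size_path lp).
under eq_bigr do rewrite !path_weight_cons// exprMn invfM mulrACA.
rewrite -mulr_sumr ler_wpM2l//.
by apply: (le_trans (hB n _ (ltnSn n) hl)); rewrite expR_ge1Dx.
Qed.

Lemma thin_kernel_eq0 x y : 0 < a -> a < 1 ->
  thin_kernel g a x y = 0 -> thin_kernel g a' x y = 0.
Proof.
move=> a0 a1; have n0 : 0 < no_death a x by rewrite /no_death exprn_gt0// subr_gt0.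
rewrite /thin_kernel => /eqP; rewrite paddr_eq0; first last.
- by rewrite mulr_ge0 ?one_death_ge0 ?jump_ge0.
- by rewrite mulr_ge0 ?(ltW n0) ?jump_ge0.
rewrite !mulf_eq0 gt_eqF//= => /andP[/eqP-> /orP[|/eqP->]]; last by rewrite !mulr0 addr0.
rewrite (gt_eqF a0) orbF expf_eq0 subr_eq0 (gt_eqF a1) andbF orbF.
by move=> /eqP x0; rewrite /one_death x0 !mul0r mulr0 addr0.
Qed.

(** On the listed paths one law is absolutely continuous with respect to the other:
    as long as [0 < a < 1], a step is impossible only for want of arrivals of the
    required size. *)
Lemma path_weight_eq0 l : 0 < a -> a < 1 ->
  path_weight g a l = 0 -> path_weight g a' l = 0.
Proof.
move=> a0 a1; elim: l => [//|y l IH]; case: l IH => [//|x l] IH.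
rewrite (path_weight_cons a y (l := x :: l))// (path_weight_cons a' y (l := x :: l))//.
move=> /eqP; rewrite mulf_eq0 => /orP[] /eqP.
  by move/IH ->; rewrite mul0r.
by move/thin_kernel_eq0 => ->//; rewrite mulr0.
Qed.

End path_lists.

(** * The truncated Hammersley--Chapman--Robbins inequality *)

Section likelihood_comparison.
Context {d : measure_display} {Omega : measurableType d} {R : realType}.
Variables (Z : nat -> nat -> {mfun Omega >-> bool})
          (eps : nat -> {mfun Omega >-> nat}).

Lemma leq_deaths t x y w : (x <= y)%N -> (deaths Z t x w <= deaths Z t y w)%N.
Proof.
move=> /subnKC <-; elim: (y - x)%N => [|k IH]; first by rewrite addn0.
by rewrite addnS (leq_trans IH)// /deaths big_ord_recr leq_addr.
Qed.

Definition double_death (n N : nat) : set Omega :=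
  [set w | exists2 t, t \in iota 0 n & (1 < deaths Z t N w)%N].

Lemma measurable_deaths t x (A : set nat) : measurable [set w | A (deaths Z t x w)].
Proof.
apply: (@dep_noise_measurable _ _ Z eps [seq inl (t, j) | j <- iota 0 x]) => w w' ww' /=.
rewrite /deaths (eq_bigr (fun j : 'I_x => (~~ Z t j w' : nat)))// => j _.
by rewrite (noise_inj_Z (ww' (inl (t, val j)) _))// map_f// mem_iota/=.
Qed.

Lemma measurable_double_death n N : measurable (double_death n N).
Proof.
apply: measurable_exists_in => t _; exact: (measurable_deaths t N [set k | (1 < k)%N]).
Qed.

Lemma history_in_paths b N n w :
  (forall t, (t < n)%N -> (inar Z eps t w <= b t)%N) ->
  (forall t, (t <= n)%N -> (inar Z eps t w <= N)%N) ->
  history Z eps n w \in paths b N n.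
Proof.
elim: n => [//|n IH] hb hN.
have hn : history Z eps n w \in paths b N n.
  by apply: IH => t tn; [apply: hb; exact: ltnW|apply: hN; exact: leqW].
rewrite pathsS; apply/allpairsP; exists (history Z eps n w, inar Z eps n.+1 w).
split; [|by rewrite mem_iota add0n ltnS; exact: hN|by []].
rewrite mem_filter hn andbT.
by case: n hb {IH hN hn} => //= n hb; exact: hb.
Qed.

Section one_law.
Variables (P : probability Omega R) (theta : R) (G : probability nat R).
Hypotheses (theta01 : 0 <= theta <= 1) (hP : inar_noise Z eps P theta G).

Lemma Pr_two_deaths t i j : i != j ->
  Pr P [set w | Z t i w = false /\ Z t j w = false] = (1 - theta) ^+ 2.
Proof.
move=> ij; rewrite -[X in Pr P X]/([set w | Z t i w = false] `&` [set w | Z t j w = false]).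
rewrite (Pr_indep_noise hP (s := [:: inl (t, i)]) (s' := [:: inl (t, j)])).
- by rewrite !(Pr_Z theta01 hP) expr2.
- by rewrite /= inE andbT -[_ == _]/((t == t) && (i == j)) eqxx.
- move=> w w' ww' /= <-; apply/esym/(@noise_inj_Z _ _ Z eps)/ww'.
  by rewrite mem_head.
- move=> w w' ww' /= <-; apply/esym/(@noise_inj_Z _ _ Z eps)/ww'.
  by rewrite mem_head.
Qed.

(** Union bound over the times and over the pairs of individuals. *)
Lemma Pr_double_death n N :
  Pr P (double_death n N) <= n%:R * (N%:R * (1 - theta)) ^+ 2.
Proof.
have two t w : (1 < deaths Z t N w)%N -> exists i j, [/\ (i < N)%N, (j < N)%N, i != j &
    Z t i w = false /\ Z t j w = false].
  move=> h.
  have [i hi] : exists i : 'I_N, ~~ Z t i w.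
    apply: contrapT => nh; move: h; rewrite /deaths big1// => i _.
    by apply/eqP; rewrite eqb0; apply/negP => Zi; apply: nh; exists i.
  have [j /andP[ji hj]] : exists j : 'I_N, (j != i) && ~~ Z t j w.
    apply: contrapT => nh; move: h; rewrite /deaths (bigD1 i)//= hi big1// => j ji.
    by apply/eqP; rewrite eqb0; apply/negP => Zj; apply: nh; exists j; rewrite ji.
  by exists i, j; split => //; [rewrite eq_sym|split; apply/negbTE].
pose E (p : nat * (nat * nat)) : set Omega :=
  if p.2.1 == p.2.2 then set0 else [set w | Z p.1 p.2.1 w = false /\ Z p.1 p.2.2 w = false].
pose s := [seq (t, ij) | t <- iota 0 n, ij <- [seq (i, j) | i <- iota 0 N, j <- iota 0 N]].
have mE p : measurable (E p).
  rewrite /E; case: ifP => // _.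
  by apply: measurableI; exact: (@measurable_Z _ _ Z eps).
apply: (@le_trans _ _ (Pr P [set w | exists2 p, p \in s & E p w])).
  apply: le_Pr; [exact: measurable_double_death|exact: measurable_exists_in|].
  move=> w [t tn /two[i [j [iN jN ij Zij]]]]; exists (t, (i, j)).
    apply/allpairsP; exists (t, (i, j)); split => //=.
    by apply/allpairsP; exists (i, j); rewrite !mem_iota.
  by rewrite /E/= (negbTE ij).
apply: (le_trans (Pr_exists_in_le P (fun p _ => mE p))).
apply: (@le_trans _ _ (\sum_(p <- s) (1 - theta) ^+ 2)).
  apply: ler_sum => p _; rewrite /E; case: ifPn => [_|ij]; first by rewrite Pr_set0 sqr_ge0.
  by rewrite Pr_two_deaths.
rewrite big_const_seq count_predT iter_addr_0 /s !size_allpairs !size_iota.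
by rewrite -(mulr_natr (_ ^+ 2)) !natrM le_eqVlt; apply/orP; left; apply/eqP; ring.
Qed.

Lemma bmeas_trajectory n (phi : n.+1.-tuple nat -> R) (M : R) :
  (forall x, `|phi x| <= M) -> bmeas (fun w => phi (trajectory Z eps n w)).
Proof.
move=> phiM; split; last by exists M.
exact: (measurableT_comp (f := statistic phi)).
Qed.

Lemma sum_path_weight_le n (psi : n.+1.-tuple nat -> R) (b : nat -> nat) (N : nat) :
  bmeas (fun w => psi (trajectory Z eps n w)) -> (forall x, 0 <= psi x) ->
  \sum_(l <- paths b N n) path_weight (pmf_nat G) (1 - theta) l * psi (path_tuple n l) <=
  Ex P (fun w => psi (trajectory Z eps n w)).
Proof.
move=> bpsi psi0.
under eq_bigr do rewrite -(Pr_path_event theta01 hP).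
apply: Ex_ge_disj_sum => //.
- exact: uniq_paths.
- by move=> l _; exact: measurable_path_event.
- move=> l l' w ll ll'; apply: path_event_inj.
  by rewrite (size_path ll) (size_path ll').
- by move=> l w ll /path_event_trajectory-> //; exact: size_path ll.
Qed.

(** Trajectories outside the listed paths are off course or have a double death. *)
Lemma sum_path_weight_ge n (c : R) (N : nat) :
  let b t := Num.truncn (t%:R * mean_nat G + c * n%:R) in
  0 <= c -> 0 <= mean_nat G -> (b n <= N)%N ->
  1 - Pr P (off_course eps G c n) - Pr P (double_death n (b n)) <=
  \sum_(l <- paths b N n) path_weight (pmf_nat G) (1 - theta) l.
Proof.
move=> b c0 mu0 bN.
have mO := measurable_off_course Z eps G c n.
have mD := measurable_double_death n (b n).
have mU := measurableU _ _ mO mD.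
under eq_bigr do rewrite -(Pr_path_event theta01 hP).
apply: (@le_trans _ _ (1 - Pr P (off_course eps G c n `|` double_death n (b n)))).
  by rewrite -addrA -opprD lerD2l lerN2 PrU_le.
rewrite -PrC//.
apply: le_trans (Pr_exists_in_le P (fun l _ => measurable_path_event Z eps l)).
apply: le_Pr; [exact: measurableC|by apply: measurable_exists_in => l _; exact: measurable_path_event|].
move=> w /not_orP[nO nD].
have hb t : (t <= n)%N -> (inar Z eps t w <= b t)%N.
  move=> tn; apply: (leq_trans (inar_le_arrivals _ _ _ _)).
  rewrite /b truncn_ge_nat ?addr_ge0 ?mulr_ge0//.
  rewrite leNgt; apply/negP => h; apply: nO; exists t => //.
  by rewrite ltr_normr ltrBrDl h.
have bmono t : (t <= n)%N -> (b t <= b n)%N.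
  by move=> tn; apply: le_truncn; rewrite lerD2r ler_wpM2r// ler_nat.
exists (history Z eps n w).
  apply: history_in_paths => t tn; first exact/hb/ltnW.
  exact: leq_trans (leq_trans (hb _ tn) (bmono _ tn)) bN.
apply: history_path_event => t tn.
rewrite leqNgt; apply/negP => h; apply: nD; exists t; first by rewrite mem_iota.
apply: (leq_trans h); apply: leq_deaths.
exact: leq_trans (hb _ (ltnW tn)) (bmono _ (ltnW tn)).
Qed.

End one_law.

(** On each path, the nonnegative square of [(phi + u) * p - u * p'], divided by
    [p], bounds [(phi + u) ^ 2 * p] from below by terms that are linear in [phi]
    and by the likelihood ratio.  Summation over the paths yields the inequality
    of Hammersley, Chapman and Robbins, with the multiplier [u] left free; the
    mass [1 - m] outside the paths enters through the bound [M] on [phi]. *)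
Lemma truncated_hcr (P P' : probability Omega R) (theta theta' : R)
    (G : probability nat R) (n : nat) (phi : n.+1.-tuple nat -> R) (M u : R)
    (b : nat -> nat) (N : nat) :
  0 < theta < 1 -> 0 <= theta' <= 1 ->
  inar_noise Z eps P theta G -> inar_noise Z eps P' theta' G ->
  (forall x, `|phi x| <= M) -> 0 <= u ->
  let p := path_weight (pmf_nat G) (1 - theta) in
  let p' := path_weight (pmf_nat G) (1 - theta') in
  let m := \sum_(l <- paths b N n) p' l in
  let Q := \sum_(l <- paths b N n) p' l ^+ 2 / p l in
  let E0 f := Ex P (fun w => f (trajectory Z eps n w)) in
  let E1 f := Ex P' (fun w => f (trajectory Z eps n w)) in
  2 * u * (E1 phi - E0 phi) - 2 * u * M * (1 - m) + u ^+ 2 * (2 * m - 1 - Q)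
  <= E0 (fun x => phi x ^+ 2).
Proof.
move=> /andP[th0 th1] th'01 hP hP' phiM u0.
pose p := path_weight (pmf_nat G) (1 - theta).
pose p' := path_weight (pmf_nat G) (1 - theta').
pose m := \sum_(l <- paths b N n) p' l.
pose Q := \sum_(l <- paths b N n) p' l ^+ 2 / p l.
pose E0 f := Ex P (fun w => f (trajectory Z eps n w)).
pose E1 f := Ex P' (fun w => f (trajectory Z eps n w)).
change (2 * u * (E1 phi - E0 phi) - 2 * u * M * (1 - m) + u ^+ 2 * (2 * m - 1 - Q)
  <= E0 (fun x => phi x ^+ 2)).
have th01 : 0 <= theta <= 1 by rewrite !ltW.
have a01 : 0 <= 1 - theta <= 1 by rewrite subr_ge0 gerBl !ltW.
have a'01 : 0 <= 1 - theta' <= 1.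
  by case/andP: th'01 => ? ?; apply/andP; split; lra.
have bphi : bmeas (fun w => phi (trajectory Z eps n w)) by exact: bmeas_trajectory phiM.
have bcst (c : R) : bmeas (fun _ : Omega => c) := bmeas_cst c.
(* Functions made nonnegative, so that their expectations dominate sums over
   paths. *)
pose psi x := (phi x + u) ^+ 2; pose psi' x := M - phi x.
have bpsi : bmeas (fun w => psi (trajectory Z eps n w)).
  by rewrite /psi; under eq_fun do rewrite expr2; apply: bmeasM; apply: bmeasD.
have bpsi' : bmeas (fun w => psi' (trajectory Z eps n w)).
  by apply: bmeasD => //; exact: bmeasN.
have h0 := sum_path_weight_le th01 hP b N bpsi (fun x => sqr_ge0 _).
have h1 : \sum_(l <- paths b N n) p' l * psi' (path_tuple n l) <= M - E1 phi.
  have : Ex P' (fun w => psi' (trajectory Z eps n w)) = M - E1 phi.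
    by rewrite /psi' (ExD P' (bcst M) (bmeasN bphi)) (ExN P' bphi) Ex_cst.
  move=> <-; apply: sum_path_weight_le => // x.
  by rewrite subr_ge0; have := phiM x; rewrite ler_norml => /andP[].
have EE : Ex P (fun w => psi (trajectory Z eps n w)) =
    E0 (fun x => phi x ^+ 2) + 2 * u * E0 phi + u ^+ 2.
  have b2 : bmeas (fun w => phi (trajectory Z eps n w) ^+ 2).
    by under eq_fun do rewrite expr2; exact: bmeasM.
  rewrite -(Ex_cst P (u ^+ 2)) /E0 -(ExZ P (2 * u) bphi) -(ExD P b2 (bmeasZ (2 * u) bphi)).
  rewrite -(ExD P (bmeasD b2 (bmeasZ (2 * u) bphi)) (bcst (u ^+ 2))).
  by congr Ex; apply/funext => w; rewrite /psi /cst; ring.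
rewrite {}EE in h0.
have h2 : 2 * u * (\sum_(l <- paths b N n) p' l * phi (path_tuple n l)) +
    2 * u ^+ 2 * m - u ^+ 2 * Q <=
    \sum_(l <- paths b N n) p l * psi (path_tuple n l).
  rewrite /m /Q !mulr_sumr -big_split -sumrB/=; apply: ler_sum => l _.
  rewrite /psi; set f := phi _.
  have [pl0|pl0] := eqVneq (p l) 0.
    have -> : p' l = 0.
      rewrite /p'; apply: (@path_weight_eq0 _ _ (1 - theta)) => //; try lra.
      exact: pmf_nat_ge0.
    by rewrite pl0 !mul0r expr0n !mul0r !mulr0 subr0 addr0.
  have {}pl0 : 0 < p l by rewrite lt_def pl0/= path_weight_ge0//; exact: pmf_nat_ge0.
  rewrite -subr_ge0.
  have -> : p l * (f + u) ^+ 2 - (2 * u * (p' l * f) + 2 * u ^+ 2 * p' l - u ^+ 2 * (p' l ^+ 2 / p l)) =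
    (p l * (f + u) - u * p' l) ^+ 2 / p l by field; rewrite gt_eqF.
  by rewrite divr_ge0 ?sqr_ge0// ltW.
have h3 : M * m - \sum_(l <- paths b N n) p' l * phi (path_tuple n l) <= M - E1 phi.
  apply: le_trans h1; rewrite /m mulr_sumr -sumrB le_eqVlt; apply/orP; left; apply/eqP.
  by apply: eq_bigr => l _; rewrite /psi'; ring.
move: (ler_wpM2l (mulr_ge0 (ler0n R 2) u0) h3) => h4.
have := le_trans h2 h0.
set S := \sum_(l <- _) _ in h4 *.
lra.
Qed.

End likelihood_comparison.

(** * Asymptotics of the likelihood ratio *)

Section admissible_facts.
Context {R : realType}.
Variable G : probability nat R.
Hypothesis Gadm : admissible G.

Let g := pmf_nat G.

Lemma admissible_pmf0_gt0 : 0 < g 0%N.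
Proof.
case: Gadm => [[M [_ supp]]|[supp _ _]].
  by have : support_nat G 0%N by rewrite supp.
by have : support_nat G 0%N by rewrite supp.
Qed.

Lemma admissible_pmf1_gt0 : 0 < g 1%N.
Proof.
case: Gadm => [[M [M0 supp]]|[supp _ _]].
  by have : support_nat G 1%N by rewrite supp.
by have : support_nat G 1%N by rewrite supp.
Qed.

Lemma admissible_mean_gt0 : 0 < mean_nat G.
Proof.
rewrite -lte_fin /mean_nat fineK; last first.
  by rewrite expectation_fin_num// Lfun2_Lfun1// admissible_Lfun2.
rewrite unlock ge0_integral_nat; last by move=> k; rewrite lee_fin.
apply: (@lt_le_trans _ _ (\sum_(0 <= k < 2) (k%:R%:E * G [set k]))%E).
  rewrite big_nat_recr//= big_nat1 mul0e add0e mul1e pmf_natE lte_fin.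
  exact: admissible_pmf1_gt0.
by apply: nneseries_lim_ge => k _; rewrite mule_ge0// lee_fin.
Qed.

(** Where [g] increases, its value is positive, and this happens at finitely many
    places only. *)
Lemma admissible_ratio : exists2 C, 0 <= C & forall k, g k.+1 <= C * g k.
Proof.
have pos k : 0 <= g k.+1 / g k by rewrite divr_ge0 ?pmf_nat_ge0.
have [M hM] : exists M, forall k, g k.+1 <= g k \/ (k < M)%N /\ 0 < g k.
  case: Gadm => [[M [M0 supp]]|[supp _ [M [_ hM]]]]; exists M.+1 => k.
    have [kM|Mk] := leqP k M.
      by right; split => //; have : support_nat G k by rewrite supp.
    left; apply: (@le_trans _ _ 0); last exact: pmf_nat_ge0.
    have : ~ support_nat G k.+1 by rewrite supp/= leqNgt ltnS (ltnW Mk).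
    by rewrite /support_nat/= => /negP; rewrite -leNgt.
  have [kM|Mk] := ltnP k M.
    by right; split; [exact: leqW|have : support_nat G k by rewrite supp].
  by left; exact: hM.
exists (1 + \sum_(k < M) g k.+1 / g k); first by rewrite addr_ge0// sumr_ge0.
move=> k; have gk : 0 <= g k by exact: pmf_nat_ge0.
have [h|[kM gk0]] := hM k.
  by apply: (le_trans h); rewrite ler_peMl// lerDl sumr_ge0.
rewrite -ler_pdivrMr// (bigD1 (Ordinal kM))//= addrCA lerDl addr_ge0//.
by rewrite sumr_ge0.
Qed.

End admissible_facts.

Section likelihood_asymptotics.
Context {R : realType}.
Variables (G : probability nat R) (h h' c : R).
Hypotheses (Gadm : admissible G) (h0 : 0 < h) (hh' : h < h') (c0 : 0 < c).

Let g := pmf_nat G.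
Let mu := mean_nat G.
Let b n t := Num.truncn (t%:R * mu + c * n%:R).

Lemma sum_ord_natr n : \sum_(t < n) t%:R = n%:R * (n%:R - 1) / 2 :> R.
Proof.
elim: n => [|n IH]; first by rewrite big_ord0 !mul0r.
by rewrite big_ord_recr/= IH -[n.+1%:R]natr1; field.
Qed.

Let mu0 : 0 < mu. Proof. exact: admissible_mean_gt0. Qed.

Lemma bound_le n t : (t <= n)%N -> (b n t)%:R <= t%:R * mu + c * n%:R.
Proof. by move=> tn; rewrite truncn_le addr_ge0// mulr_ge0// ltW. Qed.

(** In the state [x] the leading term of the one-step estimate is
    [g 0 * (h' - h) ^ 2 / h * x / n ^ 2].  In the corridor [x] is at most
    [t * mu + c * n], and summing [t / n ^ 2] gives [1 / 2].  The result is
    the second moment of the likelihood ratio of two Poisson laws whose means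
    are the rates times [g 0 * mu / 2], up to [c] and [e]. *)
Lemma path_chi2_near (e : R) : 0 < e -> \forall n \near \oo,
  exists2 N, (b n n <= N)%N &
    \sum_(l <- paths (b n) N n)
      path_weight g (h' / n%:R ^+ 2) l ^+ 2 / path_weight g (h / n%:R ^+ 2) l <=
    expR (g 0%N * (h' - h) ^+ 2 / h * (mu / 2 + c) + e).
Proof.
have room x m k : (x <= m -> k <= (m + k).+1 - x)%N by lia.
move=> e0; have [C C0 gC] := admissible_ratio Gadm.
have h'0 : 0 < h' by exact: lt_trans hh'.
pose C1 := (mu + c) * h'.
have C10 : 0 < C1 by rewrite mulr_gt0// addr_gt0.
pose K0 := 6 + 2 * (1 + C) ^+ 2 + 6 * (h' / h).
have K00 : 0 <= K0.
  apply: addr_ge0; last by rewrite mulr_ge0// divr_ge0// ltW.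
  by apply: addr_ge0 => //; rewrite mulr_ge0// sqr_ge0.
(* [C1 / n] bounds the expected number of deaths in one step, and [K1 / n ^ 2]
   the remainder of the one-step estimate. *)
pose K1 := 2 * C1 + K0 * C1 ^+ 2.
near=> n.
have n1 : 1 <= n%:R :> R by near: n; exact: nbhs_infty_ger.
have nC1 : 2 * C1 <= n%:R by near: n; exact: nbhs_infty_ger.
have nK1 : K1 / e <= n%:R by near: n; exact: nbhs_infty_ger.
have nh' : h' <= n%:R by near: n; exact: nbhs_infty_ger.
have n0 : 0 < n%:R :> R by exact: lt_le_trans n1.
have [K hK] := pmf_nat_tail G (tau := n%:R^-1) (ltac:(by rewrite invr_gt0)).
(* From a state in the corridor, [K] further individuals leave room for all but a
   fraction [1 / n] of the arrivals. *)
exists (b n n + K)%N; first exact: leq_addr.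
pose a := h / n%:R ^+ 2; pose a' := h' / n%:R ^+ 2.
have n20 : 0 < n%:R ^+ 2 :> R by rewrite exprn_gt0.
have a0 : 0 < a by rewrite divr_gt0.
have aa' : a <= a' by rewrite ler_pM2r ?invr_gt0// ltW.
have a'1 : a' <= 1.
  rewrite ler_pdivrMr// mul1r (le_trans nh')// expr2 ler_peMr// ltW//.
have a'01 : 0 <= a' <= 1 by rewrite a'1 andbT (le_trans (ltW a0)).
have a01 : 0 <= a <= 1 by rewrite ltW//= (le_trans aa').
pose B t := g 0%N * (h' - h) ^+ 2 / h * (t%:R * mu + c * n%:R) / n%:R ^+ 2 + K1 / n%:R ^+ 2.
have g00 : 0 < g 0%N by exact: admissible_pmf0_gt0.
have D0 : 0 <= g 0%N * (h' - h) ^+ 2 / h.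
  by rewrite divr_ge0 ?(ltW h0)// mulr_ge0 ?sqr_ge0// ltW.
apply: (@le_trans _ _ (expR (\sum_(t < n) B t))); last first.
  rewrite ler_expR /B big_split/= sumr_const card_ord -mulr_suml -mulr_sumr.
  have -> : \sum_(i < n) (i%:R * mu + c * n%:R) = (\sum_(i < n) i%:R) * mu + c * n%:R * n%:R.
    by rewrite big_split/= sumr_const card_ord -mulr_suml -(mulr_natr (c * n%:R)).
  rewrite -(mulr_natr (K1 / _)); apply: lerD; last first.
    rewrite -mulrA expr2 invfM -mulrA mulVf ?gt_eqF// mulr1.
    by rewrite ler_pdivrMr// mulrC -ler_pdivrMr.
  rewrite -mulrA; apply: ler_wpM2l => //.
  rewrite ler_pdivrMr//.
  have : (\sum_(i < n) i%:R) * mu <= n%:R ^+ 2 / 2 * mu.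
    rewrite ler_wpM2r ?(ltW mu0)// sum_ord_natr ler_wpM2r// expr2 ler_wpM2l//.
    by rewrite gerBl.
  have -> : (mu / 2 + c) * n%:R ^+ 2 = n%:R ^+ 2 / 2 * mu + c * n%:R * n%:R by field.
  by move=> ?; rewrite lerD2r.
apply: sum_paths_chi2 => //; first exact: pmf_nat_ge0.
move=> t x tn xb.
have xle : x%:R <= t%:R * mu + c * n%:R.
  by apply: le_trans (bound_le (ltnW tn)); rewrite ler_nat.
have xn : x%:R <= (mu + c) * n%:R.
  apply: (le_trans xle); rewrite mulrDl lerD2r mulrC ler_wpM2l ?(ltW mu0)//.
  by rewrite ler_nat ltnW.
have sC1 : x%:R * a' <= C1 / n%:R.
  have -> : C1 / n%:R = (mu + c) * n%:R * a'.
    by rewrite /C1 /a'; field; rewrite gt_eqF.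
  by rewrite ler_wpM2r//; case/andP: a'01.
have s0 : 0 <= x%:R * a' by rewrite mulr_ge0//; case/andP: a'01.
have bmono : (b n t <= b n n)%N.
  apply: le_truncn; rewrite lerD2r ler_wpM2r ?(ltW mu0)// ler_nat ltnW//.
have := @thin_kernel_chi2 _ g (pmf_nat_ge0 G) (pmf_nat_partial_sum_le1 G) C n%:R^-1 a a' x
  (b n n + K).+1 gC C0 a0 aa' a'1.
move=> /(_ _ _)/le_trans; apply.
- apply: (le_trans sC1); rewrite ler_pdivrMr//; lra.
- exact/hK/room/(leq_trans xb bmono).
rewrite -addrA lerD2l; apply: lerD.
  have -> : g 0%N * (x%:R * (a' - a) ^+ 2 / a) =
    g 0%N * (h' - h) ^+ 2 / h * x%:R / n%:R ^+ 2.
    by rewrite /a /a'; field; rewrite !gt_eqF.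
  by rewrite ler_pM2r ?invr_gt0// ler_wpM2l.
have -> : a' / a = h' / h by rewrite /a /a'; field; rewrite !gt_eqF.
rewrite -/K0.
have -> : K1 / n%:R ^+ 2 = 2 * (C1 / n%:R) * n%:R^-1 + K0 * (C1 / n%:R) ^+ 2.
  by rewrite /K1; field; rewrite gt_eqF.
apply: lerD; first by rewrite ler_wpM2r ?invr_ge0// ler_wpM2l.
by apply: ler_wpM2l => //; rewrite lerXn2r// nnegrE divr_ge0// ltW.
Unshelve. all: by end_near. Qed.

End likelihood_asymptotics.

(** * Passage to the limit laws *)

Section laws_and_limits.
Context {R : realType}.

Lemma bounded_funP (T : Type) (f : T -> R) :
  bounded_fun f <-> exists M, forall x, `|f x| <= M.
Proof.
split=> [[M [_ hM]]|[M hM]].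
  by exists (M + 1) => x; apply: hM => //; rewrite ltrDl.
by exists M; split; rewrite ?num_real// => x Mx t _; exact: le_trans (hM t) (ltW Mx).
Qed.

Lemma bmeas_continuous (f : R -> R) : continuous f -> bounded_fun f -> bmeas f.
Proof.
by move=> cf /bounded_funP bf; split => //; exact: continuous_measurable_fun.
Qed.

Lemma weak_cvg_Ex (mu : nat -> probability R R) (nu : probability R R) (f : R -> R) :
  weak_cvg mu nu -> continuous f -> bounded_fun f ->
  Ex (mu n) f @[n --> \oo] --> Ex nu f.
Proof.
move=> mn cf bf; have := mn f cf bf.
by rewrite (ExE nu (bmeas_continuous cf bf)) => /fine_cvg.
Qed.

Context {d : measure_display} {Omega : measurableType d}.
Variables (Z : nat -> nat -> {mfun Omega >-> bool})
          (eps : nat -> {mfun Omega >-> nat}).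

Lemma Ex_statistic (P : probability Omega R) n (T : n.+1.-tuple nat -> R) (f : R -> R) :
  bmeas f ->
  Ex (distribution (inar_law Z eps P n) (statistic T)) f =
  Ex P (fun w => f (T (trajectory Z eps n w))).
Proof.
move=> bf; have [mf [M fM]] := bf; have mfE : measurable_fun setT (EFin \o f).
  exact/measurable_EFinP.
have b1 : bmeas (f \o statistic T) by split; [exact: measurableT_comp|exists M => x; exact: fM].
have b2 : bmeas (f \o statistic T \o trajectory Z eps n).
  split; last by exists M => x; exact: fM.
  by apply: measurableT_comp => //; case: b1.
rewrite /Ex /Rintegral integral_distribution//; last exact: bmeas_integrable b1.
rewrite integral_distribution//; first by case: b1 => /measurable_EFinP.
exact: bmeas_integrable b2.
Qed.

(** Two deaths at the same time, among at most [C * n] individuals, have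
    probability of order [1 / n ^ 2] at each of the [n] steps. *)
Lemma double_death_near (C h e : R) : 0 <= C -> 0 <= h -> 0 < e ->
  \forall n \near \oo, forall (P : probability Omega R) (G : probability nat R) N,
    0 <= 1 - h / n%:R ^+ 2 <= 1 -> inar_noise Z eps P (1 - h / n%:R ^+ 2) G ->
    N%:R <= C * n%:R -> Pr P (double_death Z n N) <= e.
Proof.
move=> C0 h0 e0; near=> n => P G N th01 hP NC.
have n1 : 1 <= n%:R :> R by near: n; exact: nbhs_infty_ger.
have n0 : 0 < n%:R :> R by exact: lt_le_trans n1.
have nC : (C * h) ^+ 2 / e <= n%:R by near: n; exact: nbhs_infty_ger.
apply: (le_trans (Pr_double_death th01 hP _ _)).
rewrite opprB addrC subrK.
have N1 : N%:R * (h / n%:R ^+ 2) <= C * h / n%:R.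
  have -> : C * h / n%:R = C * n%:R * (h / n%:R ^+ 2) by field; rewrite gt_eqF.
  by rewrite ler_wpM2r// divr_ge0// exprn_ge0.
have N0 : 0 <= N%:R * (h / n%:R ^+ 2) by rewrite mulr_ge0// divr_ge0// exprn_ge0.
apply: (@le_trans _ _ (n%:R * (C * h / n%:R) ^+ 2)).
  by rewrite ler_wpM2l// lerXn2r// nnegrE// (le_trans N0).
have -> : n%:R * (C * h / n%:R) ^+ 2 = (C * h) ^+ 2 / n%:R by field; rewrite gt_eqF.
by move: nC; rewrite !ler_pdivrMr// [e * _]mulrC.
Unshelve. all: by end_near. Qed.

Lemma theta_near (h : R) : 0 <= h -> \forall n \near \oo, 0 <= 1 - h / n%:R ^+ 2 <= 1.
Proof.
move=> h0; near=> n.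
have n1 : 1 <= n%:R :> R by near: n; exact: nbhs_infty_ger.
have nh : h <= n%:R by near: n; exact: nbhs_infty_ger.
have n0 : 0 < n%:R :> R by exact: lt_le_trans n1.
rewrite subr_ge0 gerBl divr_ge0 ?exprn_ge0// andbT ler_pdivrMr ?exprn_gt0// mul1r.
by apply: (le_trans nh); rewrite expr2 ler_peMr// ltW.
Unshelve. all: by end_near. Qed.

End laws_and_limits.

Section lower_bound.
Context {R : realType} {d : measure_display} {Omega : measurableType d}.
Variables (Z : nat -> nat -> {mfun Omega >-> bool})
          (eps : nat -> {mfun Omega >-> nat})
          (P : R -> probability nat R -> probability Omega R).
Hypothesis hP : forall (theta : R) (G : probability nat R), 0 <= theta <= 1 ->
  inar_noise Z eps (P theta G) theta G.
Variables (T : forall n : nat, n.+1.-tuple nat -> R)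
          (L : R -> probability nat R -> probability R R).
Hypothesis TL : asymptotically_unbiased Z eps P T L.
Variable G : probability nat R.
Hypothesis Gadm : admissible G.

Let lam := pmf_nat G 0 * mean_nat G / 2.

Let lam0 : 0 < lam.
Proof.
by rewrite divr_gt0// mulr_gt0//; [exact: admissible_pmf0_gt0|exact: admissible_mean_gt0].
Qed.

(** Weak convergence applies to [f] and to its square.  The mass that the
    truncation loses is at most [2 * e] in the limit: the law of large numbers
    and the rarity of double deaths each cost [e]. *)
Lemma hcr_slack (h h' u e M : R) (f : R -> R) : 0 < h -> h < h' -> 0 <= u -> 0 < e ->
  continuous f -> (forall x, `|f x| <= M) ->
  2 * u * (Ex (L h' G) f - Ex (L h G) f) - 2 * u * M * (2 * e)
    + u ^+ 2 * (2 * (1 - 2 * e) - 1 -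
        expR (pmf_nat G 0 * (h' - h) ^+ 2 / h * (mean_nat G / 2 + e) + e))
  <= Ex (L h G) (fun x => f x ^+ 2).
Proof.
move=> h0 hh' u0 e0 cf fM.
have h'0 : 0 < h' by exact: lt_trans hh'.
have bf : bounded_fun f by apply/bounded_funP; exists M.
have cf2 : continuous (fun x => f x ^+ 2).
  by move=> x; under eq_fun do rewrite expr2; apply: cvgM; exact: cf.
have bf2 : bounded_fun (fun x => f x ^+ 2).
  apply/bounded_funP; exists (M ^+ 2) => x; rewrite normrX lerXn2r ?nnegrE//.
  exact: le_trans (fM x).
have M0 : 0 <= M := le_trans (normr_ge0 _) (fM 0).
have [wh _] := TL (ltW h0) Gadm; have [wh' _] := TL (ltW h'0) Gadm.
have c0 := weak_cvg_Ex wh cf bf; have c1 := weak_cvg_Ex wh' cf bf.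
have c2 := weak_cvg_Ex wh cf2 bf2.
set X := expR _; set F := u ^+ 2 * _.
pose q k n := distribution (inar_law Z eps (P (1 - k / n%:R ^+ 2) G) n) (statistic (@T n)).
have cl : (fun n => 2 * u * (Ex (q h' n) f - Ex (q h n) f) - 2 * u * M * (2 * e) + F)
    @ \oo --> 2 * u * (Ex (L h' G) f - Ex (L h G) f) - 2 * u * M * (2 * e) + F.
  apply: cvgD; last exact: cvg_cst.
  apply: cvgB; last exact: cvg_cst.
  by apply: cvgM; [exact: cvg_cst|exact: cvgB].
apply: (ler_cvg_to cl c2).
have mu0 : 0 < mean_nat G := admissible_mean_gt0 Gadm.
have C0 : 0 <= mean_nat G + e by rewrite addr_ge0// ltW.
near=> n.
have th01 : 0 <= 1 - h / n%:R ^+ 2 <= 1 by near: n; exact/theta_near/ltW.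
have th'01 : 0 <= 1 - h' / n%:R ^+ 2 <= 1 by near: n; exact/theta_near/ltW.
have hn := hP G th01; have hn' := hP G th'01.
have n1 : 1 <= n%:R :> R by near: n; exact: nbhs_infty_ger.
have n0 : 0 < n%:R :> R by exact: lt_le_trans n1.
pose b t := Num.truncn (t%:R * mean_nat G + e * n%:R).
have bn : (b n)%:R <= (mean_nat G + e) * n%:R.
  have -> : (mean_nat G + e) * n%:R = n%:R * mean_nat G + e * n%:R by rewrite mulrDl mulrC.
  by rewrite truncn_le addr_ge0// mulr_ge0// ltW.
have [N bN chi2] : exists2 N, (Num.truncn (n%:R * mean_nat G + e * n%:R) <= N)%N &
    \sum_(l <- paths (fun t => Num.truncn (t%:R * mean_nat G + e * n%:R)) N n) path_weight (pmf_nat G) (h' / n%:R ^+ 2) l ^+ 2 /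
       path_weight (pmf_nat G) (h / n%:R ^+ 2) l <= X.
  by near: n; exact: (path_chi2_near Gadm h0 hh' e0 e0).
have off : Pr (P (1 - h' / n%:R ^+ 2) G) (off_course eps G e n) <= e.
  have : forall (P : probability Omega R) (theta : R),
    0 <= theta <= 1 -> inar_noise Z eps P theta G -> Pr P (off_course eps G e n) <= e.
    by near: n; exact: (uniform_lln Z eps Gadm e0 e0).
  by move=> /(_ _ _ th'01 hn').
have dbl : Pr (P (1 - h' / n%:R ^+ 2) G) (double_death Z n (b n)) <= e.
  have : forall (P : probability Omega R) (G' : probability nat R) N,
    0 <= 1 - h' / n%:R ^+ 2 <= 1 -> inar_noise Z eps P (1 - h' / n%:R ^+ 2) G' ->
    N%:R <= (mean_nat G + e) * n%:R -> Pr P (double_death Z n N) <= e.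
    by near: n; exact: (double_death_near Z eps C0 (ltW h'0) e0).
  by move=> /(_ _ _ _ th'01 hn' bn).
have ek (k : R) : 1 - (1 - k / n%:R ^+ 2) = k / n%:R ^+ 2 by ring.
have mass := sum_path_weight_ge th'01 hn' (n := n) (N := N) (ltW e0) (ltW mu0) bN.
rewrite /= ek -/b in mass.
have th1 : 0 < 1 - h / n%:R ^+ 2 < 1.
  have nh : h + 1 <= n%:R by near: n; exact: nbhs_infty_ger.
  rewrite subr_gt0 gtrBl divr_gt0 ?exprn_gt0// andbT ltr_pdivrMr ?exprn_gt0// mul1r.
  apply: (@lt_le_trans _ _ n%:R); first lra.
  by rewrite expr2 ler_peMr// ltW.
have := @truncated_hcr _ _ _ Z eps (P (1 - h / n%:R ^+ 2) G) (P (1 - h' / n%:R ^+ 2) G)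
  _ _ G n (fun x => f (T x)) M u b N th1 th'01 hn hn' (fun x => fM (T x)) u0.
rewrite /= !ek => main.
rewrite /q !Ex_statistic; first last.
- exact: bmeas_continuous.
- exact: bmeas_continuous.
- exact: bmeas_continuous.
apply: le_trans main; set m := \sum_(l <- _) path_weight _ _ _ in mass *.
apply: lerD.
  rewrite lerD2l lerN2 ler_wpM2l ?mulr_ge0//; lra.
rewrite ler_wpM2l ?sqr_ge0//; lra.
Unshelve. all: by end_near. Qed.

(** The slack [e] is sent to 0; the exponential and all other terms depend on it
    continuously. *)
Lemma hcr_limit (h h' u M : R) (f : R -> R) : 0 < h -> h < h' -> 0 <= u ->
  continuous f -> (forall x, `|f x| <= M) ->
  2 * u * (Ex (L h' G) f - Ex (L h G) f)
    - u ^+ 2 * (expR (lam * (h' - h) ^+ 2 / h) - 1)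
  <= Ex (L h G) (fun x => f x ^+ 2).
Proof.
move=> h0 hh' u0 cf fM.
pose k := pmf_nat G 0 * (h' - h) ^+ 2 / h.
pose D := 2 * u * (Ex (L h' G) f - Ex (L h G) f).
pose F e := D - 2 * u * M * (2 * e) + u ^+ 2 * (2 * (1 - 2 * e) - 1 -
        expR (k * (mean_nat G / 2 + e) + e)).
have -> : D - u ^+ 2 * (expR (lam * (h' - h) ^+ 2 / h) - 1) = F 0.
  rewrite /F /k /lam; set X := expR _; set Y := expR _.
  have -> : X = Y by rewrite /X /Y; congr expR; field; rewrite gt_eqF.
  by ring.
have cF : F (@harmonic R n) @[n --> \oo] --> F 0.
  have ch := @cvg_harmonic R.
  rewrite /F; apply: cvgD.
    apply: cvgB; first exact: cvg_cst.
    by apply: cvgM; [exact: cvg_cst|apply: cvgM => //; exact: cvg_cst].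
  apply: cvgM; first exact: cvg_cst.
  apply: cvgB.
    apply: cvgB; last exact: cvg_cst.
    apply: cvgM; first exact: cvg_cst.
    apply: cvgB; first exact: cvg_cst.
    by apply: cvgM => //; exact: cvg_cst.
  apply: (@continuous_cvg _ _ _ _ _ _ (@expR R)); first exact: continuous_expR.
  apply: cvgD => //; apply: cvgM; first exact: cvg_cst.
  by apply: cvgD => //; exact: cvg_cst.
apply: (cvgr_to_le cF); near=> n.
by apply: hcr_slack => //; rewrite /harmonic/= invr_gt0.
Unshelve. all: by end_near. Qed.

End lower_bound.

(** * The variance bound *)

Section clamping.
Context {R : realType}.
Implicit Types K x z h : R.

Definition clamp K x : R := Num.min K (Num.max (- K) x).

Lemma clamp_continuous K : continuous (clamp K).
Proof.
move=> x; apply: (@continuous_min _ _ (fun=> K) (fun x => Num.max (- K) x)).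
  exact: cst_continuous.
by apply: (@continuous_max _ _ (fun=> - K) id); [exact: cst_continuous|exact: cvg_id].
Qed.

Lemma clamp_id K x : `|x| <= K -> clamp K x = x.
Proof.
by rewrite ler_norml => /andP[Kx xK]; rewrite /clamp max_r// min_r.
Qed.

Lemma clamp_le_abs K x : 0 <= K -> `|clamp K x| <= `|x|.
Proof.
move=> K0; rewrite /clamp; have [xK|xK] := leP (- K) x.
  have [Kx|Kx] := leP K x; last by [].
  by rewrite ger0_norm// ger0_norm ?(le_trans K0).
rewrite min_r; last by lra.
rewrite normrN (ger0_norm K0); have := ler_norm (- x); rewrite normrN => h; lra.
Qed.

Lemma clamp_bound K x : 0 <= K -> `|clamp K x| <= K.
Proof.
move=> K0; rewrite /clamp ler_norml le_min ge_min lexx/= le_max lexx/= !andbT.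
by lra.
Qed.

Lemma clamp_contract K h z : 0 <= h -> h <= K -> (clamp K z - h) ^+ 2 <= (z - h) ^+ 2.
Proof.
move=> h0 hK; rewrite /clamp; have [xK|xK] := leP (- K) z; last first.
  rewrite min_r; last by lra.
  rewrite -[leLHS]sqrrN -[leRHS]sqrrN lerXn2r ?nnegrE//; lra.
have [Kx|Kx] := leP K z; last by [].
rewrite lerXn2r ?nnegrE//; lra.
Qed.

(** Weak convergence sees bounded functions only, while unbiasedness concerns the
    identity; dominated convergence relates the two. *)
Lemma clamp_expectation (nu : probability R R) (m : R) : ('E_nu[id] = m%:E)%E ->
  Ex nu (clamp k%:R) @[k --> \oo] --> m.
Proof.
rewrite unlock => Em.
have mE : measurable_fun setT (EFin : R -> \bar R) by exact/measurable_EFinP.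
have iE : nu.-integrable setT (EFin : R -> \bar R).
  apply/integrableP; split => //.
  have : (\int[nu]_x (x%:E) \is a fin_num)%E by rewrite [X in X \is a _]Em.
  rewrite integralE fin_numD fin_numN => /andP[p n].
  rewrite -[X in (X < _)%E]/(\int[nu]_x (abse \o EFin) x)%E fune_abse.
  rewrite ge0_integralD//; last 2 first.
    exact: measurable_funepos.
    exact: measurable_funeneg.
  by rewrite lte_add_pinfty// ltey_eq ?p ?n.
have mclamp k : measurable_fun setT (clamp k%:R).
  by apply: continuous_measurable_fun; exact: clamp_continuous.
have bclamp k : bmeas (clamp k%:R).
  by split => //; exists k%:R => x; exact: clamp_bound.
have : (\int[nu]_x ((clamp k%:R x)%:E))%E @[k --> \oo] --> (\int[nu]_x x%:E)%E.
  apply: (@dominated_cvg _ _ _ nu setT measurableT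
    (fun k x => (clamp k%:R x)%:E) EFin (fun x => `|x%:E|)%E).
  - by move=> k; exact/measurable_EFinP.
  - move=> x _; apply: cvg_EFin; first by apply: nearW.
    apply: cvg_near_cst; near=> k; apply: clamp_id.
    by near: k; exact: nbhs_infty_ger.
  - by move=> x _.
  - exact: integrable_abse.
  - by move=> k x _; rewrite /= lee_fin clamp_le_abs.
rewrite Em => /fine_cvg; apply: cvg_trans.
by apply: near_eq_cvg; apply: nearW => k.
Unshelve. all: by end_near. Qed.

End clamping.

Section lower_bound_conclusion.
Context {R : realType} {d : measure_display} {Omega : measurableType d}.
Variables (Z : nat -> nat -> {mfun Omega >-> bool})
          (eps : nat -> {mfun Omega >-> nat})
          (P : R -> probability nat R -> probability Omega R).
Hypothesis hP : forall (theta : R) (G : probability nat R), 0 <= theta <= 1 ->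
  inar_noise Z eps (P theta G) theta G.

(** Clamping at a level above [h] brings a point no farther from [h], so
    [hcr_limit] for the clamped identity bounds the variance of the limit law;
    then the level tends to infinity.  The unbiasedness at [h] and [h'] turns the
    difference of means into [h' - h], and the Cramer--Rao bound appears as [h']
    tends to [h]. *)
Lemma variance_lower_bound (T : forall n : nat, n.+1.-tuple nat -> R)
    (L : R -> probability nat R -> probability R R) :
  asymptotically_unbiased Z eps P T L ->
  forall (h : R) (G : probability nat R), 0 <= h -> admissible G ->
    ((variance_bound h G)%:E <= \int[L h G]_z ((z - h) ^+ 2)%:E)%E.
Proof.
move=> TL h G; rewrite le_eqVlt => /predU1P[<-|h0] Gadm.
  rewrite /variance_bound mulr0 mul0r; apply: integral_ge0 => z _.
  by rewrite lee_fin sqr_ge0.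
have [->|Vfin] := eqVneq (\int[L h G]_z ((z - h) ^+ 2)%:E)%E +oo%E; first exact: leey.
have V0 : (0 <= \int[L h G]_z ((z - h) ^+ 2)%:E)%E.
  by apply: integral_ge0 => z _; rewrite lee_fin sqr_ge0.
have {Vfin} Vfin : (\int[L h G]_z ((z - h) ^+ 2)%:E)%E \is a fin_num.
  by rewrite ge0_fin_numE// ltey.
rewrite -(fineK Vfin) lee_fin; set V := fine _.
pose lam := pmf_nat G 0 * mean_nat G / 2.
have lam0 : 0 < lam.
  by rewrite divr_gt0// mulr_gt0//; [exact: admissible_pmf0_gt0|exact: admissible_mean_gt0].
have -> : variance_bound h G = h / lam.
  rewrite /variance_bound /lam; field.
  by rewrite (gt_eqF (admissible_mean_gt0 Gadm)) (gt_eqF (admissible_pmf0_gt0 Gadm)).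
have hk k (h' u : R) : h <= k%:R -> h < h' -> 0 <= u ->
  2 * u * (Ex (L h' G) (clamp k%:R) - Ex (L h G) (clamp k%:R))
    - u ^+ 2 * (expR (lam * (h' - h) ^+ 2 / h) - 1) <= V.
  move=> hk hh' u0.
  pose f x := clamp k%:R x - h.
  have cf : continuous f.
    by move=> x; apply: cvgB; [exact: clamp_continuous|exact: cvg_cst].
  have fM x : `|f x| <= k%:R + h.
    apply: (le_trans (ler_normB _ _)); apply: lerD; first exact: clamp_bound.
    by rewrite gtr0_norm.
  have bc : bmeas (clamp k%:R : R -> R).
    split; first by apply: continuous_measurable_fun; exact: clamp_continuous.
    by exists k%:R => x; exact: clamp_bound.
  have bf : bmeas f.
    by split; [exact: continuous_measurable_fun|exists (k%:R + h)].
  have Ef (nu : probability R R) : Ex nu f = Ex nu (clamp k%:R) - h.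
    by rewrite -[X in _ - X](Ex_cst nu) -(ExN nu (bmeas_cst h)) -(ExD nu bc (bmeasN (bmeas_cst h))).
  have := hcr_limit hP TL Gadm h0 hh' u0 cf fM.
  rewrite !Ef -/lam.
  have -> : Ex (L h' G) (clamp k%:R) - h - (Ex (L h G) (clamp k%:R) - h) =
    Ex (L h' G) (clamp k%:R) - Ex (L h G) (clamp k%:R) by ring.
  move=> /le_trans; apply; rewrite /V /Ex /Rintegral fine_le//.
  - have bf2 : bmeas (fun x => f x ^+ 2).
      under eq_fun do rewrite expr2.
      exact: bmeasM.
    exact/integrable_fin_num/bmeas_integrable.
  - apply: ge0_le_integral => //.
    + by move=> x _; rewrite lee_fin sqr_ge0.
    + by apply/measurable_EFinP/measurable_funX; case: bf.
    + by apply/measurable_EFinP/measurable_funX/measurable_funB.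
    + by move=> x _; rewrite lee_fin clamp_contract// ltW.
have hl (h' u : R) : h < h' -> 0 <= u ->
  2 * u * (h' - h) - u ^+ 2 * (expR (lam * (h' - h) ^+ 2 / h) - 1) <= V.
  move=> hh' u0.
  have [_ e1] := TL h G (ltW h0) Gadm.
  have [_ e2] := TL h' G (ltW (lt_trans h0 hh')) Gadm.
  have c1 := clamp_expectation e1; have c2 := clamp_expectation e2.
  have cl : (fun k => 2 * u * (Ex (L h' G) (clamp k%:R) - Ex (L h G) (clamp k%:R))
    - u ^+ 2 * (expR (lam * (h' - h) ^+ 2 / h) - 1)) @ \oo -->
    2 * u * (h' - h) - u ^+ 2 * (expR (lam * (h' - h) ^+ 2 / h) - 1).
    apply: cvgB; last exact: cvg_cst.
    by apply: cvgM; [exact: cvg_cst|exact: cvgB].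
  apply: (cvgr_to_le cl); near=> k; apply: hk => //.
  by near: k; exact: nbhs_infty_ger.
clearbody lam V => {hk}.
apply/ler_addgt0Pr => e e0.
(* For a shift [delta] the left-hand side is about
   [2 * u * delta - u ^ 2 * lam * delta ^ 2 / h], which is maximal at
   [u = h / (lam * delta)]. *)
pose delta := Num.min (Num.min 1 (h / (2 * lam))) (e / 2).
have d0 : 0 < delta by rewrite !lt_min ltr01 !divr_gt0// mulr_gt0.
have d1 : delta <= 1 by rewrite /delta !ge_min lexx.
have d2 : delta <= h / (2 * lam) by rewrite /delta !ge_min lexx orbT.
have d3 : delta <= e / 2 by rewrite /delta !ge_min lexx orbT.
have hu0 : 0 <= h / (lam * delta) by rewrite divr_ge0 ?ltW// mulr_gt0.
have := hl (h + delta) (h / (lam * delta)) _ hu0.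
rewrite ltrDl => /(_ d0); have -> : h + delta - h = delta by ring.
set x := lam * delta ^+ 2 / h => main.
have x0 : 0 <= x by rewrite /x divr_ge0 ?(ltW h0)// mulr_ge0 ?sqr_ge0// ltW.
have dd : delta ^+ 2 <= delta by rewrite expr2 ler_piMl// ltW.
have xh : x <= 2^-1.
  rewrite /x ler_pdivrMr// mulrC.
  rewrite [2^-1 * h]mulrC ler_pdivlMr// -mulrA [lam * 2]mulrC -ler_pdivlMr ?mulr_gt0//.
  exact: le_trans dd d2.
have ex : expR x - 1 <= x + 2 * x ^+ 2.
  have h1 : 1 - x <= expR (- x) by rewrite expR_ge1Dx.
  have h2 : expR x * expR (- x) = 1 by rewrite -expRD subrr expR0.
  have h3 := expR_ge0 x.
  have h4 : expR x * (1 - x) <= 1 by rewrite -[leRHS]h2 ler_wpM2l.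
  have h5 : 1 <= (1 + x + 2 * x ^+ 2) * (1 - x).
    have -> : (1 + x + 2 * x ^+ 2) * (1 - x) = 1 + x ^+ 2 * (1 - 2 * x) by ring.
    by rewrite lerDl mulr_ge0 ?sqr_ge0//; lra.
  have h6 : 0 < 1 - x by lra.
  have := le_trans h4 h5; rewrite ler_pM2r// => ?; lra.
have u2 : (h / (lam * delta)) ^+ 2 * (expR x - 1) <= (h / (lam * delta)) ^+ 2 * (x + 2 * x ^+ 2).
  by rewrite ler_wpM2l// sqr_ge0.
have e1 : (h / (lam * delta)) ^+ 2 * (x + 2 * x ^+ 2) = h / lam + 2 * delta ^+ 2.
  by rewrite /x; field; rewrite !gt_eqF.
have e2 : 2 * (h / (lam * delta)) * delta = 2 * (h / lam).
  by field; rewrite !gt_eqF.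
rewrite e1 in u2; rewrite e2 in main; lra.
Unshelve. all: by end_near. Qed.

End lower_bound_conclusion.

(** * The limit law of the estimator *)

Section poisson_limit_law.
Context {R : realType}.
Implicit Types r lam h : R.

Definition pois r k : R := r ^+ k / k`!%:R * expR (- r).

Lemma pois_ge0 r k : 0 <= r -> 0 <= pois r k.
Proof. by move=> r0; rewrite /pois !mulr_ge0 ?exprn_ge0 ?expR_ge0// invr_ge0. Qed.

Lemma pois0 r : pois r 0 = expR (- r).
Proof. by rewrite /pois expr0 fact0 divr1 mul1r. Qed.

(** This recursion characterises the Poisson law: it gives the moments below and
    identifies the limit in the law of small numbers. *)
Lemma poisS r k : k.+1%:R * pois r k.+1 = r * pois r k.
Proof.
rewrite /pois exprS factS natrM; field.
by rewrite pnatr_eq0 -lt0n fact_gt0 nat1r pnatr_eq0.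
Qed.

(** The case [r = 0] is the Dirac mass at 0, which the formula for [pois] covers. *)
Lemma poisson_prob_set1 r k : 0 <= r -> poisson_prob r 0%N [set k] = (pois r k)%:E.
Proof.
rewrite /poisson_prob le_eqVlt => /predU1P[<-|r0].
  rewrite ltxx /pois oppr0 expR0 mulr1 diracE; case: k => [|k].
    by rewrite mem_set// expr0 fact0 divr1.
  by rewrite memNset// exprS !mul0r.
by rewrite r0 esum_set1 ?lee_fin ?poisson_pmf_ge0// /poisson_pmf r0.
Qed.

Lemma poisson_pmf_nat r k : 0 <= r -> pmf_nat (poisson_prob r 0%N) k = pois r k.
Proof.
by move=> r0; apply: EFin_inj; rewrite -pmf_natE; exact: poisson_prob_set1.
Qed.

Lemma poisson_sum1 r : 0 <= r -> (\sum_(0 <= k <oo) (pois r k)%:E = 1)%E.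
Proof.
move=> r0; rewrite -(pmf_nat_sum1 (poisson_prob r 0%N)).
by apply: eq_eseriesr => k _; rewrite poisson_pmf_nat.
Qed.

Lemma nneseriesS (f : nat -> \bar R) : (forall k, 0 <= f k)%E ->
  (\sum_(0 <= k <oo) f k = f 0%N + \sum_(0 <= k <oo) f k.+1)%E.
Proof.
move=> f0; rewrite nneseries_recl//; congr (_ + _)%E.
by rewrite -(@nneseries_addn _ f 1)//; apply: eq_eseriesr => k _; rewrite addn1.
Qed.

Lemma poisson_moment1 r : 0 <= r -> (\sum_(0 <= k <oo) (k%:R * pois r k)%:E = r%:E)%E.
Proof.
move=> r0; rewrite nneseriesS; last by move=> k; rewrite lee_fin mulr_ge0 ?pois_ge0.
rewrite mul0r add0e; under eq_eseriesr do rewrite poisS EFinM.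
rewrite nneseriesZl; last by move=> k _; rewrite lee_fin pois_ge0.
by rewrite poisson_sum1// mule1.
Qed.

Lemma poisson_moment2 r : 0 <= r ->
  (\sum_(0 <= k <oo) (k%:R ^+ 2 * pois r k)%:E = (r ^+ 2 + r)%:E)%E.
Proof.
move=> r0; rewrite nneseriesS; last by move=> k; rewrite lee_fin mulr_ge0 ?pois_ge0// sqr_ge0.
rewrite expr0n mul0r add0e.
transitivity (\sum_(0 <= k <oo) (r%:E * ((k%:R * pois r k)%:E + (pois r k)%:E)))%E.
  apply: eq_eseriesr => k _; rewrite expr2 -mulrA poisS -EFinD -EFinM; congr EFin.
  by rewrite -natr1; ring.
have p0 k : 0 <= pois r k by exact: pois_ge0.
have q0 k : 0 <= k%:R * pois r k by exact: mulr_ge0.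
rewrite nneseriesZl; last by move=> k _; rewrite adde_ge0// lee_fin.
rewrite nneseriesD; [|by move=> k _; rewrite lee_fin..].
rewrite poisson_moment1// poisson_sum1// -EFinD -EFinM; congr EFin; ring.
Qed.

Definition rescale lam (k : nat) : R := k%:R / lam.

Lemma measurable_rescale lam : measurable_fun setT (rescale lam).
Proof. by []. Qed.

HB.instance Definition _ lam :=
  isMeasurableFun.Build _ _ _ _ (rescale lam) (measurable_rescale lam).

Definition limit_law lam h : probability R R :=
  distribution (poisson_prob (lam * h) 0%N) (rescale lam).

Variables (lam h : R).
Hypotheses (lam0 : 0 < lam) (h0 : 0 <= h).

Let r0 : 0 <= lam * h. Proof. by rewrite mulr_ge0// ltW. Qed.

Lemma ge0_integral_limit_law (f : R -> R) : measurable_fun setT f ->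
  (forall x, 0 <= f x) -> (\int[limit_law lam h]_x (f x)%:E =
  \sum_(0 <= k <oo) (f (k%:R / lam) * pois (lam * h) k)%:E)%E.
Proof.
move=> mf f0; rewrite ge0_integral_distribution//; last exact/measurable_EFinP.
rewrite ge0_integral_nat//.
  by apply: eq_eseriesr => k _; rewrite pmf_natE poisson_pmf_nat// -EFinM.
by move=> k; rewrite lee_fin.
Qed.

Lemma limit_law_mean : ('E_(limit_law lam h)[id] = h%:E)%E.
Proof.
have p0 k : 0 <= pois (lam * h) k by exact: pois_ge0.
have mn : measurable_fun setT (fun x : R => `|x|) by exact: normr_measurable.
have mabs : measurable_fun setT (fun x : R => `|x|%:E) by exact/measurable_EFinP.
have absE : (\int[limit_law lam h]_x (`|x|%:E) = h%:E)%E.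
  rewrite (ge0_integral_limit_law mn)//.
  transitivity (\sum_(0 <= k <oo) (lam^-1%:E * (k%:R * pois (lam * h) k)%:E))%E.
    apply: eq_eseriesr => k _; rewrite -EFinM ger0_norm ?divr_ge0// ?(ltW lam0)//.
    by congr EFin; ring.
  rewrite nneseriesZl; last by move=> k _; rewrite lee_fin mulr_ge0.
  by rewrite poisson_moment1// -EFinM mulrA mulVf ?gt_eqF// mul1r.
have toP : (\int[limit_law lam h]_x (`|x|%:E) =
    \int[poisson_prob (lam * h) 0%N]_k (`|rescale lam k|%:E))%E.
  by rewrite ge0_integral_distribution.
rewrite unlock integral_distribution//.
  rewrite -absE toP; apply: eq_integral => k _ /=.
  by rewrite ger0_norm// /rescale divr_ge0// ltW.
apply/integrableP; split => //.
by rewrite -[X in (X < _)%E]/(\int[poisson_prob (lam * h) 0%N]_k (`|rescale lam k|%:E))%E -toP absE ltry.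
Qed.

(** The square is expanded, but its negative cross term is moved to the other side,
    so that all series have nonnegative terms. *)
Lemma limit_law_variance :
  (\int[limit_law lam h]_z ((z - h) ^+ 2)%:E = (h / lam)%:E)%E.
Proof.
have p0 k : 0 <= pois (lam * h) k by exact: pois_ge0.
have m2 : measurable_fun setT (fun z : R => (z - h) ^+ 2).
  exact/measurable_funX/measurable_funB.
rewrite ge0_integral_limit_law//; last by move=> x; exact: sqr_ge0.
set V := (\sum_(0 <= k <oo) _)%E.
have c0 : 0 <= 2 * h / lam by rewrite divr_ge0 ?mulr_ge0// ltW.
have q1 k : 0 <= k%:R * pois (lam * h) k by exact: mulr_ge0.
have q2 k : 0 <= k%:R ^+ 2 * pois (lam * h) k by rewrite mulr_ge0// sqr_ge0.
have eq : (V + (2 * h / lam)%:E * (\sum_(0 <= k <oo) (k%:R * pois (lam * h) k)%:E) =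
    (lam^-1 ^+ 2)%:E * (\sum_(0 <= k <oo) (k%:R ^+ 2 * pois (lam * h) k)%:E) +
    (h ^+ 2)%:E * (\sum_(0 <= k <oo) (pois (lam * h) k)%:E))%E.
  rewrite -!nneseriesZl; [|by move=> k _; rewrite lee_fin..].
  rewrite -!nneseriesD; first last.
  - by move=> k _; rewrite -EFinM lee_fin mulr_ge0.
  - by move=> k _; rewrite lee_fin mulr_ge0// sqr_ge0.
  - by move=> k _; rewrite -EFinM lee_fin mulr_ge0// sqr_ge0.
  - by move=> k _; rewrite -EFinM lee_fin mulr_ge0// sqr_ge0.
  apply: eq_eseriesr => k _; rewrite -!EFinM -!EFinD; congr EFin; ring.
rewrite poisson_moment1// poisson_moment2// poisson_sum1// in eq.
have Vfin : V \is a fin_num.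
  have V0 : (0 <= V)%E by apply: nneseries_ge0 => k _ _; rewrite lee_fin mulr_ge0 ?sqr_ge0.
  rewrite ge0_fin_numE//.
  apply: (@le_lt_trans _ _ (V + (2 * h / lam)%:E * (lam * h)%:E)%E).
    by rewrite leeDl// -EFinM lee_fin mulr_ge0// divr_ge0 ?mulr_ge0// ltW.
  by rewrite eq mule1 -EFinM -EFinD ltry.
move: eq; rewrite -(fineK Vfin) mule1 -!EFinM -!EFinD => -[] eq.
congr EFin; apply: (addIr (2 * h / lam * (lam * h))); rewrite {}eq.
by field; rewrite gt_eqF.
Qed.

End poisson_limit_law.

(** * The law of small numbers *)

Section bernoulli_sum_law.
Context {R : realType}.

Section fixed_length.
Variables (p : nat -> R) (a : nat -> nat -> R).
Hypotheses (p0 : forall t, 0 <= p t) (p1 : forall t, p t <= 1)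
  (a0 : forall k, a 0%N k = (k == 0%N)%:R)
  (aS0 : forall n, a n.+1 0%N = (1 - p n) * a n 0%N)
  (aSS : forall n k, a n.+1 k.+1 = (1 - p n) * a n k.+1 + p n * a n k)
  (a_ge0 : forall n k, 0 <= a n k) (a_le1 : forall n k, a n k <= 1).

Let Lam n := \sum_(t < n) p t.
Let err n := \sum_(t < n) p t ^+ 2.

Let err_ge0 n : 0 <= err n. Proof. by apply: sumr_ge0 => t _; exact: sqr_ge0. Qed.

(** Each factor [1 - p t] differs from [expR (- p t)] by at most [p t ^ 2]. *)
Lemma bernoulli_sum_zero n : `|a n 0%N - expR (- Lam n)| <= err n.
Proof.
elim: n => [|n IH].
  by rewrite a0 /Lam /err !big_ord0 oppr0 expR0 subrr normr0.
rewrite aS0 /Lam /err !big_ord_recr/= -/(Lam n) -/(err n) opprD expRD.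
have L0 : 0 <= Lam n by exact: sumr_ge0.
have e1 : expR (- Lam n) <= 1 by rewrite -expR0 ler_expR oppr_le0.
have pn0 := p0 n; have pn1 := p1 n.
have h1 : 1 - p n <= expR (- p n) by rewrite expR_ge1Dx.
have h2 : expR (- p n) <= 1 - p n + p n ^+ 2.
  have h3 : 1 + p n <= expR (p n) by rewrite expR_ge1Dx.
  have h4 : expR (p n) * expR (- p n) = 1 by rewrite -expRD subrr expR0.
  have h5 : (1 + p n) * expR (- p n) <= 1 by rewrite -[leRHS]h4 ler_wpM2r// expR_ge0.
  have h6 : 1 <= (1 + p n) * (1 - p n + p n ^+ 2).
    have -> : (1 + p n) * (1 - p n + p n ^+ 2) = 1 + p n ^+ 3 by ring.
    by rewrite lerDl exprn_ge0.
  have h7 : 0 < 1 + p n by lra.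
  by rewrite -(ler_pM2l h7) (le_trans h5).
have -> : (1 - p n) * a n 0%N - expR (- Lam n) * expR (- p n) =
  (1 - p n) * (a n 0%N - expR (- Lam n)) + expR (- Lam n) * (1 - p n - expR (- p n)) by ring.
apply: (le_trans (ler_normD _ _)); rewrite !normrM; apply: lerD.
  by rewrite (le_trans _ IH)// ler_piMl// ger0_norm ?subr_ge0// gerBl.
rewrite -[leRHS]mul1r (ger0_norm (expR_ge0 _)) ler_pM ?expR_ge0//.
by rewrite ler_norml; apply/andP; split; lra.
Qed.

(** The recursion of the Poisson law of mean [Lam] holds up to the sum of the
    squares, by induction: adding the event [n] turns the errors at [k] and
    [k + 1] into a convex combination of them plus a term in [p n ^ 2]. *)
Lemma bernoulli_sum_succ n k :
  `|k.+1%:R * a n k.+1 - Lam n * a n k| <= err n.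
Proof.
elim: n k => [|n IH] k.
  by rewrite /Lam /err !big_ord0 a0 mulr0 mul0r subrr normr0.
rewrite /Lam /err !big_ord_recr/= -/(Lam n) -/(err n).
have pn0 := p0 n; have pn1 := p1 n.
case: k => [|k].
  rewrite aSS aS0.
  have -> : 1 * ((1 - p n) * a n 1%N + p n * a n 0%N) - (Lam n + p n) * ((1 - p n) * a n 0%N) =
    (1 - p n) * (1 * a n 1%N - Lam n * a n 0%N) + p n ^+ 2 * a n 0%N by ring.
  apply: (le_trans (ler_normD _ _)); apply: lerD.
    by rewrite normrM (le_trans _ (IH 0%N))// ler_piMl// ger0_norm ?subr_ge0// gerBl.
  by rewrite ger0_norm ?mulr_ge0 ?sqr_ge0// ler_piMr// sqr_ge0.
rewrite !aSS.
have -> : k.+2%:R * ((1 - p n) * a n k.+2 + p n * a n k.+1) -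
  (Lam n + p n) * ((1 - p n) * a n k.+1 + p n * a n k) =
  ((1 - p n) * (k.+2%:R * a n k.+2 - Lam n * a n k.+1) +
   p n * (k.+1%:R * a n k.+1 - Lam n * a n k)) + p n ^+ 2 * (a n k.+1 - a n k).
  by rewrite -[k.+2%:R]natr1; ring.
apply: (le_trans (ler_normD _ _)); apply: lerD.
  apply: (le_trans (ler_normD _ _)); rewrite !normrM (ger0_norm pn0) ger0_norm ?subr_ge0//.
  have h1 : (1 - p n) * `|k.+2%:R * a n k.+2 - Lam n * a n k.+1| <= (1 - p n) * err n.
    by rewrite ler_wpM2l ?subr_ge0.
  have h2 : p n * `|k.+1%:R * a n k.+1 - Lam n * a n k| <= p n * err n by rewrite ler_wpM2l.
  by apply: (le_trans (lerD h1 h2)); rewrite -mulrDl subrK mul1r.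
rewrite normrM ger0_norm ?sqr_ge0// ler_piMr ?sqr_ge0//.
have := a_ge0 n k; have := a_le1 n k; have := a_ge0 n k.+1; have := a_le1 n k.+1.
by move=> *; rewrite ler_norml; apply/andP; split; lra.
Qed.

End fixed_length.

(** [a n m k] stands for the probability that exactly [k] of the first [m] events
    in the row [n] of a triangular array of independent events occur, with
    [p n t] for the probability of the event [t]; independence is expressed by
    the recursion in [m].  The two approximate identities above determine the limits one after
    the other. *)
Lemma small_numbers (p : nat -> nat -> R) (a : nat -> nat -> nat -> R) (r : R) :
  (\forall n \near \oo, [/\ forall t, 0 <= p n t, forall t, p n t <= 1,
    forall k, a n 0%N k = (k == 0%N)%:R &
    [/\ forall m, a n m.+1 0%N = (1 - p n m) * a n m 0%N,
     forall m k, a n m.+1 k.+1 = (1 - p n m) * a n m k.+1 + p n m * a n m k,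
     forall m k, 0 <= a n m k & forall m k, a n m k <= 1]]) ->
  (fun n => \sum_(t < n) p n t) @ \oo --> r ->
  (fun n => \sum_(t < n) p n t ^+ 2) @ \oo --> (0 : R) ->
  forall k, a n n k @[n --> \oo] --> pois r k.
Proof.
move=> H cL cE; elim=> [|k IH].
  rewrite pois0.
  have c1 : (fun n => expR (- \sum_(t < n) p n t)) @ \oo --> expR (- r).
    apply: (@continuous_cvg _ _ _ _ _ _ (@expR R)); first exact: continuous_expR.
    exact: cvgN.
  have c0 : (fun n => a n n 0%N - expR (- \sum_(t < n) p n t)) @ \oo --> (0 : R).
    apply/cvgr0Pnorm_le => e e0; have /cvgr0Pnorm_le/(_ e e0) := cE.
    apply: filterS2 H => n [p0 p1 a0 [aS0 aSS ag al]].
    by move=> he; apply: (le_trans (bernoulli_sum_zero p0 p1 a0 aS0 _)); exact: le_trans (ler_norm _) he.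
  have -> : (fun n => a n n 0%N) = (fun n =>
      (a n n 0%N - expR (- \sum_(t < n) p n t)) + expR (- \sum_(t < n) p n t)).
    by apply/funext => n; rewrite subrK.
  by rewrite -[X in _ --> X]add0r; exact: cvgD.
have c1 : (fun n => (\sum_(t < n) p n t) * a n n k) @ \oo --> r * pois r k by exact: cvgM.
have c0 : (fun n => k.+1%:R * a n n k.+1 - (\sum_(t < n) p n t) * a n n k) @ \oo --> (0 : R).
  apply/cvgr0Pnorm_le => e e0; have /cvgr0Pnorm_le/(_ e e0) := cE.
  apply: filterS2 H => n [p0 p1 a0 [aS0 aSS ag al]].
  move=> he; apply: (le_trans (bernoulli_sum_succ p0 p1 a0 aS0 aSS ag al _ _)).
  exact: le_trans (ler_norm _) he.
have -> : (fun n => a n n k.+1) = (fun n => k.+1%:R^-1 *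
    ((k.+1%:R * a n n k.+1 - (\sum_(t < n) p n t) * a n n k) + (\sum_(t < n) p n t) * a n n k)).
  by apply/funext => n; rewrite subrK mulKf// pnatr_eq0.
have -> : pois r k.+1 = k.+1%:R^-1 * (0 + r * pois r k).
  by rewrite add0r -poisS mulKf// pnatr_eq0.
by apply: cvgM; [exact: cvg_cst|exact: cvgD].
Qed.

End bernoulli_sum_law.

(** * Independent proxies for the decreases *)

Section proxy_counts.
Context {d : measure_display} {Omega : measurableType d} {R : realType}.
Variables (Z : nat -> nat -> {mfun Omega >-> bool})
          (eps : nat -> {mfun Omega >-> nat}).
Variable m : nat -> nat.

(** The decrease at time [t] that would be observed if the population had the
    deterministic size [m t].  Contrary to the decreases of the process, these
    events are independent. *)
Definition proxy (t : nat) (w : Omega) : bool :=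
  (eps t w == 0%N) && (0 < deaths Z t (m t) w)%N.

Definition proxy_count (n : nat) (w : Omega) : nat := (\sum_(t < n) proxy t w)%N.

Let depn := dep (noise Z eps).

Lemma dep_deaths t x N (A : set nat) : (x <= N)%N ->
  depn [seq inl (t, j) | j <- iota 0 N] [set w | A (deaths Z t x w)].
Proof.
move=> xN w w' ww' /=.
rewrite /deaths (eq_bigr (fun j : 'I_x => (~~ Z t j w' : nat)))// => j _.
rewrite (noise_inj_Z (ww' (inl (t, val j)) _))// map_f// mem_iota/=.
exact: leq_trans (ltn_ord j) xN.
Qed.

Lemma dep_proxy t N (A : set bool) : (m t <= N)%N ->
  depn (present t N) [set w | A (proxy t w)].
Proof.
move=> mN w w' ww' /=; rewrite /proxy.
rewrite -[eps t w]/(noise Z eps (inr t) w) ww' ?mem_present_eps//.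
suff -> : deaths Z t (m t) w = deaths Z t (m t) w' by [].
rewrite /deaths; apply: eq_bigr => j _.
rewrite (noise_inj_Z (ww' (inl (t, val j)) _))// mem_present_Z//.
exact: leq_trans (ltn_ord j) mN.
Qed.

Lemma dep_proxy_count n N (A : set nat) : (forall t, (t < n)%N -> (m t <= N)%N) ->
  depn (past n N) [set w | A (proxy_count n w)].
Proof.
move=> mN w w' ww' /=.
suff -> : proxy_count n w = proxy_count n w' by [].
rewrite /proxy_count; apply: eq_bigr => t _; congr nat_of_bool.
have := @dep_proxy t N [set b | b = proxy t w] (mN _ (ltn_ord t)) w w'.
move=> /= h; apply/esym/h => // i it; apply: ww'.
apply/flattenP; exists (present t N) => //; apply: map_f.
by rewrite mem_iota/=.
Qed.

Lemma measurable_proxy_count n (A : set nat) : measurable [set w | A (proxy_count n w)].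
Proof.
apply: (@dep_noise_measurable _ _ Z eps (past n (\max_(t < n) m t)%N)).
by apply: dep_proxy_count => t tn; exact: (leq_bigmax (Ordinal tn)).
Qed.

Lemma measurable_proxy t (A : set bool) : measurable [set w | A (proxy t w)].
Proof.
apply: (@dep_noise_measurable _ _ Z eps (present t (m t))).
exact: dep_proxy.
Qed.

Variables (P : probability Omega R) (theta : R) (G : probability nat R).
Hypotheses (theta01 : 0 <= theta <= 1) (hP : inar_noise Z eps P theta G).

Lemma Pr_no_deaths t x : Pr P [set w | deaths Z t x w = 0%N] = theta ^+ x.
Proof.
elim: x => [|x IH].
  rewrite (_ : [set w | _] = setT) ?Pr_setT ?expr0//.
  by apply/seteqP; split => // w _; rewrite /= /deaths big_ord0.
have -> : [set w | deaths Z t x.+1 w = 0%N] =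
    [set w | deaths Z t x w = 0%N] `&` [set w | Z t x w = true].
  apply/seteqP; split => w; rewrite /deaths/= big_ord_recr/=.
    by move/eqP; rewrite addn_eq0 => /andP[/eqP-> /=]; case: (Z t x w).
  by move=> [-> ->].
rewrite (Pr_indep_noise hP (s := [seq inl (t, j) | j <- iota 0 x]) (s' := [:: inl (t, x)])).
- by rewrite IH (Pr_Z theta01 hP) exprSr.
- rewrite cat_uniq map_inj_uniq ?iota_uniq//=; last by move=> i j [].
  rewrite orbF andbT; apply/negP => /mapP[j]; rewrite mem_iota/= => jx [xj].
  by rewrite xj ltnn in jx.
- exact: (@dep_deaths t x x [set k | k = 0%N]).
- move=> w w' ww' /= <-; apply/esym/(@noise_inj_Z _ _ Z eps)/ww'.
  by rewrite mem_head.
Qed.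

Lemma Pr_proxy t : Pr P [set w | proxy t w] = pmf_nat G 0 * (1 - theta ^+ m t).
Proof.
have -> : [set w | proxy t w] =
    [set w | eps t w = 0%N] `&` ~` [set w | deaths Z t (m t) w = 0%N].
  apply/seteqP; split => w; rewrite /proxy /=.
    by move=> /andP[/eqP-> d0]; split => //; move=> d00; rewrite d00 in d0.
  by move=> [-> /eqP]; rewrite eqxx lt0n.
rewrite (Pr_indep_noise hP (s := [:: inr t]) (s' := [seq inl (t, j) | j <- iota 0 (m t)])).
- rewrite (Pr_eps hP) PrC ?Pr_no_deaths//.
  exact: (@measurable_deaths _ _ Z eps t (m t) [set k | k = 0%N]).
- rewrite /= map_inj_uniq ?iota_uniq ?andbT; last by move=> i j [].
  by apply/negP => /mapP[].
- move=> w w' ww' /= <-.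
  by rewrite -[eps t w]/(noise Z eps (inr t) w) ww' ?mem_head.
- exact: (@dep_deaths t (m t) (m t) (~` [set k | k = 0%N])).
Qed.

Let indep n (A : set nat) (B : set bool) :
  Pr P ([set w | A (proxy_count n w)] `&` [set w | B (proxy n w)]) =
  Pr P [set w | A (proxy_count n w)] * Pr P [set w | B (proxy n w)].
Proof.
pose M := (\max_(t < n.+1) m t)%N.
have mM t : (t < n.+1)%N -> (m t <= M)%N by move=> tn; exact: (leq_bigmax (Ordinal tn)).
apply: (Pr_indep_noise hP (past_present_uniq n M)).
  by apply: dep_proxy_count => t tn; apply: mM; exact: ltnW.
by apply: dep_proxy; exact: mM.
Qed.

Let Pr_noproxy t : Pr P [set w | proxy t w = false] = 1 - Pr P [set w | proxy t w].
Proof.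
rewrite -PrC; last exact: (measurable_proxy t [set b | b]).
by congr Pr; apply/seteqP; split => w /=; case: (proxy t w).
Qed.

Lemma Pr_proxy_count0 k : Pr P [set w | proxy_count 0 w = k] = (k == 0%N)%:R.
Proof.
have [->|k0] := eqVneq k 0%N.
  rewrite (_ : [set w | _] = setT) ?Pr_setT//.
  by apply/seteqP; split => // w _; rewrite /= /proxy_count big_ord0.
rewrite (_ : [set w | _] = set0) ?Pr_set0//.
by apply/seteqP; split => // w; rewrite /= /proxy_count big_ord0 => /esym/eqP; rewrite (negbTE k0).
Qed.

Lemma Pr_proxy_countS0 n : Pr P [set w | proxy_count n.+1 w = 0%N] =
  (1 - Pr P [set w | proxy n w]) * Pr P [set w | proxy_count n w = 0%N].
Proof.
rewrite mulrC -Pr_noproxy -(indep n [set k | k = 0%N] [set b | b = false]).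
congr Pr; apply/seteqP; split => w; rewrite /proxy_count/= big_ord_recr/=.
  by move/eqP; rewrite addn_eq0 => /andP[/eqP-> /=]; case: (proxy n w).
by move=> [-> ->].
Qed.

Lemma Pr_proxy_countSS n k : Pr P [set w | proxy_count n.+1 w = k.+1] =
  (1 - Pr P [set w | proxy n w]) * Pr P [set w | proxy_count n w = k.+1] +
  Pr P [set w | proxy n w] * Pr P [set w | proxy_count n w = k].
Proof.
rewrite -Pr_noproxy mulrC -(indep n [set i | i = k.+1] [set b | b = false]).
rewrite mulrC -(indep n [set i | i = k] [set b | b]).
rewrite -PrU_disj.
- congr Pr; apply/seteqP; split => w; rewrite /proxy_count/= big_ord_recr/=.
    case: (proxy n w) => /=; first by rewrite addn1 => -[->]; right.
    by rewrite addn0 => ->; left.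
  by move=> [[-> ->]|[-> ->]]; rewrite ?addn0 ?addn1.
- apply: measurableI; first exact: (measurable_proxy_count n [set i | i = k.+1]).
  exact: (measurable_proxy n [set b | b = false]).
- apply: measurableI; first exact: (measurable_proxy_count n [set i | i = k]).
  exact: (measurable_proxy n [set b | b]).
- by apply/seteqP; split => // w [[_ /= ->] [_]].
Qed.

End proxy_counts.

Section proxy_poisson.
Context {R : realType} {d : measure_display} {Omega : measurableType d}.
Variables (Z : nat -> nat -> {mfun Omega >-> bool})
          (eps : nat -> {mfun Omega >-> nat})
          (P : R -> probability nat R -> probability Omega R).
Hypothesis hP : forall (theta : R) (G : probability nat R), 0 <= theta <= 1 ->
  inar_noise Z eps (P theta G) theta G.

Section means.
Variables (g0 mu h : R) (n : nat).
Hypotheses (g00 : 0 <= g0) (g01 : g0 <= 1) (mu0 : 0 <= mu) (h0 : 0 <= h) (n0 : 0 < n%:R :> R)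
  (a1 : h / n%:R ^+ 2 <= 1).

Let a := h / n%:R ^+ 2.
Let m t := Num.truncn (t%:R * mu).
Let p t := g0 * (1 - (1 - a) ^+ m t).

Let a01 : 0 <= a <= 1. Proof. by rewrite a1 andbT divr_ge0// exprn_ge0// ltW. Qed.

Let a0 : 0 <= a. Proof. by case/andP: a01. Qed.

Let m_le t : (m t)%:R <= t%:R * mu.
Proof. by rewrite truncn_le mulr_ge0. Qed.

Let m_ge t : t%:R * mu - 1 <= (m t)%:R.
Proof. by rewrite lerBlDr natr1 ltW// truncnS_gt. Qed.

Lemma proxy_prob_ge0 t : 0 <= p t.
Proof. by rewrite mulr_ge0// subr_ge0; exact: (no_death_le1 _ a01). Qed.

Lemma proxy_prob_le1 t : p t <= 1.
Proof.
have h1 : 0 <= (1 - a) ^+ m t by exact: (no_death_ge0 _ a01).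
by rewrite mulr_ile1// ?subr_ge0 ?gerBl//; exact: (no_death_le1 _ a01).
Qed.

Let ma t : (t < n)%N -> (m t)%:R * a <= mu * h / n%:R.
Proof.
move=> tn; have -> : mu * h / n%:R = n%:R * mu * a by rewrite /a; field; rewrite gt_eqF.
rewrite ler_wpM2r// (le_trans (m_le t))// ler_wpM2r// ler_nat ltnW//.
Qed.

(** Each proxy has probability at most [mu * h / n]. *)
Lemma proxy_prob_sum_sqr : \sum_(t < n) p t ^+ 2 <= (mu * h) ^+ 2 / n%:R.
Proof.
have -> : (mu * h) ^+ 2 / n%:R = \sum_(t < n) (mu * h / n%:R) ^+ 2.
  by rewrite sumr_const card_ord -[RHS]mulr_natr; field; rewrite gt_eqF.
apply: ler_sum => t _; rewrite lerXn2r ?nnegrE ?proxy_prob_ge0//.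
  by rewrite divr_ge0 ?mulr_ge0// ltW.
rewrite (le_trans _ (ma (ltn_ord t)))// /p (@le_trans _ _ (1 - (1 - a) ^+ m t))//.
  by rewrite ler_piMl// subr_ge0; exact: (no_death_le1 _ a01).
by rewrite lerBlDr -lerBlDl; exact: (no_death_ge _ a01).
Qed.

(** To first order the proxy at time [t] has probability [g0 * (t * mu) * h / n ^ 2].
    The terms in the error come from [n * (n - 1)] in place of [n ^ 2], from the
    rounding of [t * mu], and from the second-order terms. *)
Lemma proxy_prob_sum : `|\sum_(t < n) p t - g0 * mu / 2 * h| <=
  (mu * h / 2 + h + (mu * h) ^+ 2) / n%:R.
Proof.
have up : \sum_(t < n) p t <= g0 * mu / 2 * h.
  apply: (@le_trans _ _ (\sum_(t < n) (g0 * (t%:R * mu * a)))).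
    apply: ler_sum => t _; rewrite ler_wpM2l// (@le_trans _ _ ((m t)%:R * a))//.
      by rewrite lerBlDr -lerBlDl; exact: (no_death_ge _ a01).
    by rewrite ler_wpM2r.
  rewrite -mulr_sumr -!mulr_suml sum_ord_natr.
  have -> : g0 * (n%:R * (n%:R - 1) / 2 * mu * a) = g0 * mu / 2 * h * (1 - n%:R^-1).
    by rewrite /a; field; rewrite gt_eqF.
  rewrite ler_piMr ?mulr_ge0// lerBlDr lerDl invr_ge0 ltW//.
have lo : g0 * mu / 2 * h - (mu * h / 2 + h + (mu * h) ^+ 2) / n%:R <= \sum_(t < n) p t.
  apply: (@le_trans _ _ (\sum_(t < n) (g0 * ((t%:R * mu - 1) * a - (mu * h / n%:R) ^+ 2)))); last first.
    apply: ler_sum => t _; rewrite ler_wpM2l//.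
    have := no_death_le (m t) a01; rewrite /no_death => hd.
    have h1 : ((m t)%:R * a) ^+ 2 <= (mu * h / n%:R) ^+ 2.
      by rewrite lerXn2r ?nnegrE ?mulr_ge0 ?ma.
    have h2 : (t%:R * mu - 1) * a <= (m t)%:R * a by rewrite ler_wpM2r.
    lra.
  rewrite -mulr_sumr sumrB sumr_const card_ord -mulr_suml sumrB sumr_const card_ord -mulr_suml.
  rewrite sum_ord_natr -(mulr_natr (_ ^+ 2)).
  have -> : (n%:R * (n%:R - 1) / 2 * mu - 1 *+ n) * a - (mu * h / n%:R) ^+ 2 * n%:R =
    mu / 2 * h - (mu * h / 2 + h + (mu * h) ^+ 2) / n%:R.
    by rewrite /a; field; rewrite gt_eqF.
  rewrite mulrBr -!mulrA lerD2l lerN2 ler_piMl//.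
  by rewrite mulr_ge0 ?invr_ge0 ?(ltW n0)// !addr_ge0 ?mulr_ge0// ?sqr_ge0.
by rewrite ler_norml lerBrDl lerBlDl; apply/andP; split; lra.
Qed.

End means.

Lemma proxy_count_poisson (G : probability nat R) (h : R) : admissible G -> 0 <= h ->
  forall k, Pr (P (1 - h / n%:R ^+ 2) G)
      [set w | proxy_count Z eps (fun t => Num.truncn (t%:R * mean_nat G)) n w = k]
    @[n --> \oo] --> pois (pmf_nat G 0 * mean_nat G / 2 * h) k.
Proof.
move=> Gadm h0.
have mu0 : 0 <= mean_nat G by exact/ltW/admissible_mean_gt0.
have g00 : 0 <= pmf_nat G 0 by exact: pmf_nat_ge0.
have g01 : pmf_nat G 0 <= 1 by have := pmf_nat_partial_sum_le1 G 1; rewrite big_ord1.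
pose m t := Num.truncn (t%:R * mean_nat G).
pose p n t := pmf_nat G 0 * (1 - (1 - h / n%:R ^+ 2) ^+ m t).
pose a n j k := Pr (P (1 - h / n%:R ^+ 2) G) [set w | proxy_count Z eps m j w = k].
have near1 : \forall n \near \oo, 0 <= 1 - h / n%:R ^+ 2 <= 1 /\ 0 < n%:R :> R.
  near=> n; split; first by near: n; exact: theta_near.
  by apply: (@lt_le_trans _ _ 1) => //; near: n; exact: nbhs_infty_ger.
apply: (@small_numbers _ p a).
- apply: filterS near1 => n [th n0].
  have a1 : h / n%:R ^+ 2 <= 1 by case/andP: th; lra.
  have pE t : p n t = Pr (P (1 - h / n%:R ^+ 2) G) [set w | proxy Z eps m t w].
    by rewrite (Pr_proxy m th (hP G th)).
  split.
  + by move=> t; exact: proxy_prob_ge0.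
  + by move=> t; exact: proxy_prob_le1.
  + by move=> k; exact: Pr_proxy_count0.
  split.
  + by move=> j; rewrite pE; exact: (Pr_proxy_countS0 _ (hP G th)).
  + by move=> j k; rewrite pE; exact: (Pr_proxy_countSS _ (hP G th)).
  + by move=> j k; exact: Pr_ge0.
  + by move=> j k; apply: Pr_le1; exact: (measurable_proxy_count Z eps m j [set i | i = k]).
- apply/cvgrPdist_le => e e0; near=> n.
  have [th n0] : 0 <= 1 - h / n%:R ^+ 2 <= 1 /\ 0 < n%:R :> R by near: n; exact: near1.
  have a1 : h / n%:R ^+ 2 <= 1 by case/andP: th; lra.
  rewrite distrC; apply: (le_trans (proxy_prob_sum g00 g01 mu0 h0 n0 a1)).
  rewrite ler_pdivrMr// [e * _]mulrC -ler_pdivrMr//.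
  by near: n; exact: nbhs_infty_ger.
- apply/cvgr0Pnorm_le => e e0; near=> n.
  have [th n0] : 0 <= 1 - h / n%:R ^+ 2 <= 1 /\ 0 < n%:R :> R by near: n; exact: near1.
  have a1 : h / n%:R ^+ 2 <= 1 by case/andP: th; lra.
  rewrite ger0_norm; last by apply: sumr_ge0 => t _; exact: sqr_ge0.
  apply: (le_trans (proxy_prob_sum_sqr g00 g01 mu0 h0 n0 a1)).
  rewrite ler_pdivrMr// [e * _]mulrC -ler_pdivrMr//.
  by near: n; exact: nbhs_infty_ger.
Unshelve. all: by end_near. Qed.

End proxy_poisson.

(** * Comparison of the estimator with the proxies *)

Section good_event.
Context {d : measure_display} {Omega : measurableType d} {R : realType}.
Variables (Z : nat -> nat -> {mfun Omega >-> bool})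
          (eps : nat -> {mfun Omega >-> nat}).

Lemma deaths_eq t x y w : (x <= y)%N ->
  (forall j, (x <= j)%N -> (j < y)%N -> Z t j w) -> deaths Z t x w = deaths Z t y w.
Proof.
move=> /subnKC <-; elim: (y - x)%N => [|k IH] h; first by rewrite addn0.
rewrite addnS /deaths big_ord_recr/= -/(deaths Z t (x + k) w) h ?leq_addr ?addnS// addn0.
by apply: IH => j xj jk; apply: h => //; rewrite addnS ltnW.
Qed.

Definition pairs (n : nat) (lo : nat -> nat) (len : nat) : seq (nat * nat) :=
  [seq (t, j) | t <- iota 0 n, j <- iota (lo t) len].

(** The window from [lo t] to [lo t + len] will contain both the size of the
    population and its deterministic approximation.  Unless an individual
    indexed in this window dies, both see the same deaths. *)
Definition ambiguous (n : nat) (lo : nat -> nat) (len : nat) : set Omega :=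
  [set w | exists2 i, i \in pairs n lo len & Z i.1 i.2 w = false].

Lemma measurable_no_survival t j b : measurable [set w | Z t j w = b].
Proof. exact: (@measurable_Z _ _ Z eps t j b). Qed.

Lemma measurable_ambiguous n lo len : measurable (ambiguous n lo len).
Proof. by apply: measurable_exists_in => i _; exact: measurable_no_survival. Qed.

Lemma unambiguous_deaths n lo len w t x y : ~ ambiguous n lo len w -> (t < n)%N ->
  (lo t <= x <= lo t + len)%N -> (lo t <= y <= lo t + len)%N ->
  deaths Z t x w = deaths Z t y w.
Proof.
move=> amb tn.
suff h z : (lo t <= z <= lo t + len)%N -> deaths Z t (lo t) w = deaths Z t z w.
  by move=> /h <- /h <-.
move=> /andP[lz zl]; apply: deaths_eq => // j lj jz.
apply/negP => /negP Zj; apply: amb; exists (t, j); last exact/negbTE.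
apply/allpairsPdep; exists t, j; split => //; rewrite mem_iota ?tn// lj/=.
exact: leq_trans jz zl.
Qed.

Definition many_deaths (n N : nat) (c : R) : set Omega :=
  [set w | c <= \sum_(t < n) (deaths Z t N w)%:R].

(* As a count of events, to which Markov's inequality applies. *)
Let many_deathsE n N c : many_deaths n N c =
  [set w | c <= \sum_(i <- pairs n (fun=> 0%N) N) \1_([set w | Z i.1 i.2 w = false]) w].
Proof.
have io k : iota 0 k = index_iota 0 k by rewrite /index_iota subn0.
apply/seteqP; split => w; rewrite /many_deaths/=.
all: suff -> : \sum_(t < n) (deaths Z t N w)%:R =
    \sum_(i <- pairs n (fun=> 0%N) N) \1_([set w | Z i.1 i.2 w = false]) w :> R by [].
all: rewrite /pairs big_allpairs (io n) big_mkord.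
all: apply: eq_bigr => t _; rewrite /deaths natr_sum (io N) big_mkord.
all: apply: eq_bigr => j _; rewrite indicE; congr (_%:R).
all: congr nat_of_bool; apply/idP/idP => [/negbTE h|/set_mem/= ->//].
all: exact: mem_set.
Qed.

Lemma measurable_many_deaths n N c : measurable (many_deaths n N c).
Proof.
have bE : measurable_fun setT (fun w =>
    \sum_(i <- pairs n (fun=> 0%N) N) \1_([set w | Z i.1 i.2 w = false]) w : R).
  apply: measurable_sum => i; apply: measurable_indic; exact: measurable_no_survival.
by rewrite many_deathsE -[X in measurable X]setTI; apply: measurable_fun_le.
Qed.

Section bounds.
Variables (P : probability Omega R) (theta : R) (G : probability nat R).
Hypotheses (theta01 : 0 <= theta <= 1) (hP : inar_noise Z eps P theta G).

Let sum_pairs n lo len :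
  \sum_(i <- pairs n lo len) Pr P [set w | Z i.1 i.2 w = false] =
  n%:R * (len%:R * (1 - theta)).
Proof.
rewrite (eq_bigr (fun=> 1 - theta)); last by move=> i _; rewrite (Pr_Z theta01 hP).
rewrite big_const_seq iter_addr_0 count_predT size_allpairs_dep -[LHS]mulr_natr.
rewrite (_ : sumn _ = n * len)%N; first by rewrite natrM mulrC mulrA.
rewrite (eq_map (g := fun=> len)); last by move=> t; rewrite size_iota.
by rewrite sumnE big_map big_const_seq iter_addn_0 count_predT size_iota mulnC.
Qed.

Lemma Pr_ambiguous n lo len :
  Pr P (ambiguous n lo len) <= n%:R * (len%:R * (1 - theta)).
Proof.
rewrite -(sum_pairs n lo); apply: Pr_exists_in_le => i _; exact: measurable_no_survival.
Qed.

Lemma Pr_many_deaths n N c : 0 < c ->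
  Pr P (many_deaths n N c) <= n%:R * (N%:R * (1 - theta)) / c.
Proof.
move=> c0; rewrite many_deathsE -(sum_pairs n (fun=> 0%N)).
apply: markov_count => // i; exact: measurable_no_survival.
Qed.

End bounds.

Section deterministic.
Variables (G : probability nat R) (c : R) (n : nat) (w : Omega).
Let mu := mean_nat G.
Let N := Num.truncn ((mu + c) * n%:R).
(* The population lies within [2 * c * n] of [t * mu], and the rounded value of
   [t * mu] within 1; a negative lower end is truncated to 0. *)
Let lo t := Num.truncn (t%:R * mu - 2 * c * n%:R - 1).
Let len := (Num.truncn (4 * c * n%:R + 2)).+1.
Hypotheses (mu0 : 0 <= mu) (c0 : 0 < c) (n0 : 0 < n%:R :> R).
Hypotheses (course : ~ off_course eps G c n w) (single : ~ double_death Z n N w)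
  (few : ~ many_deaths n N (c * n%:R) w) (clear : ~ ambiguous n lo len w).

Let X t := inar Z eps t w.
Let D t := deaths Z t (X t) w.
Let cn := c * n%:R.

Let cn0 : 0 < cn. Proof. by rewrite mulr_gt0. Qed.

Let arrivals_near t : (t <= n)%N -> `|(arrivals eps t w)%:R - t%:R * mu| <= cn.
Proof. by move=> tn; rewrite leNgt; apply/negP => h; apply: course; exists t. Qed.

Let XN t : (t <= n)%N -> (X t <= N)%N.
Proof.
move=> tn; rewrite truncn_ge_nat; last by rewrite mulr_ge0 ?addr_ge0// ltW.
apply: (@le_trans _ _ (arrivals eps t w)%:R); first by rewrite ler_nat inar_le_arrivals.
have := arrivals_near tn; rewrite ler_norml => /andP[_].
rewrite lerBlDr => /le_trans; apply; rewrite mulrDl addrC lerD2r mulrC.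
by rewrite ler_wpM2l// ler_nat.
Qed.

Let D1 t : (t < n)%N -> (D t <= 1)%N.
Proof.
move=> tn; rewrite leqNgt; apply/negP => h; apply: single.
exists t; first by rewrite mem_iota.
by apply: (leq_trans h); apply: leq_deaths; apply: XN; exact: ltnW.
Qed.

Let sum_D t : (t <= n)%N -> \sum_(s < t) (D s)%:R <= cn.
Proof.
move=> tn; apply: (@le_trans _ _ (\sum_(s < n) (deaths Z s N w)%:R)); last first.
  by rewrite leNgt; apply/negP => h; apply: few; exact: ltW.
apply: (@le_trans _ _ (\sum_(s < t) (deaths Z s N w)%:R)).
  apply: ler_sum => s _; rewrite ler_nat; apply: leq_deaths; apply: XN.
  by rewrite ltnW// (leq_trans (ltn_ord s)).
rewrite -!(big_mkord xpredT (fun s => (deaths Z s N w)%:R)).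
by rewrite [leRHS](big_cat_nat (n := t))//= lerDl sumr_ge0.
Qed.

Let X_near t : (t <= n)%N -> `|(X t)%:R - t%:R * mu| <= 2 * cn.
Proof.
move=> tn; have := arrivals_near tn; rewrite !ler_norml => /andP[a1 a2].
have x1 : (X t)%:R <= (arrivals eps t w)%:R :> R by rewrite ler_nat inar_le_arrivals.
have x2 : (arrivals eps t w)%:R <= (X t)%:R + \sum_(s < t) (D s)%:R :> R.
  by rewrite -natr_sum -natrD ler_nat; exact: inar_ge_arrivals.
have := sum_D tn; move: cn0 a1 a2 x1 x2; move: (\sum_(s < t) _) cn.
move=> S C; set a : R := (arrivals _ _ _)%:R; set x : R := (X t)%:R; set y := t%:R * mu.
by move=> *; apply/andP; split; lra.
Qed.

Lemma mean_estimate : `|(X n)%:R / n%:R - mu| <= 2 * c.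
Proof.
have -> : (X n)%:R / n%:R - mu = ((X n)%:R - n%:R * mu) / n%:R by field; rewrite gt_eqF.
by rewrite normrM normfV [`|n%:R|]ger0_norm ?ler_pdivrMr ?(ltW n0)// -mulrA X_near.
Qed.

(** With at most one death, the process decreases exactly when there is a death and
    no arrival. *)
Lemma decreases_proxy t : (t < n)%N ->
  (X t.+1 < X t)%N = proxy Z eps (fun t => Num.truncn (t%:R * mu)) t w.
Proof.
move=> tn; rewrite /proxy.
suff <- : D t = deaths Z t (Num.truncn (t%:R * mu)) w.
  have := inarS Z eps t w; rewrite -/(X t) -/(X t.+1) -/(D t); have := D1 tn.
  by move: (X t.+1) (X t) (D t) (eps t w) => x' x D' e'; clear; case: eqP; lia.
have tmu : 0 <= t%:R * mu by rewrite mulr_ge0.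
have lo_le x : t%:R * mu - 2 * c * n%:R - 1 <= x%:R -> (lo t <= x)%N.
  move=> h; have [p|p] := leP 0 (t%:R * mu - 2 * c * n%:R - 1).
    by rewrite -(ler_nat R) (le_trans _ h)// truncn_le.
  by rewrite /lo (@truncn0Pn _ _ _) // -ltNge (lt_le_trans p).
have lo_ge x : x%:R <= t%:R * mu + 2 * c * n%:R -> (x <= lo t + len)%N.
  have := truncnS_gt (t%:R * mu - 2 * c * n%:R - 1).
  have := truncnS_gt (4 * c * n%:R + 2).
  rewrite -/(lo t) -/len -(ler_nat R) natrD -[(lo t).+1%:R]natr1 => h1 h2 h3.
  set L : R := (lo t)%:R in h2 *; set l : R := len%:R in h1 *.
  set x' : R := x%:R in h3 *; set y := t%:R * mu in h2 h3; set k := c * n%:R.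
  move: h1 h2 h3; rewrite -!mulrA -/k; lra.
apply: (unambiguous_deaths clear tn).
  have := X_near (ltnW tn); rewrite ler_norml /cn => /andP[x1 x2].
  by apply/andP; split; [apply: lo_le|apply: lo_ge]; move: x1 x2; set x : R := (X t)%:R;
    set y := t%:R * mu; rewrite -!mulrA; set k := c * n%:R; lra.
have m1 := truncnS_gt (t%:R * mu); have m2 : (Num.truncn (t%:R * mu))%:R <= t%:R * mu.
  by rewrite truncn_le.
rewrite -natr1 in m1.
by apply/andP; split; [apply: lo_le|apply: lo_ge]; move: m1 m2 cn0; rewrite /cn;
  set x : R := (Num.truncn _)%:R; set y := t%:R * mu; rewrite -!mulrA; set k := c * n%:R; lra.
Qed.

(** Where no individual dies, the process stays constant exactly when there is no
    arrival, so the two counts differ at most by the number of deaths. *)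
Lemma zero_estimate g0 : `|\sum_(t < n) (eps t w == 0%N)%:R - n%:R * g0| <= cn ->
  `|n%:R^-1 * \sum_(t < n) (X t.+1 == X t)%:R - g0| <= 2 * c.
Proof.
move=> h.
have -> : n%:R^-1 * \sum_(t < n) (X t.+1 == X t)%:R - g0 =
    (\sum_(t < n) (X t.+1 == X t)%:R - n%:R * g0) / n%:R by field; rewrite gt_eqF.
rewrite normrM normfV [`|n%:R|]ger0_norm ?ler_pdivrMr ?(ltW n0)// -mulrA -/cn.
have d1 : `|\sum_(t < n) (X t.+1 == X t)%:R - \sum_(t < n) (eps t w == 0%N)%:R : R| <= cn.
  rewrite -sumrB (le_trans (ler_norm_sum _ _ _))// (le_trans _ (sum_D (leqnn n)))//.
  apply: ler_sum => t _.
  have := inarS Z eps t w; rewrite -/(X t) -/(X t.+1) -/(D t).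
  case: (posnP (D t)) => [-> h1|D0 _].
    rewrite (_ : (X t.+1 == X t) = (eps t w == 0%N)) ?subrr ?normr0//.
    by move: h1; rewrite addn0 => ->; rewrite -[X in _ == X]addn0 eqn_add2l.
  apply: (@le_trans _ _ 1); last by rewrite ler1n.
  by case: (_ == _); case: (_ == _); rewrite ?subrr ?subr0 ?sub0r ?normrN ?normr0 ?normr1.
apply: (le_trans (ler_distD (\sum_(t < n) (eps t w == 0%N)%:R) _ _)).
by rewrite [2 * cn]mulr_natl mulr2n; exact: lerD.
Qed.

End deterministic.

Section statistics_of_trajectory.
Variables (n : nat) (w : Omega).

Let nth_traj t : (t <= n)%N -> nth 0%N (trajectory Z eps n w) t = inar Z eps t w.
Proof.
move=> tn; have -> : t = Ordinal (tn : (t < n.+1)%N) by [].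
by rewrite -tnth_nth tnth_mktuple.
Qed.

Lemma mu_hat_trajectory : mu_hat (trajectory Z eps n w) = (inar Z eps n w)%:R / n%:R :> R.
Proof. by rewrite /mu_hat nth_traj. Qed.

Lemma g0_hat_trajectory : g0_hat (trajectory Z eps n w) =
  n%:R^-1 * \sum_(t < n) (inar Z eps t.+1 w == inar Z eps t w)%:R :> R.
Proof.
rewrite /g0_hat big_add1 big_mkord; congr (_ * _).
by apply: eq_bigr => t _; rewrite !nth_traj ?(ltnW (ltn_ord t)).
Qed.

Lemma h_tilde_trajectory : h_tilde (trajectory Z eps n w) =
  2 * (\sum_(t < n) (inar Z eps t.+1 w < inar Z eps t w))%N%:R /
  (g0_hat (trajectory Z eps n w) * mu_hat (trajectory Z eps n w)) :> R.
Proof.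
rewrite /h_tilde big_add1 big_mkord natr_sum; congr (2 * _ / _).
apply: eq_bigr => t _; rewrite /increment !nth_traj ?(ltnW (ltn_ord t))//.
by rewrite subr_lt0 ltz_nat.
Qed.

End statistics_of_trajectory.

(** Chebyshev's inequality for the indicators of no arrival. *)
Lemma zero_arrivals_near (G : probability nat R) : admissible G ->
  forall c e : R, 0 < c -> 0 < e -> \forall n \near \oo,
    forall (P : probability Omega R) (theta : R), inar_noise Z eps P theta G ->
      Pr P [set w | c * n%:R <=
        `|\sum_(t < n) (eps t w == 0%N)%:R - n%:R * pmf_nat G 0|] <= e.
Proof.
move=> Gadm c e c0 e0.
pose f (k : nat) : R := (k == 0%N)%:R.
have fE : f = \1_[set 0%N].
  apply/funext => k; rewrite /f indicE; congr (nat_of_bool _)%:R.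
  by apply/idP/idP => [/eqP->|/set_mem/= ->//]; exact: mem_set.
have f2 : f \in Lfun G 2%:E.
  apply: Lfun2_sqr => //; apply: (@le_lt_trans _ _ (\int[G]_k (cst 1 k))%E).
    apply: ge0_le_integral => //.
    - by move=> k _; rewrite lee_fin sqr_ge0.
    - by move=> k _; rewrite lee_fin /f; case: (_ == _); rewrite ?expr1n ?expr0n.
  by rewrite integral_cst// mul1e (le_lt_trans (probability_le1 _ _)) ?ltry.
have Em : ('E_G[f] = (pmf_nat G 0)%:E)%E.
  by rewrite fE expectation_indic// pmf_natE.
pose v := fine ('V_G[f])%E.
have Vv : ('V_G[f] = v%:E)%E by rewrite /v fineK// variance_fin_num.
have v0 : 0 <= v by rewrite fine_ge0// variance_ge0.
near=> n => P theta hP.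
have n0 : 0 < n%:R :> R.
  by apply: (@lt_le_trans _ _ 1) => //; near: n; exact: nbhs_infty_ger.
have nv : v / c ^+ 2 / e <= n%:R by near: n; exact: nbhs_infty_ger.
have f0 k : 0 <= f k by [].
apply: (le_trans (eps_chebyshev hP f0 f2 Em Vv n (mulr_gt0 c0 n0))).
have -> : n%:R * v / (c * n%:R) ^+ 2 = v / c ^+ 2 / n%:R.
  by field; rewrite !gt_eqF.
by move: nv; rewrite (ler_pdivrMr _ _ e0) (ler_pdivrMr _ _ n0) [e * _]mulrC.
Unshelve. all: by end_near. Qed.

Section good_near.
Variable P : R -> probability nat R -> probability Omega R.
Hypothesis hP : forall (theta : R) (G : probability nat R), 0 <= theta <= 1 ->
  inar_noise Z eps (P theta G) theta G.

(** The exceptional event [B] is a union of five.  The probabilities of four of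
    them tend to 0.  An ambiguous death has a probability of about [4 * c * h],
    which the choice of [c] makes small. *)
Lemma good_event_near (G : probability nat R) (h e eta : R) : admissible G -> 0 <= h ->
  0 < e -> 0 < eta -> \forall n \near \oo, exists2 B : set Omega,
    measurable B /\ Pr (P (1 - h / n%:R ^+ 2) G) B <= e &
    forall w, ~ B w -> let x := trajectory Z eps n w in
      [/\ h_tilde x = 2 * (proxy_count Z eps
            (fun t => Num.truncn (t%:R * mean_nat G)) n w)%:R / (g0_hat x * mu_hat x) :> R,
        `|g0_hat x - pmf_nat G 0| <= eta & `|mu_hat x - mean_nat G| <= eta].
Proof.
move=> Gadm h0 e0 eta0.
set mu := mean_nat G.
have mu0 : 0 <= mu by exact/ltW/admissible_mean_gt0.
pose c := Num.min (eta / 2) (e / 24 / (h + 1)).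
have h10 : 0 < h + 1 by rewrite ltr_pwDr.
have c0 : 0 < c by rewrite lt_min !divr_gt0.
have ceta : 2 * c <= eta by rewrite mulrC -ler_pdivlMr// ge_min lexx.
have ch : 4 * c * h <= e / 6.
  have : c <= e / 24 / (h + 1) by rewrite ge_min lexx orbT.
  rewrite ler_pdivlMr// mulrDr mulr1 => hc.
  have hc4 : 4 * c * h = 4 * (c * h) by ring.
  by rewrite hc4; move: hc c0; set k := c * h; lra.
clearbody c.
have e6 : 0 < e / 6 by rewrite divr_gt0.
have C0 : 0 <= mu + c by rewrite addr_ge0// ltW.
near=> n.
have th : 0 <= 1 - h / n%:R ^+ 2 <= 1 by near: n; exact: theta_near.
have n0 : 0 < n%:R :> R.
  by apply: (@lt_le_trans _ _ 1) => //; near: n; exact: nbhs_infty_ger.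
have hPn := hP G th.
set Pn := P _ G in hPn *.
pose N := Num.truncn ((mu + c) * n%:R).
have NC : N%:R <= (mu + c) * n%:R by rewrite truncn_le mulr_ge0.
pose lo t := Num.truncn (t%:R * mu - 2 * c * n%:R - 1).
pose len := (Num.truncn (4 * c * n%:R + 2)).+1.
have b1 : Pr Pn (off_course eps G c n) <= e / 6.
  suff : forall (Q : probability Omega R) (theta : R), 0 <= theta <= 1 ->
    inar_noise Z eps Q theta G -> Pr Q (off_course eps G c n) <= e / 6 by apply; eassumption.
  by near: n; exact: uniform_lln.
have b2 : Pr Pn (double_death Z n N) <= e / 6.
  have : forall (Q : probability Omega R) (H : probability nat R) M,
    0 <= 1 - h / n%:R ^+ 2 <= 1 -> inar_noise Z eps Q (1 - h / n%:R ^+ 2) H ->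
    M%:R <= (mu + c) * n%:R -> Pr Q (double_death Z n M) <= e / 6.
    by near: n; exact: double_death_near.
  by move=> /(_ _ _ _ th hPn NC).
pose E0 := [set w | c * n%:R <= `|\sum_(t < n) (eps t w == 0%N)%:R - n%:R * pmf_nat G 0|].
have b3 : Pr Pn E0 <= e / 6.
  suff : forall (Q : probability Omega R) (theta : R), inar_noise Z eps Q theta G ->
    Pr Q E0 <= e / 6 by apply; eassumption.
  by rewrite /E0; near: n; exact: zero_arrivals_near.
have b4 : Pr Pn (many_deaths n N (c * n%:R)) <= e / 6.
  have nk : (mu + c) * h / c / (e / 6) <= n%:R by near: n; exact: nbhs_infty_ger.
  apply: (le_trans (Pr_many_deaths th hPn _ _ (mulr_gt0 c0 n0))).
  rewrite opprB addrC subrK.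
  apply: (@le_trans _ _ (n%:R * ((mu + c) * n%:R * (h / n%:R ^+ 2)) / (c * n%:R))).
    rewrite ler_wpM2r ?invr_ge0 ?ler_wpM2l ?ler_wpM2r// ?divr_ge0 ?exprn_ge0//.
    by rewrite ltW// mulr_gt0.
  have -> : n%:R * ((mu + c) * n%:R * (h / n%:R ^+ 2)) / (c * n%:R) =
      (mu + c) * h / c / n%:R by field; rewrite !gt_eqF.
  by move: nk; rewrite (ler_pdivrMr _ _ e6) (ler_pdivrMr _ _ n0) [e / 6 * _]mulrC.
have b5 : Pr Pn (ambiguous n lo len) <= e / 6 + e / 6.
  have nk : 3 * h / (e / 6) <= n%:R by near: n; exact: nbhs_infty_ger.
  apply: (le_trans (Pr_ambiguous th hPn _ _ _)).
  rewrite opprB addrC subrK.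
  have l3 : len%:R <= 4 * c * n%:R + 3.
    have : (Num.truncn (4 * c * n%:R + 2))%:R <= 4 * c * n%:R + 2.
      by rewrite truncn_le addr_ge0// !mulr_ge0// ltW.
    by rewrite /len -natr1; set k := 4 * c * n%:R; set l : R := (Num.truncn _)%:R; lra.
  apply: (@le_trans _ _ (n%:R * ((4 * c * n%:R + 3) * (h / n%:R ^+ 2)))).
    by rewrite ler_wpM2l ?ler_wpM2r// divr_ge0 ?exprn_ge0.
  have -> : n%:R * ((4 * c * n%:R + 3) * (h / n%:R ^+ 2)) = 4 * c * h + 3 * h / n%:R.
    by field; rewrite gt_eqF.
  by apply: lerD => //; move: nk; rewrite (ler_pdivrMr _ _ e6) (ler_pdivrMr _ _ n0) [e / 6 * _]mulrC.
have mE0 : measurable E0.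
  apply: (@dep_noise_measurable _ _ Z eps [seq inr s | s <- iota 0 n]) => w w' ww'.
  rewrite /E0/=; suff -> : \sum_(t < n) (eps t w == 0%N)%:R =
    \sum_(t < n) (eps t w' == 0%N)%:R :> R by [].
  apply: eq_bigr => t _; rewrite (_ : eps t w = eps t w')//.
  by apply: (ww' (inr (val t))); apply: map_f; rewrite mem_iota/=.
have mO := measurable_off_course Z eps G c n.
have mD := measurable_double_death Z eps n N.
have mM := measurable_many_deaths n N (c * n%:R).
have mA := measurable_ambiguous n lo len.
exists (off_course eps G c n `|` (double_death Z n N `|` (E0 `|`
    (many_deaths n N (c * n%:R) `|` ambiguous n lo len)))).
  split; first by do ![apply: measurableU => //].
  have m4 := measurableU _ _ mM mA.
  have m3 := measurableU _ _ mE0 m4.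
  have m2 := measurableU _ _ mD m3.
  have := PrU_le Pn mO m2; have := PrU_le Pn mD m3.
  have := PrU_le Pn mE0 m4; have := PrU_le Pn mM mA.
  move: b1 b2 b3 b4 b5; set p1 := Pr Pn (off_course _ _ _ _); set p2 := Pr Pn (double_death _ _ _).
  set p3 := Pr Pn E0; set p4 := Pr Pn (many_deaths _ _ _); set p5 := Pr Pn (ambiguous _ _ _).
  set q1 := Pr Pn (_ `|` (_ `|` (_ `|` (_ `|` _)))); set q2 := Pr Pn (_ `|` (_ `|` (_ `|` _))).
  by set q3 := Pr Pn (_ `|` (_ `|` _)); set q4 := Pr Pn (_ `|` _); lra.
move=> w /not_orP[nO /not_orP[nD /not_orP[nE /not_orP[nM nA]]]]; split.
- rewrite h_tilde_trajectory; congr (2 * (_)%:R / _).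
  rewrite /proxy_count; apply: eq_bigr => t _.
  by rewrite (decreases_proxy mu0 c0 n0 nO nD nM nA).
- rewrite g0_hat_trajectory; apply: le_trans ceta.
  apply: (zero_estimate mu0 c0 n0 nO nM).
  by rewrite ltW// ltNge; apply/negP.
- rewrite mu_hat_trajectory; apply: le_trans ceta.
  exact: (mean_estimate mu0 c0 n0 nO nM).
Unshelve. all: by end_near. Qed.

End good_near.

End good_event.

(** * Weak convergence of the estimator *)

Section mixtures.
Context {d : measure_display} {T : measurableType d} {R : realType}.
Variable Q : probability T R.

(** Outside a rare event, and as long as [N] is below [K], the value of [g] is nearly
    a function of [N]; the bound [M] pays for the rest. *)
Lemma Ex_near_mixture (N : T -> nat) (g : T -> R) (v : nat -> R) (B : set T) (K : nat)
    (M eta : R) :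
  (forall k, measurable [set w | N w = k]) -> measurable_fun setT g -> measurable B ->
  (forall w, `|g w| <= M) -> (forall k, `|v k| <= M) -> 0 <= eta ->
  (forall w, ~ B w -> (N w < K)%N -> `|g w - v (N w)| <= eta) ->
  `|Ex Q g - \sum_(k < K) v k * Pr Q [set w | N w = k]| <=
    eta + 2 * M * Pr Q B + M * (1 - \sum_(k < K) Pr Q [set w | N w = k]).
Proof.
move=> mN mg mB gM vM eta0 near_v.
have M0 w : 0 <= M := le_trans (normr_ge0 _) (gM w).
pose I k := \1_[set w | N w = k] : T -> R.
have bI k : bmeas (I k) by apply: bmeas_indic; exact: mN.
have bg : bmeas g by split => //; exists M.
have bS (c : nat -> R) : bmeas (fun w => \sum_(k <- iota 0 K) c k * I k w).
  by apply: bmeas_sum => k; exact/bmeasZ/bI.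
have ExS (c : nat -> R) : Ex Q (fun w => \sum_(k <- iota 0 K) c k * I k w) =
    \sum_(k < K) c k * Pr Q [set w | N w = k].
  rewrite Ex_sum; last by move=> k; exact/bmeasZ/bI.
  have -> : iota 0 K = index_iota 0 K by rewrite /index_iota subn0.
  rewrite big_mkord; apply: eq_bigr => k _; rewrite ExZ; last exact: bI.
  by rewrite Ex_indic.
have S_val (c : nat -> R) w : \sum_(k <- iota 0 K) c k * I k w =
    if (N w < K)%N then c (N w) else 0.
  have Iw k : I k w = (k == N w)%:R.
    rewrite /I indicE; congr (nat_of_bool _)%:R.
    by apply/idP/eqP => [/set_mem/= ->//|->]; exact: mem_set.
  case: ifPn => NK.
    rewrite (bigD1_seq (N w)) ?iota_uniq ?mem_iota//= Iw eqxx mulr1 big1 ?addr0// => k kN.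
    by rewrite Iw (negbTE kN) mulr0.
  rewrite big_seq big1// => k; rewrite mem_iota/= => kK.
  rewrite Iw; case: eqP => [kN|_]; last by rewrite mulr0.
  by rewrite -kN kK in NK.
have one_sum : \sum_(k < K) Pr Q [set w | N w = k] =
    Ex Q (fun w => \sum_(k <- iota 0 K) 1 * I k w).
  by rewrite ExS; apply: eq_bigr => k _; rewrite mul1r.
have bB := bmeas_indic (R := R) mB.
rewrite -ExS one_sum -ExN// -ExD//; last exact: bmeasN.
have -> : eta + 2 * M * Pr Q B + M * (1 - Ex Q (fun w => \sum_(k <- iota 0 K) 1 * I k w)) =
    Ex Q (fun w => (cst eta w + 2 * M * \1_B w) +
      M * (cst 1 w + - \sum_(k <- iota 0 K) 1 * I k w)).
  have b1 := bS (fun=> 1); have bNK := bmeasN b1; have b2 := bmeasZ (2 * M) bB.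
  have b3 := bmeasD (bmeas_cst 1) bNK; have b4 := bmeasD (bmeas_cst eta) b2.
  rewrite (ExD _ b4 (bmeasZ M b3)) (ExD _ (bmeas_cst eta) b2) (ExZ _ _ bB) (ExZ _ _ b3).
  by rewrite (ExD _ (bmeas_cst 1) bNK) (ExN _ b1) !Ex_cst Ex_indic.
apply: Ex_abs_le.
- by apply: bmeasD => //; exact: bmeasN.
- apply: bmeasD; first by apply: bmeasD; [exact: bmeas_cst|exact: bmeasZ].
  by apply/bmeasZ/bmeasD; [exact: bmeas_cst|exact/bmeasN/bS].
move=> w; rewrite !S_val /cst indicE.
have g1 := gM w; have v1 := vM (N w); have gv := ler_normB (g w) (v (N w)); have Mw := M0 w.
have [Bw|nB] := boolP (w \in B); case: ifPn => NK /=; rewrite ?mulr1 ?mulr0 ?subr0 ?subrr.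
- by rewrite mulr0 addr0 (le_trans gv)// [2 * M]mulr_natl mulr2n ler_wpDl// lerD.
- by rewrite mulr1 ler_wpDl// addr_ge0// mulr_ge0.
- by rewrite mulr0 !addr0 near_v// => Bw; move/negP: nB; apply; exact: mem_set.
- by rewrite mulr1 addr0 ler_wpDl.
Qed.

End mixtures.

Section estimator.
Context {R : realType} {d : measure_display} {Omega : measurableType d}.
Variables (Z : nat -> nat -> {mfun Omega >-> bool})
          (eps : nat -> {mfun Omega >-> nat})
          (P : R -> probability nat R -> probability Omega R).
Hypothesis hP : forall (theta : R) (G : probability nat R), 0 <= theta <= 1 ->
  inar_noise Z eps (P theta G) theta G.

Lemma finite_modulus (f : R -> R) (x : nat -> R) (K : nat) (eta : R) :
  continuous f -> 0 < eta -> exists2 delta, 0 < delta &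
  forall k y, (k < K)%N -> `|y - x k| <= delta -> `|f y - f (x k)| <= eta.
Proof.
move=> cf eta0; elim: K => [|K [d1 d10 h1]]; first by exists 1.
have /cvgrPdist_le/(_ _ eta0)/nbhs_ballP[d2 /= d20 h2] := cf (x K).
exists (Num.min d1 (d2 / 2)); first by rewrite lt_min d10 divr_gt0.
move=> k y; rewrite ltnS leq_eqVlt => /predU1P[->|kK]; rewrite le_min => /andP[y1 y2].
  rewrite distrC; apply: h2; rewrite /ball/= distrC (le_lt_trans y2)//.
  by rewrite ltr_pdivrMr// ltr_pMr// ltr1n.
exact: h1.
Qed.

Lemma inv_product_near (a b delta : R) : 0 < a -> 0 < b -> 0 < delta ->
  exists2 eta, 0 < eta & forall x y, `|x - a| <= eta -> `|y - b| <= eta ->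
    `|2 / (x * y) - 2 / (a * b)| <= delta.
Proof.
move=> a0 b0 d0.
have cv : 2 / (z.1 * z.2) @[z --> (a, b)] --> 2 / (a * b).
  apply: cvgM; first exact: cvg_cst.
  apply: cvgV; first by rewrite gt_eqF// mulr_gt0.
  by apply: cvgM; [exact: cvg_fst|exact: cvg_snd].
have /cvgrPdist_le/(_ _ d0)/nbhs_ballP[r /= r0 hr] := cv.
exists (r / 2); first by rewrite divr_gt0.
have r2 : r / 2 < r by rewrite ltr_pdivrMr// ltr_pMr// ltr1n.
move=> x y xa yb; rewrite distrC; apply: (hr (x, y)).
by split; rewrite /ball/= distrC; [exact: le_lt_trans xa r2|exact: le_lt_trans yb r2].
Qed.

(** On the good event the estimator is [2 * k / (x * y)] with [x] and [y] close to
    [g 0] and [mu], where [k] is the number of proxies.  The same estimate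
    [Ex_near_mixture] is applied to the estimator and to the limit law, and the
    probabilities of the finitely many values [k < K] converge. *)
Lemma h_tilde_weak_cvg (G : probability nat R) (h : R) : admissible G -> 0 <= h ->
  weak_cvg (fun n => distribution (inar_law Z eps (P (1 - h / n%:R ^+ 2) G) n)
      (statistic (@h_tilde R n)))
    (limit_law (pmf_nat G 0 * mean_nat G / 2) h).
Proof.
move=> Gadm h0 f cf bf.
have bmf := bmeas_continuous cf bf; have [mf [M fM]] := bmf.
have M0 : 0 <= M := le_trans (normr_ge0 _) (fM 0).
have mu0 := admissible_mean_gt0 Gadm; have g0 := admissible_pmf0_gt0 Gadm.
set mu := mean_nat G in mu0 *; set g := pmf_nat G 0 in g0 *.
pose lam := g * mu / 2; rewrite -/lam.
have lam0 : 0 < lam by rewrite divr_gt0// mulr_gt0.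
have r0 : 0 <= lam * h by rewrite mulr_ge0// ltW.
pose p := pois (lam * h).
pose v (k : nat) := f (k%:R / lam).
have vM k : `|v k| <= M by exact: fM.
pose Q n := P (1 - h / n%:R ^+ 2) G.
pose C n := proxy_count Z eps (fun t => Num.truncn (t%:R * mu)) n.
pose a n k := Pr (Q n) [set w | C n w = k].
have ap k : a n k @[n --> \oo] --> p k by exact: proxy_count_poisson.
pose Y n w : R := h_tilde (trajectory Z eps n w).
pose E n := Ex (Q n) (fun w => f (Y n w)).
pose L := Ex (limit_law lam h) f.
suff EL : E n @[n --> \oo] --> L.
  rewrite (ExE _ bmf) -/L.
  rewrite (_ : (fun n => _) = EFin \o E); last first.
    by apply/funext => n; rewrite (ExE _ bmf) Ex_statistic.
  by apply: cvg_EFin; [exact: nearW|exact: EL].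
have mC n k : measurable [set w | C n w = k].
  exact: (measurable_proxy_count Z eps _ n [set i | i = k]).
have mY n : measurable_fun setT (fun w => f (Y n w)).
  apply: (measurableT_comp mf).
  move=> _ A mA.
  exact: (@measurable_trajectory _ _ Z eps n measurableT _
    (measurable_tuple_nat (@h_tilde R n @^-1` A))).
have LK K : `|L - \sum_(k < K) v k * p k| <= M * (1 - \sum_(k < K) p k).
  have LE : L = Ex (poisson_prob (lam * h) 0%N) (fun k => f (rescale lam k)).
    rewrite /L /limit_law /Ex /Rintegral integral_distribution//.
    - exact/measurable_EFinP.
    - apply: (@bmeas_integrable _ _ R _ (f \o rescale lam)).
      by split; [exact: measurableT_comp|exists M => k; exact: fM].
  have pE k : Pr (poisson_prob (lam * h) 0%N) [set j | j = k] = p k.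
    exact: poisson_pmf_nat.
  have := @Ex_near_mixture _ nat R (poisson_prob (lam * h) 0%N) id (fun k => f (rescale lam k))
    v set0 K M 0.
  rewrite Pr_set0 mulr0 addr0 add0r LE.
  rewrite (eq_bigr (fun k : 'I_K => v k * p k)); last by move=> k _; rewrite pE.
  rewrite [X in 1 - X](eq_bigr (fun k : 'I_K => p k)); last by move=> k _; rewrite pE.
  by apply => // k; rewrite /v /rescale subrr normr0.
have aK K (c : nat -> R) : (\sum_(k < K) c k * a n k) @[n --> \oo] --> \sum_(k < K) c k * p k.
  elim: K => [|K IH].
    by rewrite big_ord0; under eq_cvg do rewrite big_ord0; exact: cvg_cst.
  rewrite big_ord_recr/=; under eq_cvg do rewrite big_ord_recr/=.
  by apply: cvgD => //; apply: cvgM; [exact: cvg_cst|exact: ap].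
apply/cvgrPdist_le => e e0.
have e8 : 0 < e / 8 by rewrite divr_gt0.
pose t := e / 8 / (M + 1).
have M1 : 0 < M + 1 by rewrite ltr_pwDr.
have t0 : 0 < t by rewrite divr_gt0.
have tM : M * t <= e / 8.
  have -> : M * t = e / 8 * (M / (M + 1)) by rewrite /t; field; rewrite gt_eqF.
  by rewrite ler_piMr ?(ltW e8)// ler_pdivrMr// mul1r lerDl.
have [K hK] : exists K, 1 - \sum_(k < K) p k <= t.
  have [K /(_ K (leqnn K)) hK] := pmf_nat_tail (poisson_prob (lam * h) 0%N) t0.
  exists K; rewrite (eq_bigr (fun k : 'I_K => pmf_nat (poisson_prob (lam * h) 0%N) k)).
    by rewrite lerBlDr addrC -lerBlDr.
  by move=> k _; rewrite poisson_pmf_nat.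
have [delta d0 hd] := finite_modulus (fun k => k%:R / lam) K cf e8.
have d'0 : 0 < delta / (K%:R + 1) by rewrite divr_gt0// ltr_pwDr.
have [eta eta0 heta] := inv_product_near g0 mu0 d'0.
have good := good_event_near hP Gadm h0 t0 eta0.
have /cvgrPdist_le/(_ _ t0) near1 := aK K (fun=> 1).
have /cvgrPdist_le/(_ _ e8) near2 := aK K v.
near=> n.
have [B [mB PB] hB] : exists2 B : set Omega, measurable B /\ Pr (Q n) B <= t &
    forall w, ~ B w -> let x := trajectory Z eps n w in
      [/\ h_tilde x = 2 * (C n w)%:R / (g0_hat x * mu_hat x) :> R,
        `|g0_hat x - g| <= eta & `|mu_hat x - mu| <= eta] by near: n; exact: good.
have s1 : `|\sum_(k < K) 1 * p k - \sum_(k < K) 1 * a n k| <= t by near: n; exact: near1.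
have s2 : `|\sum_(k < K) v k * p k - \sum_(k < K) v k * a n k| <= e / 8.
  by near: n; exact: near2.
have m1 := @Ex_near_mixture _ _ _ (Q n) (C n) (fun w => f (Y n w)) v B K M (e / 8) (mC n) (mY n)
  mB (fun w => fM _) vM (ltW e8).
have /m1 : forall w, ~ B w -> (C n w < K)%N -> `|f (Y n w) - v (C n w)| <= e / 8.
  move=> w nB CK; apply: hd => //; have [yE gE mE] := hB w nB.
  rewrite /Y yE; set x := trajectory _ _ _ _ in gE mE *.
  have -> : 2 * (C n w)%:R / (g0_hat x * mu_hat x) - (C n w)%:R / lam =
      (C n w)%:R * (2 / (g0_hat x * mu_hat x) - 2 / (g * mu)) :> R.
    by rewrite /lam invf_div; ring.
  rewrite normrM ger0_norm// (le_trans (ler_wpM2l _ (heta _ _ gE mE)))//.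
  rewrite mulrA ler_pdivrMr ?ltr_pwDr// mulrC ler_wpM2l ?(ltW d0)//.
  by rewrite (@le_trans _ _ K%:R) ?lerDl// ler_nat ltnW.
rewrite -/(E n) => m2; have l2 := LK K.
have MB : 2 * M * Pr (Q n) B <= e / 8 + e / 8.
  have : M * Pr (Q n) B <= e / 8 by apply: le_trans tM; rewrite ler_wpM2l.
  by rewrite -mulrA mulr_natl mulr2n => ?; exact: lerD.
have Mp : M * (1 - \sum_(k < K) p k) <= e / 8 by apply: le_trans tM; rewrite ler_wpM2l.
have Ma : M * (1 - \sum_(k < K) Pr (Q n) [set w | C n w = k]) <= e / 8 + e / 8.
  have : M * (1 - \sum_(k < K) a n k) <= M * (t + t).
    rewrite ler_wpM2l//; move: hK s1; rewrite -!mulr_sumr !mul1r ler_norml => + /andP[_].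
    by rewrite /a; set y := \sum_(k < K) p k; set z := \sum_(k < K) _; lra.
  by move=> /le_trans; apply; rewrite mulrDr lerD.
move: m2 l2 s2 MB Mp Ma; rewrite /a !ler_norml.
set A := 2 * M * _; set b := M * (1 - \sum_(k < K) p k); set c := M * _.
set D := \sum_(k < K) v k * p k; set F := \sum_(k < K) v k * _.
clear -e0; move: (E n) => En.
move=> /andP[u1 u2] /andP[u3 u4] /andP[u5 u6] u7 u8 u9; apply/andP; split; lra.
Unshelve. all: by end_near. Qed.

End estimator.

Theorem corollary4p3 (R : realType) (d : measure_display)
    (Omega : measurableType d)
    (Z : nat -> nat -> {mfun Omega >-> bool})
    (eps : nat -> {mfun Omega >-> nat})
    (P : R -> probability nat R -> probability Omega R)
    (hP : forall (theta : R) (G : probability nat R), 0 <= theta <= 1 ->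
      inar_noise Z eps (P theta G) theta G) :
  (forall (T : forall n : nat, n.+1.-tuple nat -> R)
      (L : R -> probability nat R -> probability R R),
    asymptotically_unbiased Z eps P T L ->
    forall (h : R) (G : probability nat R), 0 <= h -> admissible G ->
      ((variance_bound h G)%:E <= \int[L h G]_z ((z - h) ^+ 2)%:E)%E) /\
  (exists L : R -> probability nat R -> probability R R,
    asymptotically_unbiased Z eps P (@h_tilde R) L /\
    forall (h : R) (G : probability nat R), 0 <= h -> admissible G ->
      (\int[L h G]_z ((z - h) ^+ 2)%:E)%E = (variance_bound h G)%:E).
Proof.
split=> [T L TL h G h0 Gadm|]; first exact: (variance_lower_bound hP TL).
pose lam (G : probability nat R) := pmf_nat G 0 * mean_nat G / 2.
have lam0 G : admissible G -> 0 < lam G.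
  by move=> Gadm; rewrite divr_gt0 ?mulr_gt0 ?admissible_pmf0_gt0 ?admissible_mean_gt0.
exists (fun h G => limit_law (lam G) h); split=> [h G h0 Gadm|h G h0 Gadm].
  by split; [exact: h_tilde_weak_cvg|apply: limit_law_mean => //; exact: lam0].
rewrite limit_law_variance ?lam0// /variance_bound /lam invf_div mulrA.
by rewrite [h * 2]mulrC.
Qed.
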